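(* Let $s$ be a nonnegative integer and suppose that $V_j^0\in H^s(\mathbb{R})\cap L^1(\mathbb{R})$ for $j=1,2$, where $V_j^0=V_j(\cdot,0)$. Then the vector solutions $V_1$ of the thermoelastic Bresse system of Type I and $V_2$ of the thermoelastic Bresse system of Type III satisfy the following decay estimates, for all nonnegative integers $n,r$ with $n+r\le s$, where $C_1,C_2$ are two positive constants (independent of $t$ and of the initial data): (1) If $\frac{\rho_1}{\rho_2}=\frac{k}{b}$ and $k=k_0$, then for $j=1,2$ and all $t\ge 0$, $$\|\partial_x^{n}V_j(t)\|_{L^2(\mathbb{R})}\le C_1(1+t)^{-\frac18-\frac n4}\|V_j^0\|_{L^1(\mathbb{R})}+C_2(1+t)^{-\frac r4}\|\partial_x^{n+r}V_j^0\|_{L^2(\mathbb{R})}.$$ (2) If $\frac{\rho_1}{\rho_2}\ne\frac{k}{b}$ or $k\ne k_0$, then for $j=1,2$ and all $t\ge 0$, $$\|\partial_x^{n}V_j(t)\|_{L^2(\mathbb{R})}\le C_1(1+t)^{-\frac18-\frac n4}\|V_j^0\|_{L^1(\mathbb{R})}+C_2(1+t)^{-\frac r6}\|\partial_x^{n+r}V_j^0\|_{L^2(\mathbb{R})}.$$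
   Context: All of $\alpha_1,\alpha_2,\rho_1,\rho_2,\gamma,b,k,k_0,k_1,k_2,l,m_1,m_2$ are positive constants (coefficients of the systems). Thermoelastic Bresse system of Type I (Cauchy problem on $\mathbb{R}\times(0,\infty)$, unknowns $\varphi,\psi,\omega,\theta_1,\theta_2$): $$\rho_1\varphi_{tt}-k(\varphi_x-\psi-l\omega)_x-k_0l(\omega_x-l\varphi)+l\gamma\theta_1=0,$$ $$\rho_2\psi_{tt}-b\psi_{xx}-k(\varphi_x-\psi-l\omega)+\gamma\theta_{2x}=0,$$ $$\rho_1\omega_{tt}-k_0(\omega_x-l\varphi)_x-kl(\varphi_x-\psi-l\omega)+\gamma\theta_{1x}=0,$$ $$\theta_{1t}-k_1\theta_{1xx}+m_1(\omega_x-l\varphi)_t=0,\qquad \theta_{2t}-k_2\theta_{2xx}+m_2\psi_{xt}=0,$$ with prescribed initial data for $(\varphi,\varphi_t,\psi,\psi_t,\omega,\omega_t,\theta_1,\theta_2)$ at $t=0$. Its vector solution is $$V_1=\Big(\rho_1^{1/2}\varphi_t,\ \rho_2^{1/2}\psi_t,\ \rho_1^{1/2}\omega_t,\ (\tfrac{\gamma}{m_1})^{1/2}\theta_1,\ (\tfrac{\gamma}{m_2})^{1/2}\theta_2,\ b^{1/2}\psi_x,\ k^{1/2}(\varphi_x-\psi-l\omega),\ k_0^{1/2}(\omega_x-l\varphi)\Big).$$ Thermoelastic Bresse system of Type III (Cauchy problem on $\mathbb{R}\times(0,\infty)$): $$\rho_1\varphi_{tt}-k(\varphi_x-\psi-l\omega)_x-k_0l(\omega_x-l\varphi)+l\gamma\theta_{1t}=0,$$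 $$\rho_2\psi_{tt}-b\psi_{xx}-k(\varphi_x-\psi-l\omega)+\gamma\theta_{2xt}=0,$$ $$\rho_1\omega_{tt}-k_0(\omega_x-l\varphi)_x-kl(\varphi_x-\psi-l\omega)+\gamma\theta_{1xt}=0,$$ $$\theta_{1tt}-k_1\theta_{1xx}-\alpha_1\theta_{1xxt}+m_1(\omega_x-l\varphi)_t=0,\qquad \theta_{2tt}-k_2\theta_{2xx}-\alpha_2\theta_{2xxt}+m_2\psi_{xt}=0,$$ with prescribed initial data for $(\varphi,\varphi_t,\psi,\psi_t,\omega,\omega_t,\theta_1,\theta_2,\theta_{1t},\theta_{2t})$ at $t=0$. Its vector solution is $$V_2=\Big(\rho_1^{1/2}\varphi_t,\ \rho_2^{1/2}\psi_t,\ \rho_1^{1/2}\omega_t,\ (\tfrac{\gamma}{m_1})^{1/2}\theta_{1t},\ (\tfrac{k_1\gamma}{m_1})^{1/2}\theta_{1x},\ (\tfrac{\gamma}{m_2})^{1/2}\theta_{2t},\ (\tfrac{k_2\gamma}{m_2})^{1/2}\theta_{2x},\ b^{1/2}\psi_x,\ k^{1/2}(\varphi_x-\psi-l\omega),\ k_0^{1/2}(\omega_x-l\varphi)\Big).$$ *)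

(* Defs.v *)
From HB Require Import structures.
From mathcomp Require Import all_boot all_order all_algebra.
From mathcomp Require Import all_classical all_reals all_analysis.

Set Implicit Arguments.
Unset Strict Implicit.
Unset Printing Implicit Defensive.

Import Order.TTheory GRing.Theory Num.Theory.
Import numFieldNormedType.Exports.

Local Open Scope classical_set_scope.
Local Open Scope ring_scope.

Section distributions.
Context {R : realType}.
Local Notation mu := (@lebesgue_measure R).

(** The test functions are those of C_c^oo(R). *)
Definition test_function (eta : R -> R) : Prop :=
  (forall (n : nat) (x : R), derivable (eta^`(n))%classic x 1) /\
  (exists M : R, forall x : R, M < `|x| -> eta x = 0).

(** A functional [T : (R -> R) -> R] is only ever evaluated at test functions;
    linear combinations [a *: T + T'] are taken pointwise. *)
Definition dist (f eta : R -> R) : R := Rintegral mu setT (fun x => f x * eta x).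

Definition ddx (T : (R -> R) -> R) : (R -> R) -> R := fun eta => - T (eta^`())%classic.

Definition locL1 (f : R -> R) : Prop := locally_integrable setT f.

Definition weak_derivative (n : nat) (f g : R -> R) : Prop :=
  forall eta, test_function eta -> iter n ddx (dist f) eta = dist g eta.

(** [d/dt f = T] in the sense of distributions in the space variable, with a
    classical time derivative on ]0, +oo[ and continuity up to [t = 0], so that
    [f 0] is the initial value. Time is the first argument. *)
Definition weak_evolution (f : R -> R -> R) (T : R -> (R -> R) -> R) : Prop :=
  forall eta, test_function eta ->
    {within `[0, +oo[%classic, continuous (fun t => dist (f t) eta)} /\
    (forall t : R, 0 < t -> is_derive t 1 (fun t' => dist (f t') eta) (T t eta)).

(** A function of (t, x) together with its weak first order derivatives. *)
Record wfun := WFun {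
  wval :> R -> R -> R;
  dt : R -> R -> R;
  dx : R -> R -> R }.

Definition is_wfun (f : wfun) : Prop :=
  [/\ forall t, 0 <= t -> [/\ locL1 (f t), locL1 (dt f t) & locL1 (dx f t)],
      forall t, 0 <= t -> weak_derivative 1 (f t) (dx f t) &
      weak_evolution f (fun t => dist (dt f t))].

End distributions.

Arguments wfun : clear implicits.

Section vector_valued_functions.
Context {R : realType} {m : nat}.
Local Notation mu := (@lebesgue_measure R).
Implicit Types V W : R -> 'rV[R]_m.

Definition entry V (j : 'I_m) : R -> R := fun x => V x 0 j.

(** The norm [`|v|] of the library on ['rV_m] is the sup norm. *)
Definition euclidean_norm (v : 'rV[R]_m) : R :=
  Num.sqrt (\sum_(j < m) v 0 j ^+ 2).

Definition L1norm V : \bar R := ('N[mu]_1[EFin \o (euclidean_norm \o V)])%E.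

Definition L2norm V : \bar R := ('N[mu]_2%:E[EFin \o (euclidean_norm \o V)])%E.

Definition in_L1 V : Prop := forall j, entry V j \in Lfun mu 1%E.

Definition in_L2 V : Prop := forall j, entry V j \in Lfun mu 2%:E.

Definition L2_derivative (n : nat) V W : Prop :=
  in_L2 W /\ forall j, weak_derivative n (entry V j) (entry W j).

Definition in_Hs (s : nat) V : Prop :=
  in_L2 V /\ forall n, (n <= s)%N -> exists W, L2_derivative n V W.

(** V belongs to C([0, +oo[; L^2(R)). *)
Definition L2_continuous (V : R -> R -> 'rV[R]_m) : Prop :=
  (forall t, 0 <= t -> in_L2 (V t)) /\
  (forall t0, 0 <= t0 ->
     L2norm (fun x => V t x - V t0 x)
       @[t --> within `[0, +oo[%classic (nbhs t0)] --> 0%E).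

(** The decay estimates for all orders [n + r <= s], with regularity-loss rate
    (1 + t)^(-r/q). The weak derivatives are unique almost everywhere; the
    existence of that of [V t] in L^2 is part of the conclusion. *)
Definition decay_estimates (s : nat) (C1 C2 q : R)
    (V : R -> R -> 'rV[R]_m) : Prop :=
  forall n r : nat, (n + r <= s)%N ->
  forall dV0 : R -> 'rV[R]_m, L2_derivative (n + r) (V 0) dV0 ->
  forall t : R, 0 <= t ->
  exists2 dV : R -> 'rV[R]_m, L2_derivative n (V t) dV &
    (L2norm dV <=
       (C1 * (1 + t) `^ (- (1 / 8) - n%:R / 4))%R%:E * L1norm (V 0%R) +
       (C2 * (1 + t) `^ (- (r%:R / q)))%R%:E * L2norm dV0)%E.

End vector_valued_functions.

Section bresse.
Context {R : realType}.
Variables (rho1 rho2 gamma b k k0 l : R).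
Implicit Types (phi psi omega : wfun R).

Definition shear phi psi omega : R -> R -> R :=
  fun t x => dx phi t x - psi t x - l * omega t x.

Definition stretch phi omega : R -> R -> R :=
  fun t x => dx omega t x - l * phi t x.

Section typeI.
Variables (k1 k2 m1 m2 : R).

Definition V_I phi psi omega (theta1 theta2 : R -> R -> R) :
    R -> R -> 'rV[R]_8 :=
  fun t x => \row_(j < 8)
    [:: Num.sqrt rho1 * dt phi t x;
        Num.sqrt rho2 * dt psi t x;
        Num.sqrt rho1 * dt omega t x;
        Num.sqrt (gamma / m1) * theta1 t x;
        Num.sqrt (gamma / m2) * theta2 t x;
        Num.sqrt b * dx psi t x;
        Num.sqrt k * shear phi psi omega t x;
        Num.sqrt k0 * stretch phi omega t x]`_j.

(** Finite energy weak solutions; the initial data are the values at [t = 0].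
    In the heat equations the terms (omega_x - l phi)_t and psi_xt are grouped
    with the time derivative of the temperatures. *)
Definition typeI_solution phi psi omega (theta1 theta2 : R -> R -> R) : Prop :=
  let S := shear phi psi omega in
  let N := stretch phi omega in
  [/\ is_wfun phi, is_wfun psi & is_wfun omega] /\
  L2_continuous (V_I phi psi omega theta1 theta2) /\
  [/\ weak_evolution (fun t x => rho1 * dt phi t x)
        (fun t => k *: ddx (dist (S t)) + (k0 * l) *: dist (N t)
                  - (l * gamma) *: dist (theta1 t)),
      weak_evolution (fun t x => rho2 * dt psi t x)
        (fun t => b *: ddx (ddx (dist (psi t))) + k *: dist (S t)
                  - gamma *: ddx (dist (theta2 t))),
      weak_evolution (fun t x => rho1 * dt omega t x)
        (fun t => k0 *: ddx (dist (N t)) + (k * l) *: dist (S t)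
                  - gamma *: ddx (dist (theta1 t))),
      weak_evolution (fun t x => theta1 t x + m1 * N t x)
        (fun t => k1 *: ddx (ddx (dist (theta1 t)))) &
      weak_evolution (fun t x => theta2 t x + m2 * dx psi t x)
        (fun t => k2 *: ddx (ddx (dist (theta2 t))))].

End typeI.

Section typeIII.
Variables (alpha1 alpha2 k1 k2 m1 m2 : R).

Definition V_III phi psi omega (theta1 theta2 : wfun R) : R -> R -> 'rV[R]_10 :=
  fun t x => \row_(j < 10)
    [:: Num.sqrt rho1 * dt phi t x;
        Num.sqrt rho2 * dt psi t x;
        Num.sqrt rho1 * dt omega t x;
        Num.sqrt (gamma / m1) * dt theta1 t x;
        Num.sqrt (k1 * gamma / m1) * dx theta1 t x;
        Num.sqrt (gamma / m2) * dt theta2 t x;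
        Num.sqrt (k2 * gamma / m2) * dx theta2 t x;
        Num.sqrt b * dx psi t x;
        Num.sqrt k * shear phi psi omega t x;
        Num.sqrt k0 * stretch phi omega t x]`_j.

Definition typeIII_solution phi psi omega (theta1 theta2 : wfun R) : Prop :=
  let S := shear phi psi omega in
  let N := stretch phi omega in
  [/\ is_wfun phi, is_wfun psi, is_wfun omega, is_wfun theta1 & is_wfun theta2]
  /\ L2_continuous (V_III phi psi omega theta1 theta2) /\
  [/\ weak_evolution (fun t x => rho1 * dt phi t x)
        (fun t => k *: ddx (dist (S t)) + (k0 * l) *: dist (N t)
                  - (l * gamma) *: dist (dt theta1 t)),
      weak_evolution (fun t x => rho2 * dt psi t x)
        (fun t => b *: ddx (ddx (dist (psi t))) + k *: dist (S t)
                  - gamma *: ddx (dist (dt theta2 t))),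
      weak_evolution (fun t x => rho1 * dt omega t x)
        (fun t => k0 *: ddx (dist (N t)) + (k * l) *: dist (S t)
                  - gamma *: ddx (dist (dt theta1 t))),
      weak_evolution (fun t x => dt theta1 t x + m1 * N t x)
        (fun t => k1 *: ddx (ddx (dist (theta1 t)))
                  + alpha1 *: ddx (ddx (dist (dt theta1 t)))) &
      weak_evolution (fun t x => dt theta2 t x + m2 * dx psi t x)
        (fun t => k2 *: ddx (ddx (dist (theta2 t)))
                  + alpha2 *: ddx (ddx (dist (dt theta2 t))))].

End typeIII.
End bresse.

(* Main.v *)
Require Import Defs.
From HB Require Import structures.
From mathcomp Require Import all_boot all_order all_algebra.
From mathcomp Require Import all_classical all_reals all_analysis.
From mathcomp Require Import measurable_realfun ring lra zify.

Set Implicit Arguments.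
Unset Strict Implicit.
Unset Printing Implicit Defensive.

Import Order.TTheory GRing.Theory Num.Theory.
Import numFieldNormedType.Exports.

Local Open Scope classical_set_scope.
Local Open Scope ring_scope.

(** The proof does not use the Fourier transform.  After mollification in space
    a finite energy solution lives in a space of smooth functions, all of whose
    derivatives are square integrable, on which [D = d/dx] is skew-symmetric and
    [1 - tau^2 D^2] is invertible.  There the estimate is proved by energy
    identities alone, so that this part ([skewSpace] to [smooth_decay]) is
    written for an abstract space of this kind.  The mollifiers then tend to the
    identity, and the estimate survives since its constants depend on the
    coefficients only ([weak_decay], [vector_decay]).

    Both systems are one first order system ([dynamics]) for the entries of the
    vector solution: Type I is Type III with the second temperature variable,
    the gradient [theta_x], absent and with [kappa = 0].  The energy [E] is
    dissipated only through the gradients of the temperatures ([energy_flows]).  The stretch and its velocity, together with the first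
    temperature, obey a closed system, and so do the shear, its velocity, the
    rotation and the second temperature.  In each of them the dissipation passes
    from the temperature to the other unknowns, one after the other: each unknown
    is, up to the time derivative of a bilinear functional, bounded by the
    previous ones and by a small multiple of the next one ([controlled],
    [controlled_step], [stepA1] to [stepB8]).  The sum of these functionals
    corrects the energy into a Lyapunov functional [L], equivalent to
    [E((1 - D^2)^2 y)], with [L' <= - c E(D^2 y)] ([lyapunov]).

    In Fourier variables this says that the density of the energy decays at the
    rate [xi^4 / (1 + xi^2)^4].  Its counterpart in the space variable is stated
    with [J = (1 - D^2)^-1] and [K = D J]: the weights [(1 + t)^j] turn the
    Lyapunov inequality into [(1 + t)^(r/2) E(K^r V(t)) <= C E(V(0))]
    ([decay_even], [decay_K]).  One then splits the solution by the binomial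
    expansion of [1 = (J + (1 - J))^m].  On the terms with many factors
    [1 - J = - D K] the decay of [K^r] is paid with [r] derivatives of the data:
    this is the loss of regularity ([high_decay]).  On the terms with many
    factors [J], and with [tau = (1 + t)^(1/4)], one writes [J^2] as
    [J^2 - tau^2 K^2] composed with the resolvent [(1 - tau^2 D^2)^-1]: the first
    operator stays bounded along the flow by the decay of [K^2], and every
    derivative of a resolvent of the data costs a factor [tau^-1]
    ([low_decay]).  Finally the resolvent maps integrable functions to square
    integrable ones with norm [O(tau^(-1/2))], by Agmon's inequality ([res_L1]);
    this is the exponent [1/8].

    The rate obtained is [(1 + t)^(-r/4)] whatever the speeds of propagation
    are.  It is the first estimate, and it implies the second one, whose rate
    [(1 + t)^(-r/6)] is slower. *)

(** * Spaces with a skew-symmetric derivation *)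

(** [D] is the space derivative.  The solvability of [g - tau^2 D^2 g = f] is
    what replaces Fourier multipliers: all the smoothing operators below are
    built from these resolvents. *)
Record skewSpace (R : realType) := SkewSpace {
  skew_sort :> lmodType R;
  dot : skew_sort -> skew_sort -> R;
  der : {linear skew_sort -> skew_sort};
  dotC : forall f g, dot f g = dot g f;
  dotDl : forall f g h, dot (f + g) h = dot f h + dot g h;
  dotZl : forall a f g, dot (a *: f) g = a * dot f g;
  dot_ge0 : forall f, 0 <= dot f f;
  dot_eq0 : forall f, dot f f = 0 -> f = 0;
  dot_der : forall f g, dot (der f) g = - dot f (der g);
  res_ex : forall tau f, 0 < tau -> exists g, g - tau ^+ 2 *: der (der g) = f }.

Arguments dot {R s}.
Arguments der {R s}.

Section skew_theory.
Context {R : realType} {X : skewSpace R}.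
Implicit Types f g h : X.
Local Notation D := (@der R X).

Definition nn f := dot f f.

Lemma nn_ge0 f : 0 <= nn f. Proof. exact: dot_ge0. Qed.

Lemma dotDr f g h : dot f (g + h) = dot f g + dot f h.
Proof. by rewrite dotC dotDl !(dotC f). Qed.

Lemma dotZr a f g : dot f (a *: g) = a * dot f g.
Proof. by rewrite dotC dotZl dotC. Qed.

Lemma dot0l g : dot 0 g = 0.
Proof. by rewrite -(scale0r 0) dotZl mul0r. Qed.

Lemma dot0r g : dot g 0 = 0.
Proof. by rewrite dotC dot0l. Qed.

Lemma dotNl f g : dot (- f) g = - dot f g.
Proof. by rewrite -scaleN1r dotZl mulN1r. Qed.

Lemma dotNr f g : dot f (- g) = - dot f g.
Proof. by rewrite dotC dotNl dotC. Qed.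

Definition dotE := (dotDl, dotDr, dotNl, dotNr, dotZl, dotZr).

(** Two vectors with the same products are equal: this turns the identities of the
    space into identities of numbers, within the reach of [ring]. *)
Lemma dot_ext f g : (forall h, dot f h = dot g h) -> f = g.
Proof.
move=> E; apply/eqP; rewrite -subr_eq0; apply/eqP; apply: dot_eq0.
by rewrite dotDl dotNl E subrr.
Qed.

Lemma derD f g : D (f + g) = D f + D g. Proof. exact: linearD. Qed.
Lemma derN f : D (- f) = - D f. Proof. exact: linearN. Qed.
Lemma derZ a f : D (a *: f) = a *: D f. Proof. exact: linearZZ. Qed.
Lemma der0 : D 0 = 0. Proof. exact: linear0. Qed.

Definition derE := (derD, derN, derZ).

Lemma young f g (e : R) : 0 < e -> dot f g <= e * nn f + (4 * e)^-1 * nn g.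
Proof.
move=> e0; rewrite /nn.
have := dot_ge0 ((2 * e) *: f - g); rewrite !dotE (dotC g f) => H.
rewrite -subr_ge0.
have -> : e * dot f f + (4 * e)^-1 * dot g g - dot f g = (4 * e)^-1 *
  (2 * e * (2 * e * dot f f) - 2 * e * dot f g + (- (2 * e * dot f g) + dot g g)).
  by field; lra.
apply: mulr_ge0; first by rewrite invr_ge0; lra.
lra.
Qed.

Lemma nnD f g : nn (f + g) <= 2 * nn f + 2 * nn g.
Proof.
have := dot_ge0 (f - g); rewrite /nn !dotE (dotC g f); lra.
Qed.

Lemma nnZ a f : nn (a *: f) = a ^+ 2 * nn f.
Proof. by rewrite /nn !dotE; ring. Qed.

Lemma nnN f : nn (- f) = nn f.
Proof. by rewrite /nn !dotE opprK. Qed.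

Lemma nn0 : nn 0 = 0. Proof. exact: dot0l. Qed.

Lemma nnB f g : nn (f - g) <= 2 * nn f + 2 * nn g.
Proof. by rewrite -[nn g]nnN; exact: nnD. Qed.

(** The cross terms of the square have the good sign because [D] is skew: the
    resolvents are contractions, and each derivative costs a factor [tau^-1]. *)
Lemma res_id tau f : nn (f - tau ^+ 2 *: D (D f)) =
  nn f + 2 * tau ^+ 2 * nn (D f) + tau ^+ 4 * nn (D (D f)).
Proof.
rewrite /nn !dotE (dotC (D (D f)) f) -[dot f (D (D f))]opprK -dot_der.
by ring.
Qed.

Definition res (tau : R) (f : X) : X :=
  if pselect (0 < tau) is left h then projT1 (cid (res_ex f h)) else f.

Lemma resP tau f : 0 < tau -> res tau f - tau ^+ 2 *: D (D (res tau f)) = f.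
Proof. by move=> t0; rewrite /res; case: pselect => // h; case: cid. Qed.

Lemma res_inj tau f g : 0 < tau ->
  f - tau ^+ 2 *: D (D f) = g - tau ^+ 2 *: D (D g) -> f = g.
Proof.
move=> t0 /eqP; rewrite -subr_eq0 => /eqP E.
apply/eqP; rewrite -subr_eq0; apply/eqP; apply: dot_eq0.
set h := f - g.
have h0 : nn (h - tau ^+ 2 *: D (D h)) = 0.
  rewrite -nn0 -E /h; congr nn.
  by apply: dot_ext => k; rewrite !derE !dotE; ring.
have := nn_ge0 h; have := nn_ge0 (D h); have := nn_ge0 (D (D h)).
move: h0; rewrite res_id => h0 a b c.
apply/eqP; rewrite eq_le [_ <= 0](_ : _ = true) ?andTb //.
rewrite -h0 -addrA lerDl addr_ge0 // mulr_ge0 // ?mulr_ge0 ?exprn_ge0 //; exact: ltW.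
Qed.

Lemma res_uniq tau f g : 0 < tau -> g - tau ^+ 2 *: D (D g) = f -> res tau f = g.
Proof. by move=> t0 gE; apply: (res_inj t0); rewrite resP. Qed.

Lemma resD tau f g : 0 < tau -> res tau (f + g) = res tau f + res tau g.
Proof.
move=> t0; apply: res_uniq => //.
rewrite -[in RHS](resP f t0) -[in RHS](resP g t0).
by apply: dot_ext => k; rewrite !derE !dotE; ring.
Qed.

Lemma resZ tau a f : 0 < tau -> res tau (a *: f) = a *: res tau f.
Proof.
move=> t0; apply: res_uniq => //; rewrite -[in RHS](resP f t0).
by apply: dot_ext => k; rewrite !derE !dotE; ring.
Qed.

Lemma resN tau f : 0 < tau -> res tau (- f) = - res tau f.
Proof. by move=> t0; rewrite -scaleN1r resZ // scaleN1r. Qed.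

Lemma res_der tau f : 0 < tau -> res tau (D f) = D (res tau f).
Proof.
move=> t0; apply: res_uniq => //; rewrite -[in RHS](resP f t0).
by apply: dot_ext => k; rewrite !derE !dotE; ring.
Qed.

Lemma dot_resr tau f g : 0 < tau -> dot (res tau f) g = dot f (res tau g).
Proof.
move=> t0; rewrite -[in LHS](resP g t0) -[in RHS](resP f t0).
by rewrite !dotE !dot_der !opprK; ring.
Qed.

Lemma res_bounds tau f : 0 < tau -> [/\ nn (res tau f) <= nn f,
  tau ^+ 2 * nn (D (res tau f)) <= nn f &
  tau ^+ 4 * nn (D (D (res tau f))) <= nn f].
Proof.
move=> t0.
have -> : nn f = nn (res tau f - tau ^+ 2 *: D (D (res tau f))) by rewrite resP.
rewrite res_id.
have := nn_ge0 (res tau f).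
have : 0 <= tau ^+ 2 * nn (D (res tau f)) by rewrite mulr_ge0 ?exprn_ge0 ?nn_ge0 ?ltW.
have : 0 <= tau ^+ 4 * nn (D (D (res tau f))).
  by rewrite mulr_ge0 ?exprn_ge0 ?nn_ge0 ?ltW.
by move=> a b c; split; lra.
Qed.

(** Both terms on the left are thus controlled by the pairing of the resolvent
    with its argument, where an integrable argument can be used. *)
Lemma res_energy tau f : 0 < tau ->
  nn (res tau f) + tau ^+ 2 * nn (D (res tau f)) = dot f (res tau f).
Proof.
move=> t0; rewrite -[X in _ = dot X _](resP f t0) /nn !dotE !dot_der; ring.
Qed.

Lemma dot_sqr f g : dot f g ^+ 2 <= nn f * nn g.
Proof.
have [g0|] := eqVneq (nn g) 0.
  by rewrite (dot_eq0 g0) dot0r nn0 mulr0 expr0n.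
move=> g0; have gp : 0 < nn g by rewrite lt_def g0 nn_ge0.
have := nn_ge0 (nn g *: f - dot f g *: g).
rewrite {1}/nn !dotE (dotC g f) -!/(nn _) => H.
rewrite -(ler_pM2l gp) -subr_ge0; move: H; congr (0 <= _); ring.
Qed.

Definition sn f := Num.sqrt (nn f).

Lemma sqr_sn f : sn f ^+ 2 = nn f. Proof. by rewrite sqr_sqrtr ?nn_ge0. Qed.

Lemma dot_norm f g : `|dot f g| <= sn f * sn g.
Proof.
rewrite /sn -sqrtrM ?nn_ge0 // -sqrtr_sqr ler_wsqrtr //; exact: dot_sqr.
Qed.

Lemma iter_derD j f g : iter j D (f + g) = iter j D f + iter j D g.
Proof. by elim: j => //= j ->; rewrite derE. Qed.

Lemma iter_derZ j a f : iter j D (a *: f) = a *: iter j D f.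
Proof. by elim: j => //= j ->; rewrite derE. Qed.

Lemma iter_der0 j : iter j D 0 = 0.
Proof. by elim: j => //= j ->; rewrite der0. Qed.

Lemma iter_der_res j tau f : 0 < tau ->
  iter j D (res tau f) = res tau (iter j D f).
Proof. by move=> t0; elim: j => //= j ->; rewrite res_der. Qed.

Definition Xcvg {T} (F : set_system T) (c : T -> X) (l : X) :=
  forall j, nn (iter j D (c t - l)) @[t --> F] --> (0 : R).

Section Xcvg_theory.
Context {T : Type} {F : set_system T} {FF : Filter F}.
Implicit Types c d : T -> X.

Lemma Xcvg_ext c d l : c =1 d -> Xcvg F c l -> Xcvg F d l.
Proof. by move=> /funext ->. Qed.

Lemma XcvgD c d l m : Xcvg F c l -> Xcvg F d m -> Xcvg F (fun t => c t + d t) (l + m).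
Proof.
move=> cl dm j.
have H : (2 * nn (iter j D (c t - l)) + 2 * nn (iter j D (d t - m)))
    @[t --> F] --> (2 * 0 + 2 * 0 : R).
  by apply: cvgD; apply: cvgMr; [exact: cl|exact: dm].
rewrite !mulr0 addr0 in H.
apply: squeeze_cvgr H; last exact: cvg_cst.
near=> t; rewrite nn_ge0/=.
have -> : c t + d t - (l + m) = (c t - l) + (d t - m).
  by apply: dot_ext => k; rewrite !dotE; ring.
by rewrite iter_derD nnD.
Unshelve. all: by end_near. Qed.

Lemma XcvgZ a c l : Xcvg F c l -> Xcvg F (fun t => a *: c t) (a *: l).
Proof.
move=> cl j; rewrite -(mulr0 (a ^+ 2)).
have -> : (fun t => nn (iter j D (a *: c t - a *: l))) =
    (fun t => a ^+ 2 * nn (iter j D (c t - l))).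
  by apply/funext => t; rewrite -scalerBr iter_derZ nnZ.
by apply: cvgMr; exact: cl.
Qed.

Lemma Xcvg_der c l : Xcvg F c l -> Xcvg F (fun t => D (c t)) (D l).
Proof.
move=> cl j.
have -> : (fun t => nn (iter j D (D (c t) - D l))) =
    (fun t => nn (iter j.+1 D (c t - l))).
  by apply/funext => t; rewrite iterSr derD derN.
exact: cl.
Qed.

Lemma Xcvg_res tau c l : 0 < tau -> Xcvg F c l ->
  Xcvg F (fun t => res tau (c t)) (res tau l).
Proof.
move=> t0 cl j; apply: squeeze_cvgr (cl j); last exact: cvg_cst.
near=> t; rewrite nn_ge0/= -scaleN1r -resZ // -resD // scaleN1r iter_der_res //.
by have [] := res_bounds (iter j D (c t - l)) t0.
Unshelve. all: by end_near. Qed.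

Lemma Xcvg_dot c d l m : Xcvg F c l -> Xcvg F d m ->
  dot (c t) (d t) @[t --> F] --> dot l m.
Proof.
move=> cl dm.
have sc : sn (c t - l) @[t --> F] --> (0 : R).
  rewrite -(@sqrtr0 R); apply: continuous_cvg; last exact: (cl 0%N).
  exact: sqrt_continuous.
have sd : sn (d t - m) @[t --> F] --> (0 : R).
  rewrite -(@sqrtr0 R); apply: continuous_cvg; last exact: (dm 0%N).
  exact: sqrt_continuous.
have H : (sn (c t - l) * sn (d t - m) + (sn (c t - l) * sn m
    + sn l * sn (d t - m))) @[t --> F] --> (0 * 0 + (0 * sn m + sn l * 0) : R).
  by apply: cvgD; [exact: cvgM|apply: cvgD; [exact: cvgMl|exact: cvgMr]].
rewrite !(mul0r, mulr0, addr0) in H.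
have N : `|dot (c t) (d t) - dot l m| @[t --> F] --> (0 : R).
  apply: squeeze_cvgr H; last exact: cvg_cst.
  near=> t; rewrite normr_ge0/=.
  have -> : dot (c t) (d t) - dot l m =
      dot (c t - l) (d t - m) + (dot (c t - l) m + dot l (d t - m)).
    by rewrite !dotE; ring.
  apply: (le_trans (ler_normD _ _)); apply: lerD; first exact: dot_norm.
  by apply: (le_trans (ler_normD _ _)); apply: lerD; exact: dot_norm.
by apply/subr_cvg0; apply: norm_cvg0.
Unshelve. all: by end_near. Qed.

End Xcvg_theory.

(** The first function is continuous for [t >= 0] and has the second one as its
    derivative for [t > 0], in all the norms [nn (iter j D _)]. *)
Definition curve (c c' : R -> X) :=
  (forall t : R, 0 <= t -> Xcvg (within `[0, +oo[ (nbhs t)) c (c t)) /\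
  (forall t : R, 0 < t -> Xcvg (0 : R)^' (fun h : R => h^-1 *: (c (h + t) - c t)) (c' t)).

Lemma curveD c c' d d' : curve c c' -> curve d d' ->
  curve (fun t => c t + d t) (fun t => c' t + d' t).
Proof.
move=> [cc cd] [dc dd]; split=> t t0; first exact: XcvgD (cc _ t0) (dc _ t0).
apply: (Xcvg_ext _ (XcvgD (cd _ t0) (dd _ t0))) => h.
by apply: dot_ext => k; rewrite !dotE; ring.
Qed.

Lemma curveZ a c c' : curve c c' -> curve (fun t => a *: c t) (fun t => a *: c' t).
Proof.
move=> [cc cd]; split=> t t0; first exact: XcvgZ (cc _ t0).
apply: (Xcvg_ext _ (XcvgZ a (cd _ t0))) => h.
by apply: dot_ext => k; rewrite !dotE; ring.
Qed.

Lemma curve_der c c' : curve c c' -> curve (fun t => D (c t)) (fun t => D (c' t)).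
Proof.
move=> [cc cd]; split=> t t0; first exact: Xcvg_der (cc _ t0).
apply: (Xcvg_ext _ (Xcvg_der (cd _ t0))) => h.
by rewrite !derE.
Qed.

Lemma curve_res tau c c' : 0 < tau -> curve c c' ->
  curve (fun t => res tau (c t)) (fun t => res tau (c' t)).
Proof.
move=> tau0 [cc cd]; split=> t t0; first exact: Xcvg_res (cc _ t0).
apply: (Xcvg_ext _ (Xcvg_res tau0 (cd _ t0))) => h.
by rewrite resZ // resD // resN.
Qed.

Definition flows (F F' : R -> R) :=
  (forall t : R, 0 <= t -> F @ within `[0, +oo[ (nbhs t) --> F t) /\
  (forall t : R, 0 < t -> is_derive t 1 F (F' t)).

Lemma curve_dot c c' d d' : curve c c' -> curve d d' ->
  flows (fun t => dot (c t) (d t)) (fun t => dot (c' t) (d t) + dot (c t) (d' t)).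
Proof.
move=> [cc cd] [dc dd]; split=> t t0.
  exact: Xcvg_dot (cc _ t0) (dc _ t0).
have dcont : Xcvg (0 : R)^' (fun h : R => d (h + t)) (d t).
  move=> j.
  have hl : (h ^+ 2 * (2 * nn (iter j D (h^-1 *: (d (h + t) - d t) - d' t))
     + 2 * nn (iter j D (d' t)))) @[h --> (0 : R)^'] -->
     (0 ^+ 2 * (2 * 0 + 2 * nn (iter j D (d' t))) : R).
    apply: cvgM.
      by apply: cvg_within_filter; apply: (@exprn_continuous R 2).
    apply: cvgD; last exact: cvg_cst.
    by apply: cvgMr; exact: dd.
  rewrite expr0n mul0r in hl.
  apply: squeeze_cvgr hl; last exact: cvg_cst.
  near=> h; rewrite nn_ge0/=.
  have h0 : h != 0 by near: h; exact: nbhs_dnbhs_neq.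
  have -> : d (h + t) - d t = h *: (h^-1 *: (d (h + t) - d t)).
    by rewrite scalerA mulfV // scale1r.
  rewrite iter_derZ nnZ ler_wpM2l ?sqr_ge0 // scalerA mulVf // scale1r.
  rewrite -[X in nn (iter j D X) <= _](subrK (d' t)) iter_derD.
  exact: nnD.
have H : (dot (h^-1 *: (c (h + t) - c t)) (d (h + t))
     + dot (c t) (h^-1 *: (d (h + t) - d t))) @[h --> (0 : R)^'] -->
     dot (c' t) (d t) + dot (c t) (d' t).
  have dtt : Xcvg (0 : R)^' (fun=> c t) (c t).
    by move=> j; rewrite subrr; under eq_fun do rewrite iter_der0 nn0; exact: cvg_cst.
  by apply: cvgD; [exact: (Xcvg_dot (cd _ t0) dcont)|exact: (Xcvg_dot dtt (dd _ t0))].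
have E : (fun h : R => h^-1 *: (dot (c (h *: 1 + t)) (d (h *: 1 + t)) - dot (c t) (d t)))
   @ (0 : R)^' --> dot (c' t) (d t) + dot (c t) (d' t).
  apply: cvg_trans H; apply: near_eq_cvg; near=> h.
  rewrite /= /GRing.scale/= mulr1 !dotE; ring.
by apply: DeriveDef; [apply/cvg_ex; eexists; exact: E|exact: cvg_lim E].
Unshelve. all: by end_near. Qed.

End skew_theory.

(** * Time derivatives, and absorption of quadratic terms *)

Section flows_theory.
Context {R : realType}.
Implicit Types F G : R -> R.

Lemma flowsD F F' G G' : flows F F' -> flows G G' ->
  flows (fun t => F t + G t) (fun t => F' t + G' t).
Proof.
move=> [Fc Fd] [Gc Gd]; split => t t0.
  by apply: cvgD; [exact: Fc|exact: Gc].
exact: is_deriveD (Fd _ t0) (Gd _ t0).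
Qed.

Lemma flowsZ (a : R) F F' : flows F F' -> flows (fun t => a * F t) (fun t => a * F' t).
Proof.
move=> [Fc Fd]; split => t t0; first by apply: cvgMr; exact: Fc.
exact: is_deriveZ (Fd _ t0).
Qed.

Lemma flows_ext F F' G G' : F =1 G -> F' =1 G' -> flows F F' -> flows G G'.
Proof. by move=> /funext -> /funext ->. Qed.

(** The derivative is only known for positive times, and the continuity at
    [t = 0] brings the inequality back to the initial value. *)
Lemma flows_nincr F F' : flows F F' -> (forall t, 0 < t -> F' t <= 0) ->
  forall t, 0 <= t -> F t <= F 0.
Proof.
move=> [Fc Fd] Fn t; rewrite le_eqVlt => /predU1P[<-//|t0].
have cF : {within `[0, t], continuous F}.
  have sub : `[0, t] `<=` `[0 : R, +oo[.
    by move=> x /=; rewrite !in_itv/= => /andP[->].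
  apply: (continuous_subspaceW sub).
  by apply/subspace_continuousP => x /=; rewrite in_itv/= andbT => x0; exact: Fc.
have [c cI E] : exists2 c, c \in `]0, t[ & F t - F 0 = F' c * (t - 0).
  apply: MVT => // x; rewrite in_itv/= => /andP[x0 _]; exact: Fd.
rewrite -subr_le0 E subr0; apply: mulr_le0_ge0; last exact: ltW.
by move: cI; rewrite in_itv/= => /andP[c0 _]; exact: Fn.
Qed.

Lemma flows_powM (n : nat) F F' : flows F F' ->
  flows (fun t => (1 + t) ^+ n * F t)
        (fun t => n%:R * (1 + t) ^+ n.-1 * F t + (1 + t) ^+ n * F' t).
Proof.
move=> [Fc Fd]; split => t t0.
  apply: cvgM; last exact: Fc.
  apply: cvg_within_filter.
  apply: (@continuous_comp _ _ _ (fun t : R => 1 + t) (fun x : R => x ^+ n)).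
    by apply: cvgD; [exact: cvg_cst|exact: cvg_id].
  exact: exprn_continuous.
have d1 : is_derive t (1 : R) (fun t : R => 1 + t) 1.
  have := is_deriveD (is_derive_cst (1 : R) t 1) (is_derive_id t (1 : R)).
  by rewrite add0r.
have := is_deriveM (is_deriveX n d1) (Fd _ t0).
have -> : (fun t : R => 1 + t) ^+ n * F = (fun t => (1 + t) ^+ n * F t).
  by apply/funext => x; rewrite fctE exprfctE.
move=> H; apply: (is_derive_eq H).
by rewrite exprfctE /GRing.scale/= mulr1; ring.
Qed.

End flows_theory.

Section absorption.
Context {R : realType} {X : skewSpace R} {Y : Type}.
Implicit Types (f g : Y -> X) (Q s b : Y -> R) (c : R).

Definition bounded_by Q f :=
  exists C : R, 0 < C /\ forall y, nn (f y) <= C * Q y.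

Lemma bounded_byD Q f g : bounded_by Q f -> bounded_by Q g ->
  bounded_by Q (fun y => f y + g y).
Proof.
move=> [C [C0 fC]] [C' [C'0 gC]]; exists (2 * C + 2 * C'); split; first lra.
by move=> y; have := nnD (f y) (g y); have := fC y; have := gC y; lra.
Qed.

Lemma bounded_byZ Q c f : bounded_by Q f -> bounded_by Q (fun y => c *: f y).
Proof.
move=> [C [C0 fC]]; exists ((c ^+ 2 + 1) * C); split.
  by rewrite mulr_gt0 // ltr_wpDl ?sqr_ge0.
move=> y; rewrite nnZ -mulrA.
have CQ : 0 <= C * Q y := le_trans (nn_ge0 _) (fC y).
apply: (@le_trans _ _ (c ^+ 2 * (C * Q y))).
  by rewrite ler_wpM2l ?sqr_ge0.
by rewrite mulrDl lerDl mul1r.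
Qed.

Lemma bounded_byN Q f : bounded_by Q f -> bounded_by Q (fun y => - f y).
Proof. by move=> [C [C0 fC]]; exists C; split=> // y; rewrite nnN. Qed.

Lemma bounded_by_nn Q f : (forall y, nn (f y) <= Q y) -> bounded_by Q f.
Proof. by move=> H; exists 1; split=> // y; rewrite mul1r. Qed.

(** [f] is at most an arbitrarily small multiple of [s], modulo [b]. *)
Definition absorbed s b (f : Y -> R) :=
  forall e : R, 0 < e -> exists K : R, 0 <= K /\ forall y, f y <= e * s y + K * b y.

Lemma absorbedD s b (f g : Y -> R) : absorbed s b f -> absorbed s b g ->
  absorbed s b (fun y => f y + g y).
Proof.
move=> fa ga e e0; have e2 : 0 < e / 2 by rewrite divr_gt0.
have [K [K0 fK]] := fa _ e2; have [K' [K'0 gK]] := ga _ e2.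
exists (K + K'); split; first exact: addr_ge0.
by move=> y; have := fK y; have := gK y; rewrite mulrDl; lra.
Qed.

(** Young's inequality, with the small constant on the factor bounded by [s]. *)
Lemma absorbed_dot s b c f g : bounded_by s f -> bounded_by b g ->
  absorbed s b (fun y => c * dot (f y) (g y)).
Proof.
move=> [C [C0 fC]] [C' [C'0 gC]] e e0.
pose e' := e / C; have e'0 : 0 < e' by rewrite divr_gt0.
have k0 : 0 <= (4 * e')^-1 * c ^+ 2.
  by rewrite mulr_ge0 ?sqr_ge0 // invr_ge0 mulr_ge0 // ltW.
exists ((4 * e')^-1 * c ^+ 2 * C'); split; first by rewrite mulr_ge0 // ltW.
move=> y; rewrite -dotZr; apply: (le_trans (young _ _ e'0)); rewrite nnZ.
apply: lerD.
  have -> : e * s y = e' * (C * s y) by rewrite /e'; field; rewrite gt_eqF.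
  by rewrite ler_pM2l.
by rewrite mulrA -[leRHS]mulrA ler_wpM2l.
Qed.

Lemma absorbed_dotC s b c f g : bounded_by b f -> bounded_by s g ->
  absorbed s b (fun y => c * dot (f y) (g y)).
Proof.
move=> fb gs; have := absorbed_dot c gs fb.
by under eq_fun do rewrite dotC.
Qed.

Lemma absorbed_dotb s b c f g : (forall y, 0 <= s y) -> bounded_by b f ->
  bounded_by b g -> absorbed s b (fun y => c * dot (f y) (g y)).
Proof.
move=> s0 [C [C0 fC]] [C' [C'0 gC]] e e0.
have k0 : 0 <= (4 * 1)^-1 * c ^+ 2.
  by rewrite mulr_ge0 ?sqr_ge0 // invr_ge0 mulr_ge0.
exists (C + (4 * 1)^-1 * c ^+ 2 * C'); split.
  by apply: addr_ge0; [exact: ltW|apply: mulr_ge0 => //; exact: ltW].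
move=> y; rewrite -dotZr; apply: (le_trans (young _ _ ltr01)); rewrite nnZ mul1r.
apply: (@le_trans _ _ ((C + (4 * 1)^-1 * c ^+ 2 * C') * b y)).
  rewrite [leRHS]mulrDl; apply: lerD => //.
  by rewrite mulrA -[leRHS]mulrA ler_wpM2l.
by rewrite lerDr mulr_ge0 // ltW.
Qed.

End absorption.

(** * The first order system and its energy *)

(** The unknowns of the first order system, in this order: the velocities of
    [phi], [psi] and [omega]; the first temperature variable, which is the
    temperature for Type I and its time derivative for Type III, and the space
    derivative of the temperature of Type III; the same for the second
    temperature; the derivative of [psi], the shear and the stretch. *)
Inductive comp := Cv | Cu | Cw | Ct1 | Cc1 | Ct2 | Cc2 | Cz | CS | CN.

Definition comps := [:: Cv; Cu; Cw; Ct1; Cc1; Ct2; Cc2; Cz; CS; CN].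

(** [ka1 = ka2 = 0] is the system of Type I. *)
Record coefs (R : realType) := Coefs {
  rho1 : R; rho2 : R; ga : R; bb : R; kk : R; k0 : R; ll : R;
  al1 : R; al2 : R; ka1 : R; ka2 : R; m1 : R; m2 : R;
  rho1_gt0 : 0 < rho1; rho2_gt0 : 0 < rho2; ga_gt0 : 0 < ga; bb_gt0 : 0 < bb;
  kk_gt0 : 0 < kk; k0_gt0 : 0 < k0; ll_gt0 : 0 < ll;
  al1_gt0 : 0 < al1; al2_gt0 : 0 < al2; ka1_ge0 : 0 <= ka1; ka2_ge0 : 0 <= ka2;
  m1_gt0 : 0 < m1; m2_gt0 : 0 < m2 }.

(** The gradients of the temperatures evolve only in the system of Type III.
    With [ka = 0] and the factor [ind ka] these variables stay equal to [0]. *)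
Definition ind {R : realType} (x : R) : R := (x != 0)%:R.

Lemma indE {R : realType} (x : R) : x * ind x = x.
Proof. by rewrite /ind; case: eqP => [->|_]; rewrite ?mul0r ?mulr1. Qed.

Section state_space.
Context {R : realType} (X : skewSpace R) (p : coefs R).
Local Notation D := (@der R X).

Definition state := comp -> X.
Implicit Types (y : state) (F G : state -> R) (f g : state -> X).

Definition dynamics (y : state) : state := fun i =>
  match i with
  | Cv => (rho1 p)^-1 *: (kk p *: D (y CS) + (k0 p * ll p) *: y CN
                      - (ll p * ga p) *: y Ct1)
  | Cu => (rho2 p)^-1 *: (bb p *: D (y Cz) + kk p *: y CS - ga p *: D (y Ct2))
  | Cw => (rho1 p)^-1 *: (k0 p *: D (y CN) + (kk p * ll p) *: y CS
                      - ga p *: D (y Ct1))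
  | Ct1 => ka1 p *: D (y Cc1) + al1 p *: D (D (y Ct1))
             - m1 p *: (D (y Cw) - ll p *: y Cv)
  | Cc1 => ind (ka1 p) *: D (y Ct1)
  | Ct2 => ka2 p *: D (y Cc2) + al2 p *: D (D (y Ct2)) - m2 p *: D (y Cu)
  | Cc2 => ind (ka2 p) *: D (y Ct2)
  | Cz => D (y Cu)
  | CS => D (y Cv) - y Cu - ll p *: y Cw
  | CN => D (y Cw) - ll p *: y Cv
  end.

Definition sol (y : R -> state) :=
  forall i, curve (fun t => y t i) (fun t => dynamics (y t) i).

Definition smap (T : X -> X) y : state := fun i => T (y i).

Lemma sol_der (y : R -> state) : sol y -> sol (fun t => smap D (y t)).
Proof.
move=> ys i; have := curve_der (ys i); congr (curve _ _); apply/funext => t.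
by case: i; rewrite /smap/= ?derE.
Qed.

Lemma sol_res tau (y : R -> state) : 0 < tau ->
  sol y -> sol (fun t => smap (res tau) (y t)).
Proof.
move=> t0 ys i; have := curve_res t0 (ys i); congr (curve _ _); apply/funext => t.
by case: i; rewrite /smap/= ?(resD, resZ, resN, res_der).
Qed.

Lemma solD (y z : R -> state) : sol y -> sol z -> sol (fun t i => y t i + z t i).
Proof.
move=> ys zs i; have := curveD (ys i) (zs i); congr (curve _ _); apply/funext => t.
by case: i; apply: dot_ext => h; rewrite /= ?derE ?dotE; ring.
Qed.

Lemma solZ a (y : R -> state) : sol y -> sol (fun t i => a *: y t i).
Proof.
move=> ys i; have := curveZ a (ys i); congr (curve _ _); apply/funext => t.
by case: i; apply: dot_ext => h; rewrite /= ?derE ?dotE; ring.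
Qed.

Definition opB (f : X) := f - D (D f).

Lemma sol_opB (y : R -> state) : sol y -> sol (fun t => smap opB (y t)).
Proof.
move=> ys; have := solD ys (solZ (-1) (sol_der (sol_der ys))).
congr sol; apply/funext => t; apply/funext => i.
by rewrite /smap /opB scaleN1r.
Qed.

(** The linear expressions in the unknowns that commute with the flow, so that
    their time derivative is read off [dynamics]. *)
Definition form f := forall y : R -> state, sol y ->
  curve (fun t => f (y t)) (fun t => f (dynamics (y t))).

Lemma form_comp i : form (fun y => y i). Proof. by move=> y; exact. Qed.

Lemma form_der f : form f -> form (fun y => D (f y)).
Proof. by move=> ff y /ff; exact: curve_der. Qed.

Lemma formD f g : form f -> form g -> form (fun y => f y + g y).
Proof. by move=> ff fg y ys; exact: curveD (ff _ ys) (fg _ ys). Qed.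

Lemma formZ a f : form f -> form (fun y => a *: f y).
Proof. by move=> ff y ys; exact: curveZ (ff _ ys). Qed.

Lemma formN f : form f -> form (fun y => - f y).
Proof.
move=> ff y ys; have H := formZ (-1) ff; have := H y ys; congr (curve _ _).
  by apply/funext => t; rewrite scaleN1r.
by apply/funext => t; rewrite scaleN1r.
Qed.

Definition sflows F F' := forall y : R -> state, sol y ->
  flows (fun t => F (y t)) (fun t => F' (y t)).

Lemma sflows_dot f g : form f -> form g ->
  sflows (fun y => dot (f y) (g y))
         (fun y => dot (f (dynamics y)) (g y) + dot (f y) (g (dynamics y))).
Proof. by move=> ff fg y ys; exact: curve_dot (ff _ ys) (fg _ ys). Qed.

Lemma sflowsD F F' G G' : sflows F F' -> sflows G G' ->
  sflows (fun y => F y + G y) (fun y => F' y + G' y).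
Proof. by move=> FF GG y ys; exact: flowsD (FF _ ys) (GG _ ys). Qed.

Lemma sflowsZ a F F' : sflows F F' ->
  sflows (fun y => a * F y) (fun y => a * F' y).
Proof. by move=> FF y ys; exact: flowsZ (FF _ ys). Qed.

(** With these weights [energy] is the squared norm of the vector solution. *)
Definition wt (i : comp) : R :=
  match i with
  | Cv => rho1 p | Cu => rho2 p | Cw => rho1 p
  | Ct1 => ga p / m1 p | Cc1 => ka1 p * ga p / m1 p
  | Ct2 => ga p / m2 p | Cc2 => ka2 p * ga p / m2 p
  | Cz => bb p | CS => kk p | CN => k0 p
  end.

Lemma wt_ge0 i : 0 <= wt i.
Proof.
have := (rho1_gt0 p, rho2_gt0 p, ga_gt0 p, bb_gt0 p, kk_gt0 p, k0_gt0 p).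
have := (m1_gt0 p, m2_gt0 p, ka1_ge0 p, ka2_ge0 p).
move=> [[[h1 h2] h3] h4] [[[[[h5 h6] h7] h8] h9] h10].
by case: i => /=; rewrite ?mulr_ge0 ?invr_ge0 // ltW.
Qed.

Definition energy y : R := \sum_(i <- comps) wt i * nn (y i).

Lemma energy_ge0 y : 0 <= energy y.
Proof. by apply: sumr_ge0 => i _; rewrite mulr_ge0 ?wt_ge0 ?nn_ge0. Qed.

Lemma le_energy y z (c : R) : 0 <= c -> (forall i, nn (y i) <= c * nn (z i)) ->
  energy y <= c * energy z.
Proof.
move=> c0 yz; rewrite mulr_sumr; apply: ler_sum => i _.
by rewrite mulrCA ler_wpM2l ?wt_ge0.
Qed.

Lemma energyD y z : energy (fun i => y i + z i) <= 2 * energy y + 2 * energy z.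
Proof.
rewrite !mulr_sumr -big_split/=; apply: ler_sum => i _.
by rewrite !(mulrCA 2) -mulrDr ler_wpM2l ?wt_ge0 // nnD.
Qed.

Lemma energyZ a y : energy (fun i => a *: y i) = a ^+ 2 * energy y.
Proof. by rewrite mulr_sumr; apply: eq_bigr => i _; rewrite nnZ mulrCA. Qed.

Definition dissip y : R :=
  2 * (ga p * al1 p / m1 p) * nn (D (y Ct1)) + 2 * (ga p * al2 p / m2 p) * nn (D (y Ct2)).

(** Every coupling of the system is skew for the weights [wt]: after integration
    by parts all the mixed terms cancel in pairs, and the heat conduction is
    what remains. *)
Lemma energy_flows : sflows energy (fun y => - dissip y).
Proof.
move=> y ys.
pose E' (y : state) := \sum_(i <- comps) wt i * (dot (dynamics y i) (y i) + dot (y i) (dynamics y i)).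
have H : sflows energy E'.
  rewrite /energy /E'; elim: comps => [|i s IH].
    move=> z zs; split=> t t0; under eq_fun do rewrite big_nil.
      by rewrite big_nil; exact: cvg_cst.
    by rewrite big_nil; exact: is_derive_cst.
  move=> z zs; have := sflowsD (sflowsZ (wt i) (sflows_dot (form_comp i) (form_comp i))) IH zs.
  by apply: flows_ext => t; rewrite big_cons.
apply: flows_ext (H y ys) => // t.
have derC (f g : X) : dot (D f) g = - dot (D g) f by rewrite dot_der dotC.
have ka1E : ka1 p * ind (ka1 p) = ka1 p by rewrite indE.
have ka2E : ka2 p * ind (ka2 p) = ka2 p by rewrite indE.
have -> : E' (y t) = \sum_(i <- comps) 2 * (wt i * dot (dynamics (y t) i) (y t i)).
  by apply: eq_bigr => i _; rewrite (dotC (y t i)); ring.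
rewrite /comps !big_cons big_nil /dissip /= /nn.
move: (y t) => {ys H E'} z.
rewrite !dotE (derC (z CS) (z Cv)) (derC (z CN) (z Cw)).
rewrite (derC (z Cz) (z Cu)) (derC (z Ct2) (z Cu)) (derC (z Ct1) (z Cw)).
rewrite (derC (z Cc1) (z Ct1)) (derC (z Cc2) (z Ct2)) !(dot_der (D _)).
rewrite (dotC (z CN)) (dotC (z Cv) (z Ct1)) (dotC (z CS) (z Cu)) (dotC (z CS) (z Cw)).
have r1 := gt_eqF (rho1_gt0 p); have r2 := gt_eqF (rho2_gt0 p).
have n1 := gt_eqF (m1_gt0 p); have n2 := gt_eqF (m2_gt0 p).
have c1 x : ka1 p * ga p / m1 p * (ind (ka1 p) * x) = ka1 p * ga p / m1 p * x.
  by rewrite -[X in _ = X * _ / _ * _]ka1E; ring.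
have c2 x : ka2 p * ga p / m2 p * (ind (ka2 p) * x) = ka2 p * ga p / m2 p * x.
  by rewrite -[X in _ = X * _ / _ * _]ka2E; ring.
rewrite c1 c2 !dot_der.
by field; rewrite r1 r2 n1 n2.
Qed.

Lemma opB_nn (f : X) : nn (opB f) = nn f + 2 * nn (D f) + nn (D (D f)).
Proof.
have := res_id 1 f; rewrite !expr1n scale1r /opB => ->.
by rewrite mulr1 mul1r.
Qed.

Lemma opB_der (f : X) : opB (D f) = D (opB f).
Proof. by rewrite /opB !derE. Qed.

(** The functionals of the chain contain derivatives up to the fourth order;
    two factors [1 - D^2] control all of them. *)
Definition energy2 (y : state) := energy (smap opB (smap opB y)).
(** A multiple of [dissip], without the coefficients, of the solution to which
    the same two factors are applied. *)
Definition dissipation (y : state) :=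
  nn (D (opB (opB (y Ct1)))) + nn (D (opB (opB (y Ct2)))).

Lemma energy2_ge0 y : 0 <= energy2 y. Proof. exact: energy_ge0. Qed.
Lemma dissipation_ge0 y : 0 <= dissipation y. Proof. by rewrite addr_ge0 ?nn_ge0. Qed.

Lemma sol_opB2 (y : R -> state) : sol y -> sol (fun t => smap opB (smap opB (y t))).
Proof. by move=> /sol_opB/sol_opB. Qed.

Lemma energy2_flows : sflows energy2 (fun y => - dissip (smap opB (smap opB y))).
Proof. by move=> y ys; exact: energy_flows (sol_opB2 ys). Qed.

Lemma dissipation_le : exists c, 0 < c /\ forall y, c * dissipation y <= dissip (smap opB (smap opB y)).
Proof.
have a1 : 0 < 2 * (ga p * al1 p / m1 p).
  by rewrite !mulr_gt0 ?invr_gt0 ?ga_gt0 ?al1_gt0 ?m1_gt0.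
have a2 : 0 < 2 * (ga p * al2 p / m2 p).
  by rewrite !mulr_gt0 ?invr_gt0 ?ga_gt0 ?al2_gt0 ?m2_gt0.
exists (Num.min (2 * (ga p * al1 p / m1 p)) (2 * (ga p * al2 p / m2 p))).
split; first by rewrite lt_min a1 a2.
move=> y; rewrite /dissipation /dissip /smap mulrDr; apply: lerD.
  by rewrite ler_wpM2r ?nn_ge0 // ge_min lexx.
by rewrite ler_wpM2r ?nn_ge0 // ge_min lexx orbT.
Qed.

Lemma opB_ge (f : X) j : (j <= 2)%N -> nn (iter j D f) <= nn (opB f).
Proof.
have := nn_ge0 f; have := nn_ge0 (D f); have := nn_ge0 (D (D f)).
by case: j => [|[|[|//]]] a b c _; rewrite opB_nn /=; lra.
Qed.

Lemma iter_opB j (f : X) : iter j D (opB f) = opB (iter j D f).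
Proof. by elim: j => //= j ->; rewrite opB_der. Qed.

Lemma opB2_ge (f : X) j : (j <= 4)%N -> nn (iter j D f) <= nn (opB (opB f)).
Proof.
move=> j4; have -> : j = (minn j 2 + (j - 2))%N by lia.
rewrite iterD; apply: (le_trans (opB_ge _ _)); first lia.
by rewrite -iter_opB; apply: opB_ge; lia.
Qed.

Lemma dissipation_t1 j y : (j < 5)%N -> nn (iter j.+1 D (y Ct1)) <= dissipation y.
Proof.
move=> j5; rewrite iterSr /dissipation -!opB_der.
by apply: ler_wpDr; rewrite ?nn_ge0 // opB2_ge.
Qed.

Lemma dissipation_t2 j y : (j < 5)%N -> nn (iter j.+1 D (y Ct2)) <= dissipation y.
Proof.
move=> j5; rewrite iterSr /dissipation -!opB_der.
by apply: ler_wpDl; rewrite ?nn_ge0 // opB2_ge.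
Qed.

Lemma energy_comp i y : wt i * nn (y i) <= energy y.
Proof.
have h j : 0 <= wt j * nn (y j) by rewrite mulr_ge0 ?wt_ge0 ?nn_ge0.
rewrite /energy /comps !big_cons big_nil.
have := (h Cv, h Cu, h Cw, h Ct1, h Cc1, h Ct2, h Cc2, h Cz, h CS, h CN).
by case: i => -[[[[[[[[[]]]]]]]]]; lra.
Qed.

(** The vectors from which the functionals of the chain may be formed. *)
Definition tame f := bounded_by energy2 f.

Lemma tame_comp i j : 0 < wt i -> (j <= 4)%N -> tame (fun y => iter j D (y i)).
Proof.
move=> w0 j4; exists (wt i)^-1; split; first by rewrite invr_gt0.
move=> y; rewrite ler_pdivlMl //; apply: le_trans (energy_comp i _).
by rewrite ler_wpM2l ?wt_ge0 // opB2_ge.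
Qed.

(** When [ka = 0] the energy does not see the gradient of the temperature, and
    the statement is trivial because of the factor [ka]. *)
Lemma tame_c j : (j <= 4)%N ->
  tame (fun y => ka1 p *: iter j D (y Cc1)) /\ tame (fun y => ka2 p *: iter j D (y Cc2)).
Proof.
move=> j4; have n1 := m1_gt0 p; have n2 := m2_gt0 p; have g0 := ga_gt0 p.
have aux (ka : R) (m : R) i : 0 <= ka -> 0 < m -> wt i = ka * ga p / m ->
    tame (fun y => ka *: iter j D (y i)).
  rewrite le_eqVlt => /predU1P[<- _ _|ka0 m0 wi]; last first.
    by apply: bounded_byZ; apply: tame_comp; rewrite // wi !mulr_gt0 // invr_gt0.
  by exists 1; split=> // y; rewrite scale0r nn0 mul1r energy2_ge0.
by split; [apply: (aux _ (m1 p))|apply: (aux _ (m2 p))]; rewrite ?ka1_ge0 ?ka2_ge0.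
Qed.

(** One link of the chain. The functional [F] is dominated by the energy, so that
    in the end only its time derivative matters; the multiple of [next] is small
    in order that consecutive links can be composed. *)
Definition controlled prev next Q := forall d : R, 0 < d -> exists K F F',
  [/\ 0 <= K, sflows F F', exists C, forall y, `|F y| <= C * energy2 y &
    forall y, Q y <= F' y + K * (dissipation y + prev y) + d * next y].

(** Two consecutive links are one link: the small multiple of [Q] in the
    estimate of [P] is absorbed once [Q] is estimated by [P]. *)
Lemma controlled_step P Q N : (forall y, 0 <= P y) -> (forall y, 0 <= Q y) ->
  (forall y, 0 <= N y) ->
  controlled (fun=> 0) Q P -> controlled P N Q ->
  controlled (fun=> 0) N (fun y => P y + Q y).
Proof.
move=> P0 Q0 N0 cP cQ d d0.
have [|K2 [G [G' [K20 GG [C2 GC] QG]]]] := cQ (d / 4); first by rewrite divr_gt0.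
have e0 : 0 < (2 * (K2 + 1))^-1 by rewrite invr_gt0 mulr_gt0 // ltr_wpDl.
have [K1 [F [F' [K10 FF [C1 FC] PF]]]] := cP _ e0.
exists (4 * K2 * (1 + K1) + K1), (fun y => (1 + 4 * K2) * F y + 4 * G y),
  (fun y => (1 + 4 * K2) * F' y + 4 * G' y); split.
- by rewrite addr_ge0 // !mulr_ge0 // addr_ge0.
- exact: sflowsD (sflowsZ _ FF) (sflowsZ _ GG).
- exists ((1 + 4 * K2) * C1 + 4 * C2) => y; apply: (le_trans (ler_normD _ _)).
  have k : 0 <= 1 + 4 * K2 by rewrite addr_ge0 // mulr_ge0.
  rewrite !normrM (ger0_norm k) (ger0_norm (ler0n _ 4)).
  have -> : ((1 + 4 * K2) * C1 + 4 * C2) * energy2 y =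
    (1 + 4 * K2) * (C1 * energy2 y) + 4 * (C2 * energy2 y) by ring.
  by apply: lerD; rewrite ler_wpM2l.
- move=> y.
  set e := (2 * (K2 + 1))^-1 in e0 PF.
  have ee : 2 * (K2 + 1) * e = 1 by rewrite mulfV // gt_eqF // mulr_gt0 // ltr_wpDl.
  have Kee : 0 <= K2 * e by rewrite mulr_ge0 // ltW.
  have Ke : K2 * e <= 1 / 2 by lra.
  have e1 : e <= 1 by lra.
  have := PF y; have := QG y; have := P0 y; have := Q0 y; have := N0 y.
  have := dissipation_ge0 y.
  move: (P y) (Q y) (N y) (F' y) (G' y) (dissipation y) => P_ Q_ N_ F_ G_ B_ b0 n0 q0 p0 hq hp.
  rewrite addr0 in hp *.
  have hp2 : K2 * P_ <= K2 * (F_ + K1 * B_ + e * Q_) by rewrite ler_wpM2l.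
  have h3 : K2 * e * Q_ <= 1 / 2 * Q_ by rewrite ler_wpM2r.
  have h4 : e * Q_ <= 1 * Q_ by rewrite ler_wpM2r.
  have hQ : Q_ <= 2 * (G_ + K2 * B_ + K2 * (F_ + K1 * B_) + d / 4 * N_) by lra.
  lra.
Qed.

(** How a link is obtained: [F] is differentiated along the flow, one of the
    terms of [F'] is [a Q], and the other ones are absorbed. *)
Lemma controlled_intro (a : R) prev next Q F F' (Z : state -> R) : 0 < a ->
  sflows F F' -> (exists C, forall y, `|F y| <= C * energy2 y) ->
  (forall y, 0 <= Q y) -> (forall y, 0 <= next y) ->
  (forall y, a * Q y = F' y + Z y) ->
  absorbed (fun y => Q y + next y) (fun y => dissipation y + prev y) Z ->
  controlled prev next Q.
Proof.
move=> a0 FF [C FC] q0 n0 QF Za d d0.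
pose e := Num.min (a / 2) (a * d / 2).
have e0 : 0 < e by rewrite lt_min !divr_gt0 // mulr_gt0.
have [K [K0 ZK]] := Za _ e0.
exists (2 / a * K), (fun y => 2 / a * F y), (fun y => 2 / a * F' y); split.
- by rewrite !mulr_ge0 // invr_ge0 ltW.
- exact: sflowsZ.
- have k : 0 <= 2 / a by rewrite divr_ge0 // ltW.
  exists (2 / a * C) => y; rewrite normrM (ger0_norm k).
  by rewrite -[leRHS]mulrA; apply: ler_wpM2l.
- move=> y.
  have ea : e <= a / 2 by rewrite ge_min lexx.
  have ed : e <= a * d / 2 by rewrite ge_min lexx orbT.
  have := QF y; have := ZK y; have := q0 y; have := n0 y.
  move: (Q y) (next y) (F' y) (dissipation y + prev y) (Z y) => Q_ N_ F_ B_ Z_ hn hq hz hQ.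
  have h1 : e * Q_ <= a / 2 * Q_ by rewrite ler_wpM2r.
  have h2 : e * N_ <= a * d / 2 * N_ by rewrite ler_wpM2r.
  rewrite -(ler_pM2l (_ : 0 < a / 2)) ?divr_gt0 // !mulrDr.
  have -> : a / 2 * (2 / a * F_) = F_ by field; rewrite gt_eqF.
  have -> : a / 2 * (2 / a * K * B_) = K * B_ by field; rewrite gt_eqF.
  lra.
Qed.

End state_space.

(** * The chain of estimates *)

Section swap.
Context {R : realType} (X : skewSpace R).
Local Notation D := (@der R X).
Implicit Types f g : X.

(** With [selfE], these identities bring every product of derivatives of two
    given vectors to the form where the first one comes first, so that [ring]
    can compare the two sides of an energy identity. *)
Lemma swapE f g : (dot g f = dot f g) * (dot g (D f) = - dot f (D g)) *
  (dot g (D (D f)) = dot f (D (D g))) *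
  (dot g (D (D (D f))) = - dot f (D (D (D g)))) *
  (dot g (D (D (D (D f)))) = dot f (D (D (D (D g))))) *
  (dot g (D (D (D (D (D f))))) = - dot f (D (D (D (D (D g)))))) *
  (dot g (D (D (D (D (D (D f)))))) = dot f (D (D (D (D (D (D g))))))) *
  (dot g (D (D (D (D (D (D (D f))))))) = - dot f (D (D (D (D (D (D (D g)))))))) *
  (dot g (D (D (D (D (D (D (D (D f)))))))) = dot f (D (D (D (D (D (D (D (D g))))))))).
Proof. by do !split; rewrite dotC ?dot_der ?opprK. Qed.

Lemma selfE f : (dot f (D f) = 0) * (dot f (D (D (D f))) = 0) *
  (dot f (D (D (D (D (D f))))) = 0) * (dot f (D (D (D (D (D (D (D f))))))) = 0).
Proof.
have h (x : R) : x = - x -> x = 0 by lra.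
by do !split; apply: h; rewrite [LHS]dotC !dot_der ?opprK.
Qed.

End swap.

Section lyapunov.
Context {R : realType} (X : skewSpace R) (p : coefs R).
Local Notation D := (@der R X).
Local Notation state := (state X).
Implicit Types (y : state).
Local Notation dyn := (@dynamics R X p).
Local Notation cE := (@energy2 R X p).
Local Notation cB := (@dissipation R X).

Implicit Types (F G : state -> R) (f g : state -> X).
Local Notation D2 f := (D (D f)).
Local Notation D3 f := (D (D (D f))).
Local Notation D4 f := (D (D (D (D f)))).
Local Notation D5 f := (D (D (D (D (D f))))).

Definition tamef F := exists C, forall y, `|F y| <= C * cE y.

Lemma tame_dot f g : tame p f -> tame p g -> tamef (fun y => dot (f y) (g y)).
Proof.
move=> [C [C0 fC]] [C' [C'0 gC]]; exists (C + C') => y.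
apply: (le_trans (dot_norm _ _)).
have := sqr_ge0 (sn (f y) - sn (g y)); rewrite sqrrB !sqr_sn.
have := fC y; have := gC y; have := nn_ge0 (f y); have := nn_ge0 (g y); lra.
Qed.

Lemma tamefD F G : tamef F -> tamef G -> tamef (fun y => F y + G y).
Proof.
move=> [C FC] [C' GC]; exists (C + C') => y.
by apply: (le_trans (ler_normD _ _)); have := FC y; have := GC y; lra.
Qed.

Lemma tamefZ a F : tamef F -> tamef (fun y => a * F y).
Proof.
move=> [C FC]; exists (`|a| * C) => y.
by rewrite normrM -mulrA ler_wpM2l.
Qed.

(** The operator [l^2 - D^2] through which curvature enters: it is positive,
    and does not vanish at low frequencies. *)
Definition La (f : X) := ll p ^+ 2 *: f - D2 f.

(** The stretch, with its velocity [fP], and the first temperature form a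
    closed subsystem. *)
Definition fP y := D (y Cw) - ll p *: y Cv.
Definition fY1 y := ka1 p *: D (y Cc1) - m1 p *: fP y.

(** The shear, with its velocity [fh], and the second temperature form a closed
    subsystem. *)
Definition fh y := D (y Cv) - y Cu - ll p *: y Cw.
Definition fy y := ka2 p *: y Cc2 - m2 p *: y Cu.
Definition fq y := bb p *: D (y Cz) + kk p *: y CS.
Definition fg y := bb p *: D2 (y Cu) + kk p *: fh y.

(** The momentum [fM] is the combination of [fh] and of the rotation velocity in
    whose time derivative the shear only occurs with two derivatives. This matters
    because the chain controls the second and third derivatives of the shear, but
    not the first one. *)
Definition rho0 := rho1 p + ll p ^+ 2 * rho2 p.
Definition nu := m2 p / rho0.
Definition fM y := rho1 p *: fh y + rho0 *: y Cu.
Definition fY2 y := ka2 p *: y Cc2 - nu *: fM y.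

Let r1 : rho1 p != 0. Proof. by rewrite gt_eqF ?rho1_gt0. Qed.
Let r2 : rho2 p != 0. Proof. by rewrite gt_eqF ?rho2_gt0. Qed.
Let l0 : ll p != 0. Proof. by rewrite gt_eqF ?ll_gt0. Qed.
Let rho0_gt0 : 0 < rho0.
Proof. by rewrite addr_gt0 ?mulr_gt0 ?exprn_gt0 ?rho1_gt0 ?rho2_gt0 ?ll_gt0. Qed.
Let r0 : rho0 != 0. Proof. by rewrite gt_eqF. Qed.

Ltac vec := apply: dot_ext => h; rewrite /= ?derE ?dotE.

Lemma dyn_t1 y : dyn y Ct1 = fY1 y + al1 p *: D2 (y Ct1).
Proof. by rewrite /fY1 /fP; vec; ring. Qed.

Lemma dyn_N y : dyn y CN = fP y. Proof. by []. Qed.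

Lemma fP_dyn y : fP (dyn y) = - (rho1 p)^-1 *: La (k0 p *: y CN - ga p *: y Ct1).
Proof. by rewrite /fP /La; vec; ring. Qed.

Lemma fY1_dyn y : fY1 (dyn y) = ka1 p *: D2 (y Ct1)
  + (m1 p / rho1 p) *: La (k0 p *: y CN - ga p *: y Ct1).
Proof. by rewrite /fY1 fP_dyn /La; vec; rewrite -[in RHS](indE (ka1 p)); ring. Qed.

Lemma dyn_t2 y : dyn y Ct2 = D (fy y) + al2 p *: D2 (y Ct2).
Proof. by rewrite /fy; vec; ring. Qed.

Lemma fy_dyn y : fy (dyn y) = - (m2 p / rho2 p) *: fq y
  + (ka2 p + m2 p * ga p / rho2 p) *: D (y Ct2).
Proof. by rewrite /fy /fq; vec; rewrite -[in RHS](indE (ka2 p)); ring. Qed.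

Lemma fq_dyn y : fq (dyn y) = fg y.
Proof. by rewrite /fq /fg /fh; vec; ring. Qed.

Lemma dyn_S y : dyn y CS = fh y. Proof. by []. Qed.

Lemma dyn_u y : dyn y Cu = (rho2 p)^-1 *: (fq y - ga p *: D (y Ct2)).
Proof. by rewrite /fq; vec; ring. Qed.

Lemma fh_dyn y : fh (dyn y) = - (kk p / rho1 p) *: La (y CS)
  - (rho2 p)^-1 *: (fq y - ga p *: D (y Ct2)).
Proof. by rewrite /fh /fq /La; vec; field; rewrite r1 r2. Qed.

Lemma fg_dyn y : fg (dyn y) =
  (bb p / rho2 p) *: D2 (fq y - ga p *: D (y Ct2))
  - (kk p / rho2 p) *: (fq y - ga p *: D (y Ct2))
  - (kk p ^+ 2 / rho1 p) *: La (y CS).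
Proof. by rewrite /fg fh_dyn dyn_u /La; vec; ring. Qed.

Lemma fM_dyn y : fM (dyn y) = kk p *: D2 (y CS)
  + (ll p ^+ 2 * bb p) *: D (y Cz) - (ll p ^+ 2 * ga p) *: D (y Ct2).
Proof.
rewrite /fM fh_dyn dyn_u /La /fq /rho0; vec; field; by rewrite r1 r2.
Qed.

Lemma fY2_dyn y : fY2 (dyn y) = (ka2 p + nu * ll p ^+ 2 * ga p) *: D (y Ct2)
  - (nu * kk p) *: D2 (y CS) - (nu * ll p ^+ 2 * bb p) *: D (y Cz).
Proof. by rewrite /fY2 fM_dyn; vec; rewrite -[in RHS](indE (ka2 p)); ring. Qed.

Ltac form_tac := lazymatch goal with
  | |- form _ (fun y => @?f y + @?g y) =>
      apply: (@formD R X p f g); form_tac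
  | |- form _ (fun y => - @?f y) => apply: (@formN R X p f); form_tac
  | |- form _ (fun y => ?a *: @?f y) => apply: (@formZ R X p a f); form_tac
  | |- form _ (fun y => y ?i) => exact: (@form_comp R X p i)
  | |- form _ (fun y => _ (@?f y)) => apply: (@form_der R X p f); form_tac end.

Lemma form_P : form p fP. Proof. by rewrite /fP; form_tac. Qed.
Lemma form_Y1 : form p fY1. Proof. by rewrite /fY1 /fP; form_tac. Qed.
Lemma form_h : form p fh. Proof. by rewrite /fh; form_tac. Qed.
Lemma form_y : form p fy. Proof. by rewrite /fy; form_tac. Qed.
Lemma form_q : form p fq. Proof. by rewrite /fq; form_tac. Qed.
Lemma form_g : form p fg. Proof. by rewrite /fg /fh; form_tac. Qed.
Lemma form_M : form p fM. Proof. by rewrite /fM /fh; form_tac. Qed.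
Lemma form_Y2 : form p fY2. Proof. by rewrite /fY2 /fM /fh; form_tac. Qed.

Lemma tame_wt i j : match i with Cc1 | Cc2 => false | _ => true end ->
  (j <= 4)%N -> tame p (fun y => iter j D (y i)).
Proof.
move=> ic j4; apply: tame_comp j4 => //.
have := (rho1_gt0 p, rho2_gt0 p, ga_gt0 p, bb_gt0 p, kk_gt0 p, k0_gt0 p).
have := (m1_gt0 p, m2_gt0 p).
move=> [h1 h2] [[[[[h5 h6] h7] h8] h9] h10].
by case: i ic => //= _; rewrite ?mulr_gt0 ?invr_gt0.
Qed.

Lemma iter_derN j (f : X) : iter j D (- f) = - iter j D f.
Proof. by elim: j => //= j ->; rewrite derE. Qed.

Lemma iter_der1 j (f : X) : iter j D (D f) = iter j.+1 D f.
Proof. by rewrite iterSr. Qed.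

Ltac tame_tac := lazymatch goal with
  | |- bounded_by _ (fun y => @?f y + @?g y) => apply: bounded_byD; tame_tac
  | |- bounded_by _ (fun y => - @?f y) => apply: bounded_byN; tame_tac
  | |- bounded_by _ (fun y => ka1 p *: _ (y Cc1)) => refine (proj1 (@tame_c R X p _ _)); lia
  | |- bounded_by _ (fun y => ka2 p *: _ (y Cc2)) => refine (proj2 (@tame_c R X p _ _)); lia
  | |- bounded_by _ (fun y => ?a *: @?f y) => apply: bounded_byZ; tame_tac
  | |- bounded_by _ (fun y => _ (y ?i)) => apply: tame_wt; [by []|lia]
  end.
Ltac tame_form := rewrite /tame; under eq_fun do
  rewrite ?(iter_derD, iter_derN, iter_derZ, iter_der1); tame_tac.

Lemma tame_P j : (j <= 3)%N -> tame p (fun y => iter j D (fP y)).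
Proof. by move=> j3; rewrite /fP; tame_form. Qed.
Lemma tame_Y1 j : (j <= 3)%N -> tame p (fun y => iter j D (fY1 y)).
Proof. by move=> j3; rewrite /fY1 /fP; tame_form. Qed.
Lemma tame_h j : (j <= 3)%N -> tame p (fun y => iter j D (fh y)).
Proof. by move=> j3; rewrite /fh; tame_form. Qed.
Lemma tame_y j : (j <= 4)%N -> tame p (fun y => iter j D (fy y)).
Proof. by move=> j3; rewrite /fy; tame_form. Qed.
Lemma tame_q j : (j <= 3)%N -> tame p (fun y => iter j D (fq y)).
Proof. by move=> j3; rewrite /fq; tame_form. Qed.
Lemma tame_g j : (j <= 2)%N -> tame p (fun y => iter j D (fg y)).
Proof. by move=> j3; rewrite /fg /fh; tame_form. Qed.
Lemma tame_M j : (j <= 3)%N -> tame p (fun y => iter j D (fM y)).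
Proof. by move=> j3; rewrite /fM /fh; tame_form. Qed.
Lemma tame_Y2 j : (j <= 3)%N -> tame p (fun y => iter j D (fY2 y)).
Proof. by move=> j3; rewrite /fY2 /fM /fh; tame_form. Qed.

(** The quantities [QA1] to [QA3] form the chain of the stretch, [QB1] to [QB8]
    that of the shear, both in the order in which they are estimated. *)
Definition QA1 y := nn (D (fY1 y)) + nn (D2 (fY1 y)).
Definition QA2 y := nn (ll p *: D (y CN)) + nn (ll p *: D2 (y CN))
  + nn (D2 (y CN)) + nn (D3 (y CN)).
Definition QA3 y := nn (D (fP y)) + nn (D2 (fP y)).

Definition QB1 y := nn (D2 (fy y)) + nn (D3 (fy y)) + nn (D4 (fy y)).
Definition QB2 y := nn (D2 (fq y)) + nn (D3 (fq y)).
Definition QB3 y := nn (D2 (fg y)).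
Definition QB4 y := nn (ll p *: D2 (y CS)) + nn (D3 (y CS)).
Definition QB5 y := nn (D2 (fh y)).
Definition QB6 y := nn (D2 (fY2 y)).
Definition QB7 y := nn (D2 (y Cz)).
Definition QB8 y := nn (D2 (y Cu)).

Ltac unQ := rewrite ?/QA1 ?/QA2 ?/QA3 ?/QB1 ?/QB2 ?/QB3 ?/QB4 ?/QB5 ?/QB6 ?/QB7 ?/QB8.

Ltac pos := by rewrite ?addr_ge0 ?nn_ge0 ?dissipation_ge0.
Ltac q0 := by move=> ?; unQ; pos.
Ltac le_cB := lazymatch goal with
  | |- context [Ct1] => first [exact: (@dissipation_t1 R X 0)|exact: (@dissipation_t1 R X 1)|exact: (@dissipation_t1 R X 2)
      |exact: (@dissipation_t1 R X 3)|exact: (@dissipation_t1 R X 4)]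
  | |- context [Ct2] => first [exact: (@dissipation_t2 R X 0)|exact: (@dissipation_t2 R X 1)|exact: (@dissipation_t2 R X 2)
      |exact: (@dissipation_t2 R X 3)|exact: (@dissipation_t2 R X 4)] end.
Ltac le_sum := match goal with
  | |- is_true (?a <= ?a) => exact: lexx
  | |- is_true (_ <= @dissipation _ _ _) => le_cB
  | |- is_true (_ <= _ + _) => apply: ler_wpDr; [pos|le_sum]
  | |- is_true (_ <= _ + _) => apply: ler_wpDl; [pos|le_sum] end.
(* A vector is bounded by a sum when its square is one of the terms, or the square
   of a derivative of a temperature while [dissipation] is one of the terms. *)
Ltac bnd := apply: bounded_by_nn; let y := fresh "y" in intro y; unQ; le_sum.
Ltac absorb := lazymatch goal with
  | |- absorbed _ _ (fun y => @?f y + @?g y) =>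
     apply: (@absorbedD _ _ _ _ f g); absorb
  | |- _ => first [by apply: absorbed_dotb; [q0|bnd|bnd]|by apply: absorbed_dot; bnd|
         by apply: absorbed_dotC; bnd] end.

Ltac tame1 := first [exact: (@tame_wt _ 0)|exact: (@tame_wt _ 1)|exact: (@tame_wt _ 2)
  |exact: (@tame_wt _ 3)
  |exact: (@tame_P 0)|exact: (@tame_P 1)|exact: (@tame_P 2)
  |exact: (@tame_Y1 1)|exact: (@tame_Y1 2)|exact: (@tame_h 2)
  |exact: (@tame_y 2)|exact: (@tame_y 3)|exact: (@tame_y 4)
  |exact: (@tame_q 2)|exact: (@tame_q 3)|exact: (@tame_g 2)|exact: (@tame_M 1)
  |exact: (@tame_Y2 1)|exact: (@tame_Y2 2)|exact: (@tame_g 3)].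
Ltac tamed := do ?[apply: tamefD|apply: tamefZ|apply: tame_dot]; tame1.
Ltac forms := do ?apply: form_der;
  first [exact: form_comp|exact: form_P|exact: form_Y1|exact: form_h|exact: form_y
        |exact: form_q|exact: form_g|exact: form_M|exact: form_Y2].

(** In each link the auxiliary function [Z] lists what remains of the derivative
    of the functional once the quantity to be estimated has been removed, written
    with the vectors whose squares occur in the quantities. *)
Lemma stepA1 : controlled p (fun=> 0) QA2 QA1.
Proof.
have F1 : form p (fun y => D (y Ct1)) by forms.
have F2 : form p (fun y => D2 (y Ct1)) by forms.
have F3 : form p (fun y => D (fY1 y)) by forms.
have F4 : form p (fun y => D2 (fY1 y)) by forms.
pose mr := m1 p / rho1 p.
pose Z y :=
    (- al1 p) * dot (D3 (y Ct1)) (D (fY1 y))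
  + (- al1 p) * dot (D4 (y Ct1)) (D2 (fY1 y))
  + (ka1 p + mr * ga p + mr * ga p * ll p ^+ 2) * dot (D2 (y Ct1)) (D2 (y Ct1))
  + (ka1 p + mr * ga p) * dot (D3 (y Ct1)) (D3 (y Ct1))
  + (mr * ga p * ll p ^+ 2) * dot (D (y Ct1)) (D (y Ct1))
  + (- mr * k0 p * ll p) * dot (D (y Ct1)) (ll p *: D (y CN))
  + (- mr * k0 p * ll p ^+ 2 - mr * k0 p) * dot (D2 (y Ct1)) (D2 (y CN))
  + (- mr * k0 p) * dot (D3 (y Ct1)) (D3 (y CN)).
apply: (@controlled_intro R X p 1 _ _ _ _ _ Z ltr01
  (sflowsD (sflows_dot F1 F3) (sflows_dot F2 F4))).
- by tamed.
- q0.
- q0.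
- move=> y; rewrite dyn_t1 fY1_dyn /QA1 /Z /La /nn -/mr.
  move: (fY1 y) (y Ct1) (y CN) => Y t N.
  by rewrite !derE !dotE !dot_der ?(swapE t Y) ?(swapE t N) ?selfE; ring.
- by rewrite /Z; absorb.
Qed.

Lemma stepA2 : controlled p QA1 QA3 QA2.
Proof.
have F1 : form p (fun y => D (y CN)) by forms.
have F2 : form p (fun y => D2 (y CN)) by forms.
have F3 : form p (fun y => D (fY1 y)) by forms.
have F4 : form p (fun y => D2 (fY1 y)) by forms.
pose mr := m1 p / rho1 p.
have mr0 : 0 < mr * k0 p by rewrite !mulr_gt0 ?invr_gt0 ?m1_gt0 ?rho1_gt0 ?k0_gt0.
pose Z y :=
    (ka1 p + mr * ga p + mr * ga p * ll p ^+ 2) * dot (D2 (y Ct1)) (D2 (y CN))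
  + (ka1 p + mr * ga p) * dot (D3 (y Ct1)) (D3 (y CN))
  + (mr * ga p * ll p) * dot (D (y Ct1)) (ll p *: D (y CN))
  + (- 1) * dot (D (fY1 y)) (D (fP y))
  + (- 1) * dot (D2 (fY1 y)) (D2 (fP y)).
apply: (@controlled_intro R X p _ _ _ _ _ _ Z mr0
  (sflowsD (sflows_dot F3 F1) (sflows_dot F4 F2))).
- by tamed.
- q0.
- q0.
- move=> y; rewrite dyn_N fY1_dyn /QA2 /Z /La /nn -/mr.
  move: (fY1 y) (y Ct1) (y CN) (fP y) => Y t N P.
  by rewrite !derE !dotE !dot_der ?(swapE t Y) ?(swapE t N) ?selfE; ring.
- by rewrite /Z; absorb.
Qed.

Lemma stepA3 : controlled p (fun y => QA1 y + QA2 y) (fun=> 0) QA3.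
Proof.
have F1 : form p (fun y => D (y CN)) by forms.
have F2 : form p (fun y => D2 (y CN)) by forms.
have F3 : form p (fun y => D (fP y)) by forms.
have F4 : form p (fun y => D2 (fP y)) by forms.
pose Z y :=
    (k0 p / rho1 p) * dot (ll p *: D (y CN)) (ll p *: D (y CN))
  + (k0 p / rho1 p) * dot (ll p *: D2 (y CN)) (ll p *: D2 (y CN))
  + (k0 p / rho1 p) * dot (D2 (y CN)) (D2 (y CN))
  + (k0 p / rho1 p) * dot (D3 (y CN)) (D3 (y CN))
  + (- (ga p / rho1 p) * (1 + ll p ^+ 2)) * dot (D2 (y Ct1)) (D2 (y CN))
  + (- (ga p / rho1 p)) * dot (D3 (y Ct1)) (D3 (y CN))
  + (- (ga p / rho1 p) * ll p) * dot (D (y Ct1)) (ll p *: D (y CN)).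
apply: (@controlled_intro R X p 1 _ _ _ _ _ Z ltr01
  (sflowsD (sflows_dot F1 F3) (sflows_dot F2 F4))).
- by tamed.
- q0.
- q0.
- move=> y; rewrite dyn_N fP_dyn /QA3 /Z /La /nn.
  move: (y Ct1) (y CN) (fP y) => t N P.
  by rewrite !derE !dotE !dot_der ?(swapE t N) ?selfE; ring.
- by rewrite /Z; absorb.
Qed.

Lemma stepB1 : controlled p (fun=> 0) QB2 QB1.
Proof.
have F1 : form p (fun y => D (y Ct2)) by forms.
have F2 : form p (fun y => D2 (y Ct2)) by forms.
have F3 : form p (fun y => D3 (y Ct2)) by forms.
have G1 : form p (fun y => D2 (fy y)) by forms.
have G2 : form p (fun y => D3 (fy y)) by forms.
have G3 : form p (fun y => D4 (fy y)) by forms.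
pose a := m2 p / rho2 p; pose c := ka2 p + m2 p * ga p / rho2 p.
pose Z y :=
    (- al2 p) * dot (D3 (y Ct2)) (D2 (fy y))
  + (- al2 p) * dot (D4 (y Ct2)) (D3 (fy y))
  + (- al2 p) * dot (D5 (y Ct2)) (D4 (fy y))
  + a * dot (D (y Ct2)) (D2 (fq y))
  + a * dot (D2 (y Ct2)) (D3 (fq y))
  + (- a) * dot (D4 (y Ct2)) (D3 (fq y))
  + c * dot (D2 (y Ct2)) (D2 (y Ct2))
  + c * dot (D3 (y Ct2)) (D3 (y Ct2))
  + c * dot (D4 (y Ct2)) (D4 (y Ct2)).
apply: (@controlled_intro R X p 1 _ _ _ _ _ Z ltr01
  (sflowsD (sflowsD (sflows_dot F1 G1) (sflows_dot F2 G2)) (sflows_dot F3 G3))).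
- by tamed.
- q0.
- q0.
- move=> y; rewrite dyn_t2 fy_dyn /QB1 /Z /nn -/a -/c.
  move: (y Ct2) (fy y) (fq y) => t f q.
  by rewrite !derE !dotE !dot_der ?(swapE t f) ?(swapE t q) ?selfE; ring.
- by rewrite /Z; absorb.
Qed.

Lemma stepB2 : controlled p QB1 QB3 QB2.
Proof.
have F1 : form p (fun y => D2 (fy y)) by forms.
have F2 : form p (fun y => D3 (fy y)) by forms.
have G1 : form p (fun y => D2 (fq y)) by forms.
have G2 : form p (fun y => D3 (fq y)) by forms.
pose a := m2 p / rho2 p; pose c := ka2 p + m2 p * ga p / rho2 p.
have a0 : 0 < a by rewrite divr_gt0 ?m2_gt0 ?rho2_gt0.
pose Z y :=
    c * dot (D3 (y Ct2)) (D2 (fq y)) + c * dot (D4 (y Ct2)) (D3 (fq y))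
  + 1 * dot (D2 (fy y)) (D2 (fg y)) + (- 1) * dot (D4 (fy y)) (D2 (fg y)).
apply: (@controlled_intro R X p a _ _ _ _ _ Z a0
  (sflowsZ (- 1) (sflowsD (sflows_dot F1 G1) (sflows_dot F2 G2)))).
- by tamed.
- q0.
- q0.
- move=> y; rewrite fy_dyn fq_dyn /QB2 /Z /nn -/a -/c.
  move: (y Ct2) (fy y) (fq y) (fg y) => t f q g.
  by rewrite !derE !dotE !dot_der ?(swapE t q) ?selfE; ring.
- by rewrite /Z; absorb.
Qed.

Lemma stepB3 : controlled p (fun y => QB1 y + QB2 y) QB4 QB3.
Proof.
have F1 : form p (fun y => D2 (fq y)) by forms.
have G1 : form p (fun y => D2 (fg y)) by forms.
pose Z y :=
    (bb p / rho2 p) * dot (D3 (fq y)) (D3 (fq y))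
  + (kk p / rho2 p) * dot (D2 (fq y)) (D2 (fq y))
  + (bb p / rho2 p * ga p) * dot (D5 (y Ct2)) (D2 (fq y))
  + (- (kk p / rho2 p) * ga p) * dot (D3 (y Ct2)) (D2 (fq y))
  + (kk p ^+ 2 / rho1 p * ll p) * dot (D2 (fq y)) (ll p *: D2 (y CS))
  + (kk p ^+ 2 / rho1 p) * dot (D3 (fq y)) (D3 (y CS)).
apply: (@controlled_intro R X p 1 _ _ _ _ _ Z ltr01 (sflows_dot F1 G1)).
- by tamed.
- q0.
- q0.
- move=> y; rewrite fg_dyn fq_dyn /QB3 /Z /La /nn.
  move: (y Ct2) (fq y) (fg y) (y CS) => t q g S.
  by rewrite !derE !dotE !dot_der ?(swapE t q) ?selfE; ring.
- by rewrite /Z; absorb.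
Qed.

Lemma stepB4 : controlled p (fun y => QB1 y + QB2 y + QB3 y) QB5 QB4.
Proof.
have F1 : form p (fun y => D2 (fg y)) by forms.
have G1 : form p (fun y => D2 (y CS)) by forms.
have a0 : 0 < kk p ^+ 2 / rho1 p by rewrite divr_gt0 ?exprn_gt0 ?kk_gt0 ?rho1_gt0.
pose Z y :=
    1 * dot (D2 (fg y)) (D2 (fh y))
  + (- (bb p / rho2 p)) * dot (D3 (fq y)) (D3 (y CS))
  + (- (kk p / rho2 p) / ll p) * dot (D2 (fq y)) (ll p *: D2 (y CS))
  + (bb p / rho2 p * ga p) * dot (D4 (y Ct2)) (D3 (y CS))
  + (kk p / rho2 p * ga p / ll p) * dot (D3 (y Ct2)) (ll p *: D2 (y CS)).
apply: (@controlled_intro R X p _ _ _ _ _ _ Z a0 (sflowsZ (- 1) (sflows_dot F1 G1))).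
- by tamed.
- q0.
- q0.
- move=> y; rewrite fg_dyn dyn_S /QB4 /Z /La /nn.
  move: (y Ct2) (fq y) (fg y) (y CS) (fh y) => t q g S h.
  by rewrite !derE !dotE !dot_der ?(swapE t S) ?(swapE q S) ?selfE; field; rewrite l0 r1 r2.
- by rewrite /Z; absorb.
Qed.

Lemma stepB5 : controlled p (fun y => QB1 y + QB2 y + QB3 y + QB4 y) QB6 QB5.
Proof.
have F1 : form p (fun y => D2 (y CS)) by forms.
have G1 : form p (fun y => D2 (fh y)) by forms.
pose Z y :=
    (kk p / rho1 p) * dot (ll p *: D2 (y CS)) (ll p *: D2 (y CS))
  + (kk p / rho1 p) * dot (D3 (y CS)) (D3 (y CS))
  + ((rho2 p)^-1 / ll p) * dot (D2 (fq y)) (ll p *: D2 (y CS))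
  + (- ((rho2 p)^-1 / ll p) * ga p) * dot (D3 (y Ct2)) (ll p *: D2 (y CS)).
apply: (@controlled_intro R X p 1 _ _ _ _ _ Z ltr01 (sflows_dot F1 G1)).
- by tamed.
- q0.
- q0.
- move=> y; rewrite fh_dyn dyn_S /QB5 /Z /La /nn.
  move: (y Ct2) (fq y) (y CS) (fh y) => t q S h.
  by rewrite !derE !dotE !dot_der ?(swapE t S) ?(swapE q S) ?selfE; field; rewrite l0 r1 r2.
- by rewrite /Z; absorb.
Qed.

Let ll2_gt0 : 0 < ll p ^+ 2. Proof. by rewrite exprn_gt0 ?ll_gt0. Qed.
Let nu_gt0 : 0 < nu. Proof. by rewrite divr_gt0 ?m2_gt0. Qed.

(** [fY2] and [fy] differ by a multiple of [fh], so that this link is algebraic: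
    the functional is zero. *)
Lemma stepB6 : controlled p (fun y => QB1 y + QB2 y + QB3 y + QB4 y + QB5 y) QB7 QB6.
Proof.
have FF := sflowsZ 0 (sflows_dot (@form_comp R X p CS) (@form_comp R X p CS)).
pose c := nu * rho1 p.
move=> d d0; exists (2 + 2 * c ^+ 2); do 2!eexists; split; [|exact: FF| |].
- by rewrite addr_ge0 // mulr_ge0 // sqr_ge0.
- by exists 0 => y; cbv beta; rewrite !mul0r normr0.
move=> y; cbv beta; rewrite mul0r add0r.
have -> : QB6 y = nn (D2 (fy y) + (- c) *: D2 (fh y)).
  congr nn; rewrite /fY2 /fM /fy /c; vec; rewrite /nu; field; exact: r0.
apply: (le_trans (nnD _ _)); rewrite nnZ sqrrN.
have c0 : 0 <= c ^+ 2 by rewrite sqr_ge0.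
have b0 := dissipation_ge0 y.
have q1 : nn (D2 (fy y)) <= QB1 y + QB2 y + QB3 y + QB4 y + QB5 y by unQ; le_sum.
have q5 : nn (D2 (fh y)) <= QB1 y + QB2 y + QB3 y + QB4 y + QB5 y by unQ; le_sum.
have n7 : 0 <= d * QB7 y by rewrite mulr_ge0 ?nn_ge0 // ltW.
have n1 := nn_ge0 (D2 (fy y)).
move: (_ + QB5 y) q1 q5 => q q1 q5.
have : c ^+ 2 * nn (D2 (fh y)) <= c ^+ 2 * q by rewrite ler_wpM2l.
have : 0 <= c ^+ 2 * cB y by rewrite mulr_ge0.
have -> : (2 + 2 * c ^+ 2) * (cB y + q) =
    2 * cB y + 2 * q + 2 * (c ^+ 2 * cB y) + 2 * (c ^+ 2 * q) by ring.
lra.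
Qed.

Lemma stepB7 :
  controlled p (fun y => QB1 y + QB2 y + QB3 y + QB4 y + QB5 y + QB6 y) QB8 QB7.
Proof.
have F1 : form p (fun y => D (fY2 y)) by forms.
have G1 : form p (fun y => D2 (y Cz)) by forms.
pose e := ka2 p + nu * ll p ^+ 2 * ga p.
have a0 : 0 < nu * ll p ^+ 2 * bb p by do ?apply: mulr_gt0 => //; exact: bb_gt0.
pose Z y :=
    e * dot (D2 (y Ct2)) (D2 (y Cz))
  + (- (nu * kk p)) * dot (D3 (y CS)) (D2 (y Cz))
  + (- 1) * dot (D2 (fY2 y)) (D2 (y Cu)).
apply: (@controlled_intro R X p _ _ _ _ _ _ Z a0 (sflowsZ (- 1) (sflows_dot F1 G1))).
- by tamed.
- q0.
- q0.
- move=> y; rewrite fY2_dyn /QB7 /Z /nn -/e [dynamics _ _ _]/=.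
  move: (y Ct2) (y CS) (y Cz) (fY2 y) (y Cu) => t S z Y u.
  by rewrite !derE !dotE !dot_der ?(swapE t z) ?(swapE S z) ?selfE; ring.
- by rewrite /Z; absorb.
Qed.

Lemma stepB8 :
  controlled p (fun y => QB1 y + QB2 y + QB3 y + QB4 y + QB5 y + QB6 y + QB7 y) (fun=> 0) QB8.
Proof.
have F1 : form p (fun y => D (fM y)) by forms.
have G1 : form p (fun y => D2 (y Cz)) by forms.
pose Z y :=
    kk p * dot (D3 (y CS)) (D2 (y Cz))
  + (ll p ^+ 2 * bb p) * dot (D2 (y Cz)) (D2 (y Cz))
  + (- (ll p ^+ 2 * ga p)) * dot (D2 (y Ct2)) (D2 (y Cz))
  + (- rho1 p) * dot (D2 (fh y)) (D2 (y Cu)).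
apply: (@controlled_intro R X p _ _ _ _ _ _ Z rho0_gt0 (sflowsZ (- 1) (sflows_dot F1 G1))).
- by tamed.
- q0.
- q0.
- move=> y; rewrite fM_dyn /QB8 /Z /nn /fM [dynamics _ _ _]/=.
  move: (y Ct2) (y CS) (y Cz) (fh y) (y Cu) => t S z h u.
  by rewrite !derE !dotE !dot_der ?(swapE t z) ?(swapE S z) ?selfE; ring.
- by rewrite /Z; absorb.
Qed.

End lyapunov.

(** * The Lyapunov functional *)

Section lyapunov_functional.
Context {R : realType} (X : skewSpace R) (p : coefs R).
Local Notation D := (@der R X).
Local Notation D2 f := (D (D f)).
Local Notation state := (state X).
Implicit Types (y : state) (f g : state -> X).
Local Notation dyn := (@dynamics R X p).
Local Notation cE := (@energy2 R X p).
Local Notation cB := (@dissipation R X).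
Local Notation En := (@energy R X p).

Definition QA y := QA1 p y + QA2 p y + QA3 p y.
Definition QB y := QB1 p y + QB2 p y + QB3 p y + QB4 p y + QB5 p y
  + QB6 p y + QB7 y + QB8 y.

Ltac unQ := rewrite ?/QA ?/QB /QA1 ?/QA2 ?/QA3 ?/QB1 ?/QB2 ?/QB3 ?/QB4 ?/QB5 ?/QB6 ?/QB7 ?/QB8.
Ltac unq := rewrite /QA /QB /QA1 /QA2 /QA3 /QB1 /QB2 /QB3 /QB4 /QB5 /QB6 /QB7 /QB8.
Ltac q0 := move=> y; rewrite ?/QA1 ?/QA2 ?/QA3 ?/QB1 ?/QB2 ?/QB3 ?/QB4 ?/QB5 ?/QB6
  ?/QB7 ?/QB8; by rewrite ?addr_ge0 ?nn_ge0.

Lemma controlled_A : controlled p (fun=> 0) (fun=> 0) QA.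
Proof.
apply: controlled_step; [q0|q0|by []| |exact: stepA3].
apply: controlled_step; [q0|q0|q0|exact: stepA1|exact: stepA2].
Qed.

Lemma controlled_B : controlled p (fun=> 0) (fun=> 0) QB.
Proof.
apply: controlled_step; [q0|q0|by []| |exact: stepB8].
apply: controlled_step; [q0|q0|q0| |exact: stepB7].
apply: controlled_step; [q0|q0|q0| |exact: stepB6].
apply: controlled_step; [q0|q0|q0| |exact: stepB5].
apply: controlled_step; [q0|q0|q0| |exact: stepB4].
apply: controlled_step; [q0|q0|q0| |exact: stepB3].
apply: controlled_step; [q0|q0|q0|exact: stepB1|exact: stepB2].
Qed.

Definition QT y := QA y + QB y + cB y.

Lemma QA_ge0 y : 0 <= QA y. Proof. unq; do ?apply: addr_ge0; exact: nn_ge0. Qed.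
Lemma QB_ge0 y : 0 <= QB y. Proof. unq; do ?apply: addr_ge0; exact: nn_ge0. Qed.
Lemma QT_ge0 y : 0 <= QT y.
Proof. by apply: addr_ge0; [apply: addr_ge0; [exact: QA_ge0|exact: QB_ge0]|exact: dissipation_ge0]. Qed.

Ltac pos := by rewrite ?addr_ge0 ?nn_ge0 ?dissipation_ge0.
Ltac le_sum := match goal with
  | |- is_true (?a <= ?a) => exact: lexx
  | |- is_true (_ <= _ + _) => apply: ler_wpDr; [pos|le_sum]
  | |- is_true (_ <= _ + _) => apply: ler_wpDl; [pos|le_sum] end.
Ltac bnd := apply: bounded_by_nn; let y := fresh "y" in intro y; rewrite /QT; unq; le_sum.

Lemma bounded_by_eq Q f g : (forall y, f y = g y) -> bounded_by Q f -> bounded_by Q g.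
Proof. by move=> /funext ->. Qed.

Let r0 := gt_eqF (ll_gt0 p).

(** Inverting the change of unknowns which decouples the system. *)
Lemma QT_comp i : exists C, forall y, wt p i * nn (D2 (y i)) <= C * QT y.
Proof.
have simple j : bounded_by QT (fun y => D2 (y j)) ->
    exists C, forall y, wt p j * nn (D2 (y j)) <= C * QT y.
  move=> [C [C0 H]]; exists (wt p j * C) => y.
  by rewrite -mulrA ler_wpM2l ?wt_ge0.
have bh : bounded_by QT (fun y => D2 (fh p y)) by bnd.
have bu : bounded_by QT (fun y => D2 (y Cu)) by bnd.
have [Ch [Ch0 bH]] : bounded_by QT (fun y => D2 (fh p y) + D2 (y Cu)).
  exact: bounded_byD.
have [Cp [Cp0 bP]] : bounded_by QT (fun y => D2 (fP p y)) by bnd.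
have vw y : ll p ^+ 2 * (nn (D2 (y Cv)) + nn (D2 (y Cw))) <= (Cp + Ch) * QT y.
  have := bP y; have := bH y.
  have -> : D2 (fh p y) + D2 (y Cu) = D (D2 (y Cv)) - ll p *: D2 (y Cw).
    by apply: dot_ext => k; rewrite /fh !derE !dotE; ring.
  have -> : D2 (fP p y) = D (D2 (y Cw)) - ll p *: D2 (y Cv).
    by apply: dot_ext => k; rewrite /fP !derE !dotE; ring.
  move: (D2 (y Cv)) (D2 (y Cw)) => v w.
  (* The cross terms cancel because [D] is skew, so that [v] and [w] are controlled. *)
  have E : nn (D v - ll p *: w) + nn (D w - ll p *: v) =
     nn (D v) + nn (D w) + ll p ^+ 2 * (nn v + nn w).
    by rewrite /nn !dotE !dot_der (swapE v w); ring.
  have := nn_ge0 (D v); have := nn_ge0 (D w); lra.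
have l2 : 0 < ll p ^+ 2 by rewrite exprn_gt0 ?ll_gt0.
have vw2 y : nn (D2 (y Cv)) + nn (D2 (y Cw)) <= (ll p ^+ 2)^-1 * ((Cp + Ch) * QT y).
  by rewrite ler_pdivlMl.
have chi (k m : R) j : wt p j = k * ga p / m -> bounded_by QT (fun y => k *: D2 (y j)) ->
    exists C, forall y, wt p j * nn (D2 (y j)) <= C * QT y.
  move=> wj [C [C0 H]]; exists (`|ga p / m / k| * C) => y.
  have -> : wt p j * nn (D2 (y j)) = ga p / m / k * nn (k *: D2 (y j)).
    rewrite wj nnZ; have [->|k0] := eqVneq k 0; first by rewrite invr0 !(mul0r, mulr0).
    by move: (m^-1) => mi; field.
  apply: (@le_trans _ _ (`|ga p / m / k| * nn (k *: D2 (y j)))).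
    by rewrite ler_wpM2r ?nn_ge0 // ler_norm.
  by rewrite -[leRHS]mulrA ler_wpM2l.
case: i.
- exists (wt p Cv * ((ll p ^+ 2)^-1 * (Cp + Ch))) => y; rewrite -!mulrA ler_wpM2l ?wt_ge0 //.
  have := vw2 y; have := nn_ge0 (D2 (y Cw)); lra.
- exact: simple.
- exists (wt p Cw * ((ll p ^+ 2)^-1 * (Cp + Ch))) => y; rewrite -!mulrA ler_wpM2l ?wt_ge0 //.
  have := vw2 y; have := nn_ge0 (D2 (y Cv)); lra.
- apply: simple; apply: bounded_by_nn => y; apply: (le_trans (@dissipation_t1 R X 1 y isT)).
  by rewrite ler_wpDl //; apply: addr_ge0; [exact: QA_ge0|exact: QB_ge0].
- apply: (chi (ka1 p) (m1 p)) => //.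
  apply: (@bounded_by_eq _ (fun y => D (fY1 p y) + m1 p *: D (fP p y))).
    by move=> y; rewrite /fY1; apply: dot_ext => k; rewrite !derE !dotE; ring.
  by apply: bounded_byD; [bnd|apply: bounded_byZ; bnd].
- apply: simple; apply: bounded_by_nn => y; apply: (le_trans (@dissipation_t2 R X 1 y isT)).
  by rewrite ler_wpDl //; apply: addr_ge0; [exact: QA_ge0|exact: QB_ge0].
- apply: (chi (ka2 p) (m2 p)) => //.
  apply: (@bounded_by_eq _ (fun y => D2 (fY2 p y) +
    nu p *: (rho1 p *: D2 (fh p y) + rho0 p *: D2 (y Cu)))).
    by move=> y; rewrite /fY2 /fM; apply: dot_ext => k; rewrite !derE !dotE; ring.
  apply: bounded_byD; [bnd|apply: bounded_byZ].
  by apply: bounded_byD; apply: bounded_byZ.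
- by apply: simple; bnd.
- apply: simple; apply: (@bounded_by_eq _ (fun y => (ll p)^-1 *: (ll p *: D2 (y CS)))).
    by move=> y; rewrite scalerA mulVf ?r0 // scale1r.
  by apply: bounded_byZ; bnd.
- by apply: simple; bnd.
Qed.

Lemma energy_le_QT : exists C, 0 < C /\ forall y, En (smap D (smap D y)) <= C * QT y.
Proof.
have [C H] : exists C, forall y, En (smap D (smap D y)) <= C * QT y.
  rewrite /En; elim: comps => [|i s [C IH]].
    by exists 0 => y; rewrite big_nil mul0r.
  have [C' H] := QT_comp i; exists (C' + C) => y; rewrite big_cons mulrDl.
  by apply: lerD; [exact: H|exact: IH].
exists (`|C| + 1); split; first by rewrite ltr_wpDl.
move=> y; apply: (le_trans (H y)); rewrite ler_wpM2r ?QT_ge0 //.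
by rewrite (le_trans (ler_norm _)) // lerDl.
Qed.

(** The energy is taken with a factor [A] so large that it dominates the
    functionals of both chains and that its dissipation pays for the terms in
    [cB] that they leave. *)
Theorem lyapunov : exists L L' (c C : R), [/\ 0 < c, 0 < C, sflows p L L',
  forall y, cE y <= L y <= C * cE y &
  forall y, L' y <= - c * En (smap D (smap D y))].
Proof.
have [C2 [C20 HC2]] := energy_le_QT.
have [c0 [c00 Hc0]] := dissipation_le X p.
have [K1 [F [F' [K10 FF [C1 FC] QF]]]] := controlled_A ltr01.
have [K2 [G [G' [K20 GG [C3 GC] QG]]]] := controlled_B ltr01.
(* [1] keeps [L] above the energy, [C1] and [C3] absorb the functionals, and the
   last term pays for the dissipation used by the chains. *)
pose A := 1 + `|C1| + `|C3| + (K1 + K2 + 1) / c0.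
have KA : (K1 + K2 + 1) <= A * c0.
  rewrite /A mulrDl divfK ?gt_eqF // lerDr; apply: mulr_ge0; last exact: ltW.
  by rewrite !addr_ge0.
exists (fun y => A * cE y + (- 1) * (F y + G y)).
exists (fun y => A * (- dissip p (smap (@opB R X) (smap (@opB R X) y))) + (- 1) * (F' y + G' y)).
have A1 : 1 + `|C1| + `|C3| <= A.
  by rewrite lerDl divr_ge0 ?addr_ge0 ?addr_ge0 // ltW.
exists C2^-1, (A + `|C1| + `|C3|); split.
- by rewrite invr_gt0.
- by have := normr_ge0 C1; have := normr_ge0 C3; lra.
- exact: sflowsD (sflowsZ _ (@energy2_flows R X p)) (sflowsZ _ (sflowsD FF GG)).
- move=> y; have e0 := @energy2_ge0 R X p y.
  have Fy : `|F y| <= `|C1| * cE y.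
    by apply: (le_trans (FC y)); rewrite ler_wpM2r // ler_norm.
  have Gy : `|G y| <= `|C3| * cE y.
    by apply: (le_trans (GC y)); rewrite ler_wpM2r // ler_norm.
  move: Fy Gy; rewrite !ler_norml => /andP[f1 f2] /andP[g1 g2].
  have h : (1 + `|C1| + `|C3|) * cE y <= A * cE y by rewrite ler_wpM2r.
  by apply/andP; split; lra.
- move=> y; have := HC2 y; have := QF y; have := QG y; have := Hc0 y.
  set dd := dissip p _.
  have b0 := @dissipation_ge0 R X y.
  rewrite /QT => hd hB hA hE.
  suff : C2^-1 * En (smap D (smap D y)) <= A * dd + F' y + G' y.
    by rewrite mulNr; lra.
  rewrite ler_pdivrMl //; apply: (le_trans hE); rewrite ler_pM2l //.
  have hA1 : A * (c0 * cB y) <= A * dd.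
    rewrite ler_wpM2l //; have := normr_ge0 C1; have := normr_ge0 C3; lra.
  have hA2 : (K1 + K2 + 1) * cB y <= A * c0 * cB y by rewrite ler_wpM2r.
  lra.
Qed.

End lyapunov_functional.

(** * Decay of smooth solutions *)

Section decay.
Context {R : realType} (X : skewSpace R) (p : coefs R).
Local Notation D := (@der R X).
Local Notation state := (state X).
Implicit Types (V U : R -> state) (f g : X) (n r a b : nat) (t tau : R).
Local Notation sol := (@sol R X p).
Local Notation En := (@energy R X p).

(** The smoothing operator [J = (1 - D^2)^-1] and [K = D J], of symbol
    [i xi / (1 + xi^2)]. *)
Definition J f : X := res 1 f.
Definition K f : X := D (J f).

Let lt01 : (0 : R) < 1 := ltr01.

Lemma JD f g : J (f + g) = J f + J g. Proof. exact: resD. Qed.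
Lemma JZ (c : R) f : J (c *: f) = c *: J f. Proof. exact: resZ. Qed.
Lemma JN f : J (- f) = - J f. Proof. exact: resN. Qed.
Lemma J_der f : J (D f) = D (J f). Proof. exact: res_der. Qed.
Lemma KD f g : K (f + g) = K f + K g. Proof. by rewrite /K JD derE. Qed.
Lemma KZ (c : R) f : K (c *: f) = c *: K f. Proof. by rewrite /K JZ derE. Qed.
Lemma K_der f : K (D f) = D (K f). Proof. by rewrite /K J_der. Qed.
Lemma KK f : K (K f) = D (D (J (J f))). Proof. by rewrite /K J_der. Qed.
Lemma K_J f : K (J f) = J (K f). Proof. by rewrite /K J_der. Qed.

Lemma opB_J f : opB (J f) = f.
Proof. by have := resP f lt01; rewrite expr1n scale1r. Qed.

Lemma J_opB f : J (opB f) = f.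
Proof. by apply: res_uniq => //; rewrite expr1n scale1r. Qed.

Lemma opB_K f : opB (K f) = K (opB f).
Proof. by rewrite /K opB_der opB_J J_opB. Qed.

Lemma nn_J f : nn (J f) <= nn f.
Proof. by have [] := res_bounds f lt01. Qed.

Lemma nn_K f : nn (K f) <= nn f.
Proof. by have [_ + _] := res_bounds f lt01; rewrite expr1n mul1r. Qed.

Lemma dot_K f g : dot (K f) g = - dot f (K g).
Proof. by rewrite /K dot_der /J dot_resr // res_der. Qed.

Lemma sub_J f : f - J f = - D (K f).
Proof. by rewrite -{1}[f]opB_J /opB /K addrAC subrr add0r. Qed.

Lemma res_J tau f : 0 < tau -> res tau (J f) = J (res tau f).
Proof.
move=> t0; apply: res_uniq => //; rewrite -[in RHS](resP f t0).
by rewrite -!J_der -scaleNr -JZ -JD scaleNr.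
Qed.

Lemma sol_J V : sol V -> sol (fun t => smap J (V t)). Proof. exact: sol_res. Qed.
Lemma sol_K V : sol V -> sol (fun t => smap K (V t)).
Proof. by move=> /sol_J/sol_der. Qed.

Lemma sol_iter (T : X -> X) r V :
  (forall U, sol U -> sol (fun t => smap T (U t))) ->
  sol V -> sol (fun t => smap (iter r T) (V t)).
Proof. by move=> H sV; elim: r => [//|r IH]; exact: H IH. Qed.

Lemma nn_iter (T : X -> X) r f : (forall g, nn (T g) <= nn g) -> nn (iter r T f) <= nn f.
Proof. by move=> H; elim: r => //= r; exact: le_trans (H _). Qed.

Lemma En_iterK r (y : state) : En (smap (iter r K) y) <= En y.
Proof.
rewrite -[leRHS]mul1r; apply: le_energy => // i; rewrite mul1r /smap.
exact: nn_iter nn_K.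
Qed.

Lemma iter_comm (T S : X -> X) r f : (forall g, T (S g) = S (T g)) ->
  iter r T (S f) = S (iter r T f).
Proof. by move=> H; elim: r => //= r ->. Qed.

(** Let [W_j] be the solution [K^(2 j) J^2 V] and [l_j = L(W_j)]. The Lyapunov
    inequality reads [l_j' <= - k l_(j+1)], because [E(D^2 W_j)] is the value of
    the energy behind [l_(j+1)]. Hence a suitable combination of the
    [(1 + t)^j l_j], for [j <= r], is nonincreasing: the derivative of each
    weight is paid by the previous term. *)
Lemma decay_even r : exists C, forall V, sol V -> forall t, 0 <= t ->
  (1 + t) ^+ r * En (smap (iter r.*2 K) (V t)) <= C * En (V 0).
Proof.
have [L [L' [c [C [c0 C0 LL' cEL L'c]]]]] := lyapunov X p.
pose ell V j t := L (smap (iter j.*2 K) (smap J (smap J (V t)))).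
pose ell' V j t := L' (smap (iter j.*2 K) (smap J (smap J (V t)))).
have cEj j y : energy2 p (smap (iter j.*2 K) (smap J (smap J y))) = En (smap (iter j.*2 K) y).
  congr (energy p _); apply/funext => i; rewrite /smap.
  rewrite -(iter_comm _ _ (fun g => esym (opB_K g))) -(iter_comm _ _ (fun g => esym (opB_K g))).
  by rewrite !opB_J.
have D2j j y : En (smap D (smap D (smap (iter j.*2 K) (smap J (smap J y))))) =
    En (smap (iter j.+1.*2 K) y).
  congr (energy p _); apply/funext => i; rewrite /smap doubleS !iterS.
  by rewrite !(iter_comm _ _ K_J) KK.
have ell_lo V j t : En (smap (iter j.*2 K) (V t)) <= ell V j t.
  by rewrite -cEj; have /andP[] := cEL (smap (iter j.*2 K) (smap J (smap J (V t)))).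
have ell_hi V j t : ell V j t <= C * En (smap (iter j.*2 K) (V t)).
  by rewrite -cEj; have /andP[] := cEL (smap (iter j.*2 K) (smap J (smap J (V t)))).
have ell_fl V j : sol V -> flows (ell V j) (ell' V j).
  by move=> sV; exact: LL' (sol_iter _ sol_K (sol_J (sol_J sV))).
have ell'_le V j t : ell' V j t <= - (c / C) * ell V j.+1 t.
  apply: (le_trans (L'c _)); rewrite D2j mulNr mulNr lerN2 -mulrA ler_pM2l //.
  by rewrite ler_pdivrMl.
have ell_ge0 V j t : 0 <= ell V j t by rewrite (le_trans _ (ell_lo _ _ _)) // energy_ge0.
pose k := c / C; have k0 : 0 < k by rewrite divr_gt0.
have [al al0 [Phi [Phi' [H1 H2 H3]]]] : exists2 al : R, 0 < al &
   exists (Phi Phi' : (R -> state) -> R -> R),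
   [/\ forall V, sol V -> flows (Phi V) (Phi' V),
       forall V t, sol V -> 0 <= t -> al * (1 + t) ^+ r * ell V r t <= Phi V t
         /\ Phi' V t <= - (k * al) * (1 + t) ^+ r * ell V r.+1 t &
       exists C', forall V, Phi V 0 <= C' * En (V 0)].
  elim: r => [|r [al al0 [Phi [Phi' [H1 H2 [C' H3]]]]]].
    exists 1 => //; exists (fun V => ell V 0%N), (fun V => ell' V 0%N); split.
    - by move=> V; exact: ell_fl.
    - move=> V t sV t0; rewrite expr0 !mulr1 mul1r; split=> //; exact: ell'_le.
    - by exists C => V; have := ell_hi V 0%N 0; congr (_ <= C * energy p _).
  pose be := k * al / r.+1%:R.
  have be0 : 0 < be by apply: divr_gt0; [exact: mulr_gt0|rewrite ltr0n].
  exists be => //.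
  exists (fun V t => Phi V t + be * ((1 + t) ^+ r.+1 * ell V r.+1 t)).
  exists (fun V t => Phi' V t + be * (r.+1%:R * (1 + t) ^+ r * ell V r.+1 t
     + (1 + t) ^+ r.+1 * ell' V r.+1 t)); split.
  - move=> V sV; have := flowsD (H1 V sV) (flowsZ be (flows_powM r.+1 (ell_fl V r.+1 sV))).
    exact.
  - move=> V t sV t0; have [h1 h2] := H2 V t sV t0; split.
      rewrite [X in _ <= _ + X]mulrA lerDr; apply: le_trans h1.
      by rewrite mulr_ge0 // mulr_ge0 ?exprn_ge0 ?addr_ge0 // ltW.
    have e : be * (r.+1%:R * (1 + t) ^+ r * ell V r.+1 t) =
        k * al * (1 + t) ^+ r * ell V r.+1 t.
      have : r.+1%:R != 0 :> R by rewrite pnatr_eq0.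
      by rewrite /be; move: (r.+1%:R) => q q0; field.
    rewrite mulrDr e addrA.
    have -> : - (k * be) * (1 + t) ^+ r.+1 * ell V r.+2 t =
      be * ((1 + t) ^+ r.+1 * (- k * ell V r.+2 t)) by ring.
    rewrite -[leRHS]add0r; apply: lerD; first by lra.
    by rewrite ler_pM2l // ler_wpM2l ?exprn_ge0 ?addr_ge0 // ell'_le.
  - exists (C' + be * C) => V; rewrite addr0 expr1n mul1r mulrDl; apply: lerD => //.
    rewrite -mulrA ler_pM2l //; apply: (le_trans (ell_hi _ _ _)).
    by rewrite ler_pM2l // En_iterK.
have [C' H3'] := H3.
exists (al^-1 * C') => V sV t t0.
have [h1 _] := H2 V t sV t0.
have mono : Phi V t <= Phi V 0.
  apply: (flows_nincr (H1 V sV)) => // s s0.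
  have [_ h] := H2 V s sV (ltW s0); apply: (le_trans h).
  rewrite !mulNr oppr_le0 mulr_ge0 // mulr_ge0 ?exprn_ge0 ?addr_ge0 ?(ltW s0) //.
  by rewrite mulr_ge0 // ltW.
rewrite -mulrA ler_pdivlMl // mulrA; apply: le_trans (H3' V); apply: le_trans mono.
apply: le_trans h1; apply: ler_wpM2l; last exact: ell_lo.
by rewrite mulr_ge0 ?exprn_ge0 ?addr_ge0 // ltW.
Qed.

(** Odd powers of [K], by interpolation; [tau] is [(1 + t)^(1/4)]. *)
Lemma decay_K r : exists C, 0 < C /\ forall V, sol V -> forall t tau, 0 <= t ->
  0 < tau -> tau ^+ 4 = 1 + t ->
  tau ^+ r.*2 * En (smap (iter r K) (V t)) <= C * En (V 0).
Proof.
have [C1 H1] := decay_even r./2; have [C2 H2] := decay_even (r./2).+1.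
exists (`|C1| + `|C2| + 1); split; first by rewrite ltr_wpDl ?addr_ge0.
move=> V sV t tau t0 tau0 tauE.
have E0 := energy_ge0 p (V 0).
have h1 : tau ^+ (4 * r./2) * En (smap (iter r./2.*2 K) (V t)) <= `|C1| * En (V 0).
  rewrite exprM tauE; apply: (le_trans (H1 V sV t t0)).
  by rewrite ler_wpM2r // ler_norm.
have h2 : tau ^+ (4 * (r./2).+1) * En (smap (iter (r./2).+1.*2 K) (V t)) <= `|C2| * En (V 0).
  rewrite exprM tauE; apply: (le_trans (H2 V sV t t0)).
  by rewrite ler_wpM2r // ler_norm.
have [ro|ro] := boolP (odd r); last first.
  have re : r = r./2.*2 by rewrite -[LHS]odd_double_half (negbTE ro).
  have -> : tau ^+ r.*2 = tau ^+ (4 * r./2) by congr (_ ^+ _); lia.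
  rewrite {2}re; apply: (le_trans h1); rewrite ler_wpM2r // -addrA lerDl.
  by rewrite addr_ge0.
have re : r = (r./2.*2).+1 by rewrite -[LHS]odd_double_half ro.
set n := r./2 in re h1 h2 *.
have key f : 2 * tau ^+ 2 * nn (K f) <= nn f + tau ^+ 4 * nn (K (K f)).
  have := nn_ge0 (f + tau ^+ 2 *: K (K f)).
  rewrite {1}/nn !dotE; have := dot_K f (K f); rewrite (dotC (K (K f)) f) -/(nn (K f)).
  by rewrite /nn => -> ; lra.
have EK : tau ^+ r.*2 * En (smap (iter r K) (V t)) * 2 <=
    tau ^+ (4 * n) * En (smap (iter n.*2 K) (V t))
    + tau ^+ (4 * n.+1) * En (smap (iter n.+1.*2 K) (V t)).
  have -> : tau ^+ r.*2 = tau ^+ (4 * n) * tau ^+ 2 by rewrite -exprD; congr (_ ^+ _); lia.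
  have -> : tau ^+ (4 * n.+1) = tau ^+ (4 * n) * tau ^+ 4 by rewrite -exprD; congr (_ ^+ _); lia.
  rewrite -(mulrA (tau ^+ (4 * n)) (tau ^+ 4)) -mulrDr.
  rewrite -[leLHS]mulrA -[leLHS]mulrA; apply: ler_wpM2l; first by rewrite exprn_ge0 // ltW.
  pose x i := iter n.*2 K (V t i).
  have -> : tau ^+ 2 * (En (smap (iter r K) (V t)) * 2) =
      \sum_(i <- comps) wt p i * (2 * tau ^+ 2 * nn (K (x i))).
    by rewrite mulr_suml mulr_sumr re; apply: eq_bigr => i _; rewrite /smap iterS; ring.
  have -> : En (smap (iter n.*2 K) (V t)) + tau ^+ 4 * En (smap (iter n.+1.*2 K) (V t)) =
      \sum_(i <- comps) wt p i * (nn (x i) + tau ^+ 4 * nn (K (K (x i)))).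
    by rewrite mulr_sumr -big_split; apply: eq_bigr => i _; rewrite /= /smap /x doubleS; ring.
  by apply: ler_sum => i _; rewrite ler_wpM2l ?wt_ge0.
have : 0 <= `|C1| * En (V 0) by rewrite mulr_ge0.
have : 0 <= `|C2| * En (V 0) by rewrite mulr_ge0.
lra.
Qed.

Lemma iter_JD r f g : iter r J (f + g) = iter r J f + iter r J g.
Proof. by elim: r => //= r ->; rewrite JD. Qed.

(** The symbol of [HJ] is [xi^2 / (1 + xi^2)]. *)
Definition HJ f := f - J f.

Lemma HJE f : HJ f = - D (K f). Proof. exact: sub_J. Qed.

Lemma nn_HJ f : nn (HJ f) <= 4 * nn f.
Proof. by have := nnB f (J f); have := nn_J f; rewrite /HJ; lra. Qed.

Lemma sol_HJ V : sol V -> sol (fun t => smap HJ (V t)).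
Proof.
move=> sV; have := solD sV (solZ (-1) (sol_J sV)); congr sol.
by apply/funext => t; apply/funext => i; rewrite scaleN1r.
Qed.

Lemma iter_HJ r f : iter r HJ f = (- 1) ^+ r *: iter r D (iter r K f).
Proof.
elim: r => [|r IH]; first by rewrite expr0 scale1r.
rewrite iterS IH HJE KZ derZ exprS mulN1r scaleNr; congr (- (_ *: _)).
rewrite !iterS; congr (D _).
by rewrite (iter_comm _ _ (fun g => esym (K_der g))).
Qed.

Lemma iter_KD r n f : iter r K (iter n D f) = iter n D (iter r K f).
Proof.
by apply: iter_comm => g; rewrite (iter_comm _ _ (fun h => esym (K_der h))).
Qed.

(** [HJ^r] is [D^r K^r] up to sign, so the decay of [K^r] applies to the
    solution [D^(n + r) V]. *)
Lemma high_decay n r : exists C, 0 < C /\ forall V, sol V -> forall t tau, 0 <= t ->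
  0 < tau -> tau ^+ 4 = 1 + t ->
  tau ^+ r.*2 * En (smap (iter n D) (smap (iter r HJ) (V t))) <=
    C * En (smap (iter (n + r) D) (V 0)).
Proof.
have [C [C0 H]] := decay_K r; exists C; split=> // V sV t tau t0 tau0 tauE.
have sU := sol_iter (n + r) (@sol_der R X p) sV.
have := H _ sU t tau t0 tau0 tauE; congr (_ * _ <= _).
apply: eq_bigr => i _; congr (_ * _).
rewrite /smap iter_HJ iter_derZ nnZ -exprM mulnC exprM sqrrN expr1n expr1n mul1r.
by rewrite -iterD iter_KD.
Qed.

(** [opP tau] is [J^2 (1 - tau^2 D^2)]: it undoes the resolvent up to the
    smoothing [J^2], and by [decay_K] it is bounded along the flow when [tau] is
    [(1 + t)^(1/4)]. *)
Definition opP tau f := J (J f) - tau ^+ 2 *: K (K f).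

Lemma opP_J tau f : opP tau (J f) = J (opP tau f).
Proof. by rewrite /opP !K_J JD JN JZ. Qed.

Lemma opP_K tau f : opP tau (K f) = K (opP tau f).
Proof. by rewrite /opP KD -!scaleNr KZ -!K_J. Qed.

Lemma opP_der tau f : opP tau (D f) = D (opP tau f).
Proof. by rewrite /opP !(J_der, K_der) derD derN derZ. Qed.

Lemma opP_res tau f : 0 < tau -> opP tau (res tau f) = J (J f).
Proof.
move=> t0; rewrite /opP KK -!J_der -scaleNr -!JZ -!JD scaleNr; congr (J (J _)).
exact: resP.
Qed.

Lemma opP_iter tau r f : 0 < tau ->
  iter r (opP tau) (iter r (res tau) f) = iter r.*2 J f.
Proof.
move=> t0; elim: r f => //= r IH f.
by rewrite -iterS iterSr opP_res // !(iter_comm _ _ (opP_J tau)) IH.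
Qed.

Lemma opP_decay r a : exists C, 0 < C /\ forall V, sol V -> forall t tau, 0 <= t ->
  0 < tau -> tau ^+ 4 = 1 + t ->
  tau ^+ a.*2 * En (smap (iter a K) (smap (iter r (opP tau)) (V t))) <= C * En (V 0).
Proof.
elim: r a => [|r IH] a; first exact: decay_K.
have [C1 [C10 H1]] := IH a; have [C2 [C20 H2]] := IH a.+2.
exists (2 * C1 + 2 * C2); split; first lra.
move=> V sV t tau t0 tau0 tauE.
have := H1 V sV t tau t0 tau0 tauE; have := H2 V sV t tau t0 tau0 tauE.
set y := smap (iter r (opP tau)) (V t).
have -> : smap (iter r.+1 (opP tau)) (V t) = smap (opP tau) y by [].
move: y => y.
have step : En (smap (iter a K) (smap (opP tau) y)) <=
    2 * En (smap (iter a K) y) + 2 * (tau ^+ 4 * En (smap (iter a.+2 K) y)).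
  have E : smap (iter a K) (smap (opP tau) y) = (fun i =>
      J (J (smap (iter a K) y i)) + (- tau ^+ 2) *: smap (iter a.+2 K) y i).
    apply/funext => i; by rewrite /smap (iter_comm _ _ (fun g => esym (opP_K tau g))) /opP scaleNr.
  rewrite E; apply: (le_trans (energyD _ _ _)); rewrite energyZ sqrrN -exprM.
  apply: lerD => //; rewrite ler_pM2l // -[leRHS]mul1r; apply: le_energy => // i.
  by rewrite mul1r; apply: le_trans (nn_J _) (nn_J _).
have e : tau ^+ a.+2.*2 = tau ^+ a.*2 * tau ^+ 4 by rewrite -exprD; congr (_ ^+ _); lia.
rewrite e => h2 h1.
apply: (@le_trans _ _ (tau ^+ a.*2 * (2 * En (smap (iter a K) y)
    + 2 * (tau ^+ 4 * En (smap (iter a.+2 K) y))))).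
  by apply: ler_wpM2l; [rewrite exprn_ge0 // ltW|exact: step].
move: (tau ^+ a.*2) (tau ^+ 4) (En _) (En _) (En _) h1 h2 => x z e1 e2 e3 h1 h2; lra.
Qed.

(** [J^(2 (n + 1))] is [opP^(n + 1)] composed with the same power of the
    resolvent. One resolvent is kept for the passage from integrable to square
    integrable functions, each of the [n] others absorbs one derivative at the
    price of a factor [tau^-1]. *)
Lemma low_decay n : exists C, 0 < C /\ forall V, sol V -> forall t tau, 0 <= t ->
  0 < tau -> tau ^+ 4 = 1 + t ->
  tau ^+ n.*2 * En (smap (iter n D) (smap (iter n.+1.*2 J) (V t))) <=
    C * En (smap (res tau) (V 0)).
Proof.
have [C [C0 H]] := opP_decay n.+1 0; exists C; split=> // V sV t tau t0 tau0 tauE.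
pose U s := smap (iter n D) (smap (iter n.+1 (res tau)) (V s)).
have sU : sol U.
  by apply: sol_iter; [exact: sol_der|apply: sol_iter => // W; exact: sol_res].
have := H U sU t tau t0 tau0 tauE; rewrite mul1r.
have -> : smap (iter 0 K) (smap (iter n.+1 (opP tau)) (U t)) =
    smap (iter n D) (smap (iter n.+1.*2 J) (V t)).
  apply/funext => i.
  have comm g : iter n.+1 (opP tau) (iter n D g) = iter n D (iter n.+1 (opP tau) g).
    by apply: iter_comm => h; rewrite (iter_comm _ _ (fun h => esym (opP_der tau h))).
  change (iter n.+1 (opP tau) (iter n D (iter n.+1 (res tau) (V t i))) =
    iter n D (iter n.+1.*2 J (V t i))).
  by rewrite comm opP_iter.
move=> h.
apply: (@le_trans _ _ (tau ^+ n.*2 * (C * En (U 0)))).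
  by rewrite ler_wpM2l // exprn_ge0 // ltW.
rewrite mulrCA ler_pM2l // mulr_sumr /energy; apply: ler_sum => i _.
rewrite mulrCA ler_wpM2l ?wt_ge0 // /U /smap iterSr.
move: (res tau (V 0 i)) => {h H sU U sV V} f.
elim: n f => [|n IH] f; first by rewrite mul1r.
rewrite iterSr [iter n.+1 (res _) f]iterS.
have -> : iter n D (D (res tau (iter n (res tau) f))) =
    iter n D (iter n (res tau) (D (res tau f))).
  congr (iter n D _); rewrite -iterS iterSr.
  by rewrite (iter_comm _ _ (fun g => res_der g tau0)).
have -> : tau ^+ n.+1.*2 = tau ^+ 2 * tau ^+ n.*2 by rewrite -exprD; congr (_ ^+ _); lia.
rewrite -mulrA; apply: (@le_trans _ _ (tau ^+ 2 * nn (D (res tau f)))).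
  by rewrite ler_wpM2l ?sqr_ge0.
by have [] := res_bounds f tau0.
Qed.

(** The identity is split as [J + HJ] until there are enough factors [J] for
    [low_decay] or enough factors [HJ] for [high_decay]; the superfluous factors
    are bounded and are applied to the data. *)
Lemma smooth_decay n r : exists C, 0 < C /\ forall V, sol V -> forall t tau,
  0 <= t -> 0 < tau -> tau ^+ 4 = 1 + t ->
  En (smap (iter n D) (V t)) <= C * ((tau ^+ n.*2)^-1 * En (smap (res tau) (V 0))
     + (tau ^+ r.*2)^-1 * En (smap (iter (n + r) D) (V 0))).
Proof.
pose N := n.+1.*2.
pose bd (V : R -> state) tau := (tau ^+ n.*2)^-1 * En (smap (res tau) (V 0))
     + (tau ^+ r.*2)^-1 * En (smap (iter (n + r) D) (V 0)).
have bd_J V tau : 0 < tau -> bd (fun t => smap J (V t)) tau <= bd V tau.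
  move=> tau0; apply: lerD; (apply: ler_wpM2l; first by rewrite invr_ge0 exprn_ge0 // ltW).
    rewrite -[leRHS]mul1r; apply: le_energy => // i; rewrite mul1r /smap res_J //.
    exact: nn_J.
  rewrite -[leRHS]mul1r; apply: le_energy => // i; rewrite mul1r /smap.
  by rewrite (iter_comm _ _ (fun g => esym (J_der g))); exact: nn_J.
have bd_HJ V tau : 0 < tau -> bd (fun t => smap HJ (V t)) tau <= 4 * bd V tau.
  move=> tau0; rewrite mulrDr; apply: lerD; rewrite mulrCA;
    (apply: ler_wpM2l; first by rewrite invr_ge0 exprn_ge0 // ltW).
    apply: le_energy => // i; rewrite /smap /HJ resD // resN // res_J //.
    exact: nn_HJ.
  apply: le_energy => // i; rewrite /smap.
  have -> : iter (n + r) D (HJ (V 0 i)) = HJ (iter (n + r) D (V 0 i)).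
    by apply: iter_comm => g; rewrite /HJ derD derN J_der.
  exact: nn_HJ.
have bd_iter (T : X -> X) (c : R) m V tau : 0 <= c ->
    (forall W, bd (fun t => smap T (W t)) tau <= c * bd W tau) ->
    bd (fun t => smap (iter m T) (V t)) tau <= c ^+ m * bd V tau.
  move=> c0 H; elim: m => [|m IH]; first by rewrite mul1r.
  apply: (le_trans (H (fun t => smap (iter m T) (V t)))).
  by rewrite exprS -mulrA ler_wpM2l.
have bd1 V tau : 0 < tau -> En (smap (res tau) (V 0)) <= tau ^+ n.*2 * bd V tau.
  move=> tau0; rewrite -ler_pdivrMl ?exprn_gt0 // lerDl mulr_ge0 ?energy_ge0 //.
  by rewrite invr_ge0 exprn_ge0 // ltW.
have bd2 V tau : 0 < tau -> En (smap (iter (n + r) D) (V 0)) <= tau ^+ r.*2 * bd V tau.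
  move=> tau0; rewrite -ler_pdivrMl ?exprn_gt0 // lerDr mulr_ge0 ?energy_ge0 //.
  by rewrite invr_ge0 exprn_ge0 // ltW.
have comm_JH g : J (HJ g) = HJ (J g) by rewrite /HJ JD JN.
pose claim a b := exists C, 0 < C /\ forall V, sol V ->
    forall t tau, 0 <= t -> 0 < tau -> tau ^+ 4 = 1 + t ->
    En (smap (iter n D) (smap (iter a J) (smap (iter b HJ) (V t)))) <= C * bd V tau.
have bd_JHJ a b V tau : 0 < tau ->
    bd (fun t => smap (iter a J) (smap (iter b HJ) (V t))) tau <= 4 ^+ b * bd V tau.
  move=> tau0.
  have h := bd_iter J 1 a (fun t => smap (iter b HJ) (V t)) tau ler01.
  rewrite expr1n mul1r in h; apply: (le_trans (h _)).
    by move=> W; rewrite mul1r; exact: bd_J.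
  by apply: bd_iter => // W; exact: bd_HJ.
have low a b : (N <= a)%N -> claim a b.
  move=> aN; have [C [C0 H]] := low_decay n.
  exists (C * 4 ^+ b); split; first by rewrite mulr_gt0 // exprn_gt0.
  move=> V sV t tau t0 tau0 tauE.
  pose W s := smap (iter (a - N) J) (smap (iter b HJ) (V s)).
  have sW : sol W by apply: sol_iter; [exact: sol_J|apply: sol_iter => //; exact: sol_HJ].
  have := H W sW t tau t0 tau0 tauE.
  have -> : smap (iter N J) (W t) = smap (iter a J) (smap (iter b HJ) (V t)).
    by apply/funext => i; rewrite /smap /W /smap -iterD subnKC.
  move=> h.
  have h2 := bd1 W tau tau0; have h3 := bd_JHJ (a - N)%N b V tau tau0.
  have tn : 0 < tau ^+ n.*2 by rewrite exprn_gt0.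
  rewrite -(ler_pM2l tn); apply: (le_trans h).
  apply: (@le_trans _ _ (C * (tau ^+ n.*2 * bd W tau))); first by rewrite ler_pM2l.
  rewrite mulrCA ler_pM2l // -mulrA ler_pM2l //.
have high a b : (r <= b)%N -> claim a b.
  move=> br; have [C [C0 H]] := high_decay n r.
  exists (C * 4 ^+ (b - r)); split; first by rewrite mulr_gt0 // exprn_gt0.
  move=> V sV t tau t0 tau0 tauE.
  pose W s := smap (iter a J) (smap (iter (b - r) HJ) (V s)).
  have sW : sol W by apply: sol_iter; [exact: sol_J|apply: sol_iter => //; exact: sol_HJ].
  have := H W sW t tau t0 tau0 tauE.
  have -> : smap (iter r HJ) (W t) = smap (iter a J) (smap (iter b HJ) (V t)).
    apply/funext => i; rewrite /smap /W /smap.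
    have comm g : iter r HJ (iter a J g) = iter a J (iter r HJ g).
      by apply: iter_comm => h; rewrite (iter_comm _ _ comm_JH).
    by rewrite comm -iterD subnKC.
  move=> h.
  have h2 := bd2 W tau tau0; have h3 := bd_JHJ a (b - r)%N V tau tau0.
  have tn : 0 < tau ^+ r.*2 by rewrite exprn_gt0.
  rewrite -(ler_pM2l tn); apply: (le_trans h).
  apply: (@le_trans _ _ (C * (tau ^+ r.*2 * bd W tau))); first by rewrite ler_pM2l.
  rewrite mulrCA ler_pM2l // -mulrA ler_pM2l //.
suff T k a b : (N - a + (r - b) <= k)%N -> claim a b.
  have [C [C0 H]] := T _ 0%N 0%N (leqnn _).
  by exists C; split=> // V sV t tau t0 tau0 tauE; exact: H.
elim: k a b => [|k IH] a b kab; first by apply: low; lia.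
have [|aN] := leqP N a; first exact: low.
have [|br] := leqP r b; first exact: high.
have [C1 [C10 H1]] := IH a.+1 b ltac:(lia).
have [C2 [C20 H2]] := IH a b.+1 ltac:(lia).
exists (2 * C1 + 2 * C2); split; first lra.
move=> V sV t tau t0 tau0 tauE.
have := H1 V sV t tau t0 tau0 tauE; have := H2 V sV t tau t0 tau0 tauE.
have : En (smap (iter n D) (smap (iter a J) (smap (iter b HJ) (V t)))) <=
   2 * En (smap (iter n D) (smap (iter a.+1 J) (smap (iter b HJ) (V t)))) +
   2 * En (smap (iter n D) (smap (iter a J) (smap (iter b.+1 HJ) (V t)))).
  apply: le_trans (energyD _ _ _); rewrite le_eqVlt; apply/orP; left; apply/eqP.
  congr (energy p _); apply/funext => i; rewrite /smap -iter_derD iterSr -iter_JD.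
  by rewrite iterS /HJ addrC subrK.
move: (bd V tau) => x; move: (En _) (En _) (En _) => *; lra.
Qed.

End decay.

(** * Square integrable functions *)

Section L2_theory.
Context {R : realType}.
Local Notation mu := (@lebesgue_measure R).
Implicit Types f g h : R -> R.

Definition L2 f : Prop := f \in Lfun mu 2%:E.
Definition integrableR f : Prop := mu.-integrable setT (EFin \o f).

Lemma L2_meas f : L2 f -> measurable_fun setT f.
Proof. by rewrite /L2 inE => /andP[+ _]; rewrite inE. Qed.

Lemma L2_sqr f : L2 f -> integrableR (fun x => f x * f x).
Proof. by move=> /Lfun2_integrable_sqr; under eq_fun do rewrite expr2. Qed.

Lemma L2P f : measurable_fun setT f -> integrableR (fun x => f x * f x) -> L2 f.
Proof.
move=> mf /integrableP[_ fi]; rewrite /L2 inE; apply/andP; split; rewrite inE//=.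
rewrite /finite_norm unlock /= poweR_lty //.
apply: le_lt_trans fi; rewrite le_eqVlt; apply/orP; left; apply/eqP.
apply: eq_integral => x _.
by rewrite /= powR_mulrn ?normr_ge0 // normrM expr2.
Qed.

Lemma L2_mul f g : L2 f -> L2 g -> integrableR (fun x => f x * g x).
Proof. by move=> lf lg; apply/Lfun1_integrable; exact: Lfun2_mul_Lfun1. Qed.

Lemma integrableRD f g : integrableR f -> integrableR g -> integrableR (fun x => f x + g x).
Proof. by move=> fi gi; have := integrableD measurableT fi gi. Qed.

Lemma integrableRZ c f : integrableR f -> integrableR (fun x => c * f x).
Proof. by move=> fi; have := integrableZl measurableT c fi. Qed.

Lemma L2D f g : L2 f -> L2 g -> L2 (fun x => f x + g x).
Proof.
move=> lf lg; apply: L2P.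
  by apply: measurable_funD; exact: L2_meas.
have -> : (fun x => (f x + g x) * (f x + g x)) =
    (fun x => f x * f x + (2 * (f x * g x) + g x * g x)) by apply/funext => x; ring.
apply: integrableRD; first exact: L2_sqr.
by apply: integrableRD; [apply: integrableRZ; exact: L2_mul|exact: L2_sqr].
Qed.

Lemma L2Z c f : L2 f -> L2 (fun x => c * f x).
Proof.
move=> lf; apply: L2P; first by apply: measurable_funM => //; exact: L2_meas.
have -> : (fun x => (c * f x) * (c * f x)) = (fun x => (c * c) * (f x * f x)).
  by apply/funext => x; ring.
by apply: integrableRZ; exact: L2_sqr.
Qed.

Lemma L2_0 : L2 (fun=> 0).
Proof.
apply: L2P => //; rewrite /integrableR.
under eq_fun do rewrite mul0r.
exact: integrable0.
Qed.

Lemma L2N f : L2 f -> L2 (fun x => - f x).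
Proof.
move=> /(L2Z (-1)); have -> // : (fun x => -1 * f x) = (fun x => - f x).
by apply/funext => x; rewrite mulN1r.
Qed.

Lemma distC f g : dist f g = dist g f.
Proof. by congr Rintegral; apply/funext => x; rewrite mulrC. Qed.

Lemma distDl f g h : L2 f -> L2 g -> L2 h ->
  dist (fun x => f x + g x) h = dist f h + dist g h.
Proof.
move=> lf lg lh; rewrite /dist -RintegralD //; try exact: L2_mul.
by congr Rintegral; apply/funext => x; rewrite mulrDl.
Qed.

Lemma distZl c f h : L2 f -> L2 h -> dist (fun x => c * f x) h = c * dist f h.
Proof.
move=> lf lh; rewrite /dist -RintegralZl //; last exact: L2_mul.
by congr Rintegral; apply/funext => x; rewrite mulrA.
Qed.

Lemma distff_ge0 f : 0 <= dist f f.
Proof. by apply: Rintegral_ge0 => x _; rewrite -expr2 sqr_ge0. Qed.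

Lemma discriminant (a b c : R) : 0 <= c ->
  (forall l, 0 <= a + 2 * l * b + l * l * c) -> b * b <= a * c.
Proof.
move=> c0 H; have [c1|] := eqVneq c 0.
  have [->|b0] := eqVneq b 0; first by rewrite mul0r c1 mulr0.
  have := H (- (a + 1) / (2 * b)); rewrite c1 mulr0 addr0.
  have -> : a + 2 * (- (a + 1) / (2 * b)) * b = - 1 by field.
  by rewrite lerNr oppr0 ler10.
move=> c1; have cp : 0 < c by rewrite lt_def c1.
rewrite -(ler_pM2l cp) -subr_ge0.
have -> : c * (a * c) - c * (b * b) =
    c * c * (a + 2 * (- b / c) * b + - b / c * (- b / c) * c) by field.
by rewrite mulr_ge0 // mulr_ge0.
Qed.

Lemma dist_sqr f g : L2 f -> L2 g -> dist f g * dist f g <= dist f f * dist g g.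
Proof.
move=> lf lg; apply: discriminant => [|l]; first exact: distff_ge0.
have lgl := L2Z l lg.
have := distff_ge0 (fun x => f x + l * g x).
rewrite distDl //; last exact: L2D.
rewrite (distC f) (distC (fun x => l * g x)) !distDl // !distZl //.
by rewrite (distC g (fun x => l * g x)) distZl // (distC g f) (distC f (fun x => l * g x)) distZl // (distC g f); congr (_ <= _); ring.
Qed.

End L2_theory.

(** * Smooth functions and the bump function *)

Section smooth_functions.
Context {R : realType}.
Implicit Types f g : R -> R.

Definition smooth f := forall n x, derivable (f^`(n))%classic x 1.

(** Smoothness by coinduction: [P] is a property of functions that is inherited
    by derivatives. *)
Lemma smooth_coind (P : (R -> R) -> Prop) :
  (forall f, P f -> (forall x, derivable f x 1) /\ P (f^`())%classic) ->
  forall f, P f -> smooth f.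
Proof.
move=> H f Pf n; have : P (f^`(n))%classic.
  by elim: n => // n IH; rewrite derive1nS; case: (H _ IH).
by move=> /H[].
Qed.

Lemma smooth_derivable f : smooth f -> forall x, derivable f x 1.
Proof. by move=> /(_ 0%N). Qed.

Lemma smooth_derive f : smooth f -> smooth (f^`())%classic.
Proof. by move=> sf n x; have := sf n.+1 x; rewrite derive1Sn. Qed.

Lemma smooth_continuous f : smooth f -> continuous f.
Proof.
move=> sf x; apply: differentiable_continuous; apply/derivable1_diffP.
exact: smooth_derivable.
Qed.

(** The sums of products of smooth functions, a class stable under derivation. *)
Inductive prodsum : (R -> R) -> Prop :=
| prodsum_mul f g : smooth f -> smooth g -> prodsum (f * g)
| prodsum_add f g : prodsum f -> prodsum g -> prodsum (f + g).

Lemma smooth_mul f g : smooth f -> smooth g -> smooth (fun x => f x * g x).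
Proof.
move=> sf sg; apply: (@smooth_coind prodsum); last exact: (prodsum_mul sf sg).
move=> {f g sf sg} h; elim=> {h} [f g sf sg|f g _ [df Pf] _ [dg Pg]].
  have df := smooth_derivable sf; have dg := smooth_derivable sg.
  split=> [x|]; first exact: derivableM.
  have -> : ((f * g)^`())%classic = f * (g^`())%classic + (f^`())%classic * g.
    apply/funext => x; rewrite derive1E deriveM // -!derive1E.
    by rewrite /GRing.scale/= [g x * _]mulrC.
  exact: prodsum_add (prodsum_mul sf (smooth_derive sg)) (prodsum_mul (smooth_derive sf) sg).
split=> [x|]; first exact: derivableD.
have -> : ((f + g)^`())%classic = (f^`())%classic + (g^`())%classic.
  by apply/funext => x; rewrite derive1E deriveD // -!derive1E.
exact: prodsum_add Pf Pg.
Qed.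

Lemma smooth_affine f (a b c : R) : smooth f -> smooth (fun x => c * f (a * x + b)).
Proof.
pose P h := exists g a b c, smooth g /\ h = (fun x => c * g (a * x + b)).
move=> sf; apply: (@smooth_coind P); last by exists f, a, b, c.
move=> {sf f a b c} _ [f [a [b [c [sf ->]]]]].
have daff x : is_derive x (1 : R) (fun x => a * x + b) a.
  apply: (is_derive_eq (is_deriveD (is_deriveZ a (is_derive_id x (1 : R)))
    (is_derive_cst b x 1))).
  exact: (etrans (addr0 _) (mulr1 _)).
have d x : is_derive x (1 : R) (fun x => c * f (a * x + b))
    (c * (a * (f^`())%classic (a * x + b))).
  have df : is_derive (a * x + b) (1 : R) f ((f^`())%classic (a * x + b)).
    by apply: DeriveDef; [exact: smooth_derivable|rewrite derive1E].
  apply: (is_derive_eq (is_deriveZ c (@is_derive1_comp R f (fun x => a * x + b) x _ _ df (daff x)))).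
  by congr (c * _); exact: mulrC.
split=> [x|]; first by have [] := d x.
exists (f^`())%classic, a, b, (c * a); split; first exact: smooth_derive.
by apply/funext => x; rewrite derive1E (@derive_val _ _ _ _ _ _ _ (d x)) mulrA.
Qed.

Lemma expr_le_expR (y : R) i : 0 <= y -> y ^+ i <= i`!%:R * expR y.
Proof.
move=> y0; case: i => [|i].
  rewrite expr0 fact0 mul1r; apply: le_trans (expR_ge1Dx y); lra.
have f0 : 0 < i.+1`!%:R :> R by rewrite ltr0n fact_gt0.
rewrite mulrC -ler_pdivrMr //; apply: le_trans (expR_ge1Dxn i y0).
by rewrite lerDr.
Qed.

Lemma horner_le_expR (Q : {poly R}) : exists C : R, 0 <= C /\
  forall y, 0 <= y -> `|Q.[y]| <= C * expR y.
Proof.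
exists (\sum_(i < size Q) `|Q`_i| * i`!%:R); split.
  by apply: sumr_ge0 => i _; rewrite mulr_ge0.
move=> y y0; rewrite horner_coef mulr_suml; apply: (le_trans (ler_norm_sum _ _ _)).
apply: ler_sum => i _; rewrite normrM -mulrA ler_wpM2l //.
by rewrite ger0_norm ?exprn_ge0 // expr_le_expR.
Qed.

(** The functions [P(1/x) exp(-1/x)], continued by zero. They are stable under
    derivation, which gives the smoothness of [exp(-1/x)] at the origin. *)
Definition flat (P : {poly R}) (x : R) : R :=
  if 0 < x then P.[x^-1] * expR (- x^-1) else 0.

Lemma flat_sqr P : exists C : R, 0 <= C /\ forall x, `|flat P x| <= C * x ^+ 2.
Proof.
have [C [C0 H]] := horner_le_expR (P * 'X^2); exists C; split=> // x.
rewrite /flat; case: ltP => [x0|_]; last by rewrite normr0 mulr_ge0 ?sqr_ge0.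
have := H x^-1; rewrite invr_ge0 ltW // => /(_ isT).
have e0 : 0 < expR x^-1 by exact: expR_gt0.
have v0 : 0 <= x^-1 ^+ 2 by rewrite sqr_ge0.
rewrite hornerM hornerXn normrM (ger0_norm v0) => K.
rewrite expRN normrM normfV (gtr0_norm e0) ler_pdivrMr // mulrAC.
by rewrite -ler_pdivrMr ?exprn_gt0 // -exprVn.
Qed.

Lemma flat_derive P x : is_derive x (1 : R) (flat P) (flat ('X^2 * (P - P^`())) x).
Proof.
have [x0|x0|->] := ltgtP x 0.
- rewrite [X in is_derive _ _ _ X]/flat ltNge (ltW x0) /=.
  apply: (near_eq_is_derive _ (is_derive_cst (0 : R) x (1 : R))).
  near=> y; rewrite /flat ltNge (_ : y <= 0) //=.
  by apply: ltW; near: y; exact: lt_nbhsl.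
- rewrite [X in is_derive _ _ _ X]/flat x0.
  have xn : x != 0 by rewrite gt_eqF.
  have dv : is_derive x (1 : R) (fun y : R => y^-1) (- x ^- 2).
    have did : derivable (@id R) x (1 : R) by exact: (@ex_derive _ _ _ _ _ _ _ (is_derive_id x (1 : R))).
    apply: DeriveDef; first exact: (@derivableV _ _ (@id R) x 1 xn did).
    apply: (etrans (@deriveV _ _ (@id R) x 1 xn did)).
    by rewrite derive_id; exact: mulr1.
  have d1 := @is_derive1_comp R (horner P) _ x _ _ (is_derive_poly P _) dv.
  have d2 := @is_derive1_comp R expR _ x _ _ (is_derive_expR (- x^-1)) (is_deriveN dv).
  apply: (near_eq_is_derive _ (is_derive_eq (is_deriveM d1 d2) _)).
    by near=> y; rewrite /flat (_ : 0 < y) //; near: y; exact: lt_nbhsr.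
  rewrite hornerM hornerXn hornerD hornerN /GRing.scale/= exprVn.
  move: (x ^- 2) => q; ring.
- rewrite [X in is_derive _ _ _ X]/flat ltxx.
  have [C [C0 H]] := flat_sqr P.
  have E : (fun h : R => h^-1 *: (flat P (h *: 1 + 0) - flat P 0)) @ (0 : R)^' --> (0 : R).
    apply: norm_cvg0.
    have cx : C * `|h| @[h --> (0 : R)^'] --> C * `|0 : R|.
      apply: cvgMr; apply: cvg_norm; exact: cvg_within.
    rewrite normr0 mulr0 in cx.
    have N : `|h^-1 *: (flat P (h *: 1 + 0) - flat P 0)| @[h --> (0 : R)^'] --> (0 : R).
      apply: squeeze_cvgr cx; last exact: cvg_cst.
      near=> h; rewrite normr_ge0/=.
      have h0 : h != 0 by near: h; exact: nbhs_dnbhs_neq.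
      rewrite [flat P 0]/flat ltxx subr0 addr0 /GRing.scale/= mulr1 normrM normfV.
      rewrite ler_pdivrMl ?normr_gt0 //; apply: (le_trans (H h)).
      by rewrite [leRHS]mulrCA -normrM -expr2 ger0_norm ?sqr_ge0.
    exact: N.
  by apply: DeriveDef; [apply/cvg_ex; eexists; exact: E|exact: cvg_lim E].
Unshelve. all: by end_near. Qed.

Lemma flat_smooth P : smooth (flat P).
Proof.
apply: (@smooth_coind (fun f => exists P, f = flat P)); last by exists P.
move=> _ [{}P ->]; split=> [x|]; first by have [] := flat_derive P x.
exists ('X^2 * (P - P^`())); apply/funext => x.
by rewrite derive1E (@derive_val _ _ _ _ _ _ _ (flat_derive P x)).
Qed.

Definition bump (x : R) : R := flat 1 (1 - x) * flat 1 (1 + x).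

Lemma flat1 x : flat 1 x = if 0 < x then expR (- x^-1) else 0.
Proof. by rewrite /flat hornerC mul1r. Qed.

Lemma bump_ge0 x : 0 <= bump x.
Proof. by rewrite /bump !flat1; do 2!case: ifP => // _; rewrite ?mulr0 ?mul0r ?mulr_ge0 ?expR_ge0. Qed.

Lemma bump_le1 x : bump x <= 1.
Proof.
have h y : 0 <= flat 1 y <= 1.
  rewrite flat1; case: ifP => y0; last by rewrite lexx ler01.
  by rewrite expR_ge0 /= -expR0 ler_expR oppr_le0 invr_ge0 ltW.
have /andP[a b] := h (1 - x); have /andP[c d] := h (1 + x).
exact: mulr_ile1.
Qed.

Lemma bump_out x : 1 < `|x| -> bump x = 0.
Proof.
rewrite /bump !flat1 ltr_normr => /orP[x1|x1].
  by rewrite [0 < 1 - x]ltNge subr_le0 ltW //= mul0r.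
by rewrite [0 < 1 + x]ltNge (_ : 1 + x <= 0) ?mulr0 //; lra.
Qed.

Lemma bump0_gt0 : 0 < bump 0.
Proof. by rewrite /bump subr0 addr0 flat1 ltr01 mulr_gt0 ?expR_gt0. Qed.

Lemma bump_smooth : smooth bump.
Proof.
apply: (smooth_mul (f := fun x => flat 1 (1 - x)) (g := fun x => flat 1 (1 + x))).
  have -> : (fun x => flat 1 (1 - x)) = (fun x : R => 1 * flat 1 (- 1 * x + 1)).
    by apply/funext => x; rewrite mul1r mulN1r addrC.
  exact: (@smooth_affine (flat 1) (- 1) 1 1 (@flat_smooth 1)).
have -> : (fun x => flat 1 (1 + x)) = (fun x : R => 1 * flat 1 (1 * x + 1)).
  by apply/funext => x; rewrite !mul1r addrC.
exact: (@smooth_affine (flat 1) 1 1 1 (@flat_smooth 1)).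
Qed.

Lemma bump_test : test_function bump.
Proof. by split; [exact: bump_smooth|exists 1; exact: bump_out]. Qed.

End smooth_functions.

(** * Test functions *)

Section test_functions.
Context {R : realType}.
Local Notation mu := (@lebesgue_measure R).
Implicit Types (f g eta rho : R -> R) (x y : R).

Lemma bounded_supp_integrable f (B M : R) : measurable_fun setT f ->
  (forall x, `|f x| <= B) -> (forall x, M < `|x| -> f x = 0) -> integrableR f.
Proof.
move=> mf fB fM.
have -> : f = f \_ `[- M, M].
  apply/funext => x; rewrite patchE; case: ifPn => // /negP xM.
  apply: fM; rewrite ltNge ler_norml; apply/negP => xM'; apply: xM.
  by rewrite inE/= in_itv.
rewrite /integrableR (_ : EFin \o _ = (EFin \o f) \_ `[- M, M]); last first.
  by apply/funext => x; rewrite /= !patchE; case: ifP.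
refine (proj1 (@integrable_mkcond _ _ R mu _ (EFin \o f) _) _).
  exact: measurable_itv.
apply: (@measurable_bounded_integrable _ _ R mu).
- exact: measurable_itv.
- by have := @compact_finite_measure R `[- M, M] (@segment_compact R _ _).
- exact: measurable_funTS.
- exists B; split; first exact: num_real.
  by move=> C BC x _ /=; apply: (le_trans (fB x)); exact: ltW.
Qed.

Lemma bounded_supp_L2 f (B M : R) : measurable_fun setT f ->
  (forall x, `|f x| <= B) -> (forall x, M < `|x| -> f x = 0) -> L2 f.
Proof.
move=> mf fB fM; apply: L2P => //.
apply: (@bounded_supp_integrable _ (B * B) M); first exact: measurable_funM.
  by move=> x; rewrite normrM; apply: ler_pM.
by move=> x /fM ->; rewrite mul0r.
Qed.

Lemma test_smooth eta : test_function eta -> smooth eta. Proof. by case. Qed.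

Lemma test_supp eta : test_function eta -> exists M, 0 < M /\
  forall x, M < `|x| -> eta x = 0.
Proof.
move=> [_ [M H]]; exists (`|M| + 1); split; first by rewrite ltr_wpDl.
move=> x xM; apply: H; apply: le_lt_trans xM.
by apply: (le_trans (ler_norm M)); rewrite lerDl.
Qed.

Lemma test_continuous eta : test_function eta -> continuous eta.
Proof. by move=> /test_smooth/smooth_continuous. Qed.

Lemma test_bounded eta : test_function eta -> exists B, 0 < B /\ forall x, `|eta x| <= B.
Proof.
move=> te; have [M [M0 eM]] := test_supp te; have ce := test_continuous te.
have MM : - M <= M by lra.
have cn : {within `[- M, M], continuous (fun x => `|eta x|)}.
  apply: continuous_subspaceT => x.
  by apply: continuous_comp; [exact: ce|exact: norm_continuous].
have [c _ H] := EVT_max MM cn.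
exists (`|eta c| + 1); split; first by rewrite ltr_wpDl.
move=> x; have [xM|xM] := leP `|x| M.
  by apply: (@le_trans _ _ `|eta c|); [apply: H; rewrite in_itv/= -ler_norml|rewrite lerDl].
by rewrite eM // normr0 addr_ge0.
Qed.

Lemma test_meas eta : test_function eta -> measurable_fun setT eta.
Proof. by move=> /test_continuous; exact: continuous_measurable_fun. Qed.

Lemma test_L2 eta : test_function eta -> L2 eta.
Proof.
move=> te; have [M [_ eM]] := test_supp te; have [B [_ eB]] := test_bounded te.
exact: bounded_supp_L2 (test_meas te) eB eM.
Qed.

Lemma test_integrable eta : test_function eta -> integrableR eta.
Proof.
move=> te; have [M [_ eM]] := test_supp te; have [B [_ eB]] := test_bounded te.
exact: bounded_supp_integrable (test_meas te) eB eM.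
Qed.

Lemma test_affine eta (a b c : R) : a != 0 -> test_function eta ->
  test_function (fun x => c * eta (a * x + b)).
Proof.
move=> a0 te; split; first exact: smooth_affine (test_smooth te).
have [M [_ eM]] := test_supp te; exists ((M + `|b|) / `|a|) => x.
rewrite ltr_pdivrMr ?normr_gt0 // => xM; rewrite eM ?mulr0 //.
have := ler_normB (a * x + b) b; rewrite addrK normrM mulrC; lra.
Qed.

Lemma test_derive eta : test_function eta -> test_function (eta^`())%classic.
Proof.
move=> te; split; first exact: smooth_derive (test_smooth te).
have [M [_ eM]] := test_supp te; exists M => x xM.
have := @near_eq_is_derive R R R (cst 0) eta x 1 0 _ (is_derive_cst 0 x 1).
rewrite derive1E => H; apply: derive_val; apply: H.
near=> y; rewrite /= eM //; near: y.
have : `|y| @[y --> x] --> `|x| by apply: cvg_norm; exact: cvg_id.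
by move=> /(_ _ (@lt_nbhsr R _ _ xM)).
Unshelve. all: by end_near. Qed.

Lemma test_deriven eta n : test_function eta -> test_function (eta^`(n))%classic.
Proof. by move=> te; elim: n => // n; rewrite derive1nS; exact: test_derive. Qed.

Lemma test_mul f eta : smooth f -> test_function eta ->
  test_function (fun x => f x * eta x).
Proof.
move=> sf te; split; first exact: smooth_mul sf (test_smooth te).
by have [M [_ eM]] := test_supp te; exists M => x /eM ->; rewrite mulr0.
Qed.

Lemma test_shift eta x : test_function eta -> test_function (fun y => eta (x - y)).
Proof.
move=> te; have -> : (fun y => eta (x - y)) = (fun y => 1 * eta (- 1 * y + x)).
  by apply/funext => y; rewrite mul1r mulN1r addrC.
by apply: test_affine => //; rewrite oppr_eq0 oner_neq0.
Qed.

Lemma test_is_derive eta x : test_function eta ->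
  is_derive x (1 : R) eta ((eta^`())%classic x).
Proof.
by move=> te; apply: DeriveDef; [exact: smooth_derivable (test_smooth te) x|rewrite derive1E].
Qed.

Lemma test_shift_is_derive eta x y : test_function eta ->
  is_derive x (1 : R) (fun x => eta (x - y)) ((eta^`())%classic (x - y)).
Proof.
move=> te.
have ds : is_derive x (1 : R) (fun x => x - y) 1.
  apply: (is_derive_eq (is_deriveD (is_derive_id x (1 : R)) (is_derive_cst (- y) x 1))).
  exact: addr0.
apply: (is_derive_eq (@is_derive1_comp R eta (fun x => x - y) x _ _ (test_is_derive _ te) ds)).
exact: mulr1.
Qed.

Lemma test_lipschitz eta : test_function eta -> exists B, 0 < B /\
  forall x y, `|eta x - eta y| <= B * `|x - y|.
Proof.
move=> te; have [B [B0 H]] := test_bounded (test_derive te); exists B; split=> // x y.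
wlog xy : x y / y <= x.
  move=> W; have [/W//|/ltW/W] := leP y x.
  by rewrite distrC [`|y - x|]distrC.
have [|c _ ->] := @MVT_segment R eta _ y x xy (fun z _ => test_is_derive z te).
  by apply: continuous_subspaceT; exact: test_continuous.
by rewrite normrM ler_wpM2r.
Qed.

End test_functions.

(** * Convolution with a test function *)

Section convolution.
Context {R : realType}.
Local Notation mu := (@lebesgue_measure R).
Implicit Types (f g eta rho : R -> R) (x y : R).

Definition conv f rho x := dist f (fun y => rho (x - y)).

Lemma L2_norm f : L2 f -> L2 (fun x => `|f x|).
Proof.
move=> lf; apply: L2P; first by apply: measurableT_comp => //; exact: L2_meas.
have -> : (fun x => `|f x| * `|f x|) = (fun x => f x * f x).
  by apply/funext => x; rewrite -normrM -expr2 ger0_norm ?sqr_ge0.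
exact: L2_sqr.
Qed.

Definition plateau (B M : R) (x : R) : R := if `|x| <= M then B else 0.

Lemma plateau_L2 B M : 0 <= B -> L2 (plateau B M).
Proof.
move=> B0; apply: (@bounded_supp_L2 _ _ B M).
- apply: measurable_fun_ifT => //.
  by apply: measurable_fun_ler => //; exact: measurableT_comp.
- by move=> x; rewrite /plateau; case: ifP => _; rewrite ?normr0 ?ger0_norm.
- by move=> x xM; rewrite /plateau leNgt xM.
Qed.

(** Differentiation under the integral sign. For [z] at distance at most [1] from
    [x] the derivative of the integrand is dominated by the product of [f] with a
    plateau, where [rho'] is replaced by its bound on a large segment. *)
Lemma conv_is_derive f rho x : L2 f -> test_function rho ->
  is_derive x (1 : R) (conv f rho) (conv f (rho^`())%classic x).
Proof.
move=> lf tr; have tr' := test_derive tr.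
have [M [M0 rM]] := test_supp tr'; have [B [B0 rB]] := test_bounded tr'.
pose F x y := f y * rho (x - y).
pose G y := `|f y| * plateau B (M + `|x| + 1) y.
have B0' := ltW B0.
have dF z y : is_derive z (1 : R) (F^~ y) (f y * (rho^`())%classic (z - y)).
  exact: is_deriveZ (test_shift_is_derive z y tr).
have Ix : `]x - 1, x + 1[%classic x by rewrite /= in_itv/=; apply/andP; split; lra.
have G0 y : 0 <= G y by rewrite mulr_ge0 // /plateau; case: ifP.
have iG : mu.-integrable setT (EFin \o G).
  by apply: L2_mul; [exact: L2_norm|exact: plateau_L2].
have iF z : `]x - 1, x + 1[%classic z -> mu.-integrable setT (EFin \o F z).
  by move=> _; apply: L2_mul => //; apply: test_L2; exact: test_shift.
have dF' z y : `]x - 1, x + 1[%classic z -> setT y -> derivable (F^~ y) z 1.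
  by move=> _ _; have [] := dF z y.
have bF z y : `]x - 1, x + 1[%classic z -> setT y -> `|partial1of2 F z y| <= G y.
  rewrite /= in_itv/= => /andP[z1 z2] _.
  rewrite partial1of2E (@derive_val _ _ _ _ _ _ _ (dF z y)) normrM.
  rewrite /G ler_wpM2l // /plateau; case: ifP => // /negbT; rewrite -ltNge => yM.
  rewrite rM ?normr0 //.
  have zx : `|z - x| < 1 by rewrite ltr_norml; apply/andP; split; lra.
  have tri : `|y| <= `|x| + (`|z - x| + `|z - y|).
    have {1}-> : y = x + ((z - x) - (z - y)) by ring.
    by apply: (le_trans (ler_normD _ _)); rewrite lerD2l ler_normB.
  lra.
have E := @cvg_differentiation_under_integral R _ _ mu F setT measurableT x _ _ Ix
  iF dF' G G0 iG bF.
have E' : (fun h : R => h^-1 *: (conv f rho (h *: 1 + x) - conv f rho x)) @ (0 : R)^'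
    --> conv f (rho^`())%classic x.
  have -> : conv f (rho^`())%classic x = \int[mu]_(y in setT) partial1of2 F x y.
    apply: eq_Rintegral => y _.
    by rewrite partial1of2E (@derive_val _ _ _ _ _ _ _ (dF x y)).
  apply: cvg_trans E; apply: near_eq_cvg; near=> h.
  by rewrite /= /GRing.scale/= mulr1.
by apply: DeriveDef; [apply/cvg_ex; eexists; exact: E'|exact: cvg_lim E'].
Unshelve. all: by end_near. Qed.

Lemma conv_derive f rho : L2 f -> test_function rho ->
  ((conv f rho)^`())%classic = conv f (rho^`())%classic.
Proof.
move=> lf tr; apply/funext => x.
by rewrite derive1E (@derive_val _ _ _ _ _ _ _ (conv_is_derive x lf tr)).
Qed.

Lemma conv_deriven f rho n : L2 f -> test_function rho ->
  ((conv f rho)^`(n))%classic = conv f (rho^`(n))%classic.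
Proof.
move=> lf tr; elim: n => // n IH.
by rewrite !derive1nS IH conv_derive //; exact: test_deriven.
Qed.

Lemma conv_smooth f rho : L2 f -> test_function rho -> smooth (conv f rho).
Proof.
move=> lf tr n x; rewrite conv_deriven //.
by have [] := conv_is_derive x lf (test_deriven n tr).
Qed.

Lemma convDl f g rho x : L2 f -> L2 g -> test_function rho ->
  conv (fun x => f x + g x) rho x = conv f rho x + conv g rho x.
Proof. by move=> lf lg tr; apply: distDl => //; apply: test_L2; exact: test_shift. Qed.

Lemma convZl c f rho x : L2 f -> test_function rho ->
  conv (fun x => c * f x) rho x = c * conv f rho x.
Proof. by move=> lf tr; apply: distZl => //; apply: test_L2; exact: test_shift. Qed.

Lemma int_affine g (a b : R) : 0 < a -> continuous g -> (forall x, 0 <= g x) ->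
  (\int[mu]_x (g x)%:E = \int[mu]_x (g (a * x + b) * a)%:E)%E.
Proof.
move=> a0 cg g0.
have dF x : is_derive x (1 : R) (fun x => a * x + b) a.
  apply: (is_derive_eq (is_deriveD (is_deriveZ a (is_derive_id x (1 : R)))
    (is_derive_cst b x 1))).
  exact: (etrans (addr0 _) (mulr1 _)).
have F' : ((fun x => a * x + b)^`())%classic = cst a.
  by apply/funext => x; rewrite derive1E (@derive_val _ _ _ _ _ _ _ (dF x)).
rewrite (@increasing_ge0_integration_by_substitutionT R (fun x => a * x + b)) //.
- by apply: eq_integral => x _; rewrite F'.
- by move=> x y xy; rewrite ltrD2r ltr_pM2l.
- by rewrite F' => x; exact: cvg_cst.
- by rewrite F'; exact: is_cvg_cst.
- by rewrite F'; exact: is_cvg_cst.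
- apply/cvgrNyPle => A; near=> x.
  rewrite -lerBrDr mulrC -ler_pdivlMr //; near: x; exact: nbhs_ninfty_le.
- apply/cvgryPge => A; near=> x.
  rewrite -lerBlDr mulrC -ler_pdivrMr //; near: x; exact: nbhs_pinfty_ge.
Unshelve. all: by end_near. Qed.

Definition mass rho : R := Rintegral mu setT (fun x => `|rho x|).

Lemma test_norm_cont rho : test_function rho -> continuous (fun x => `|rho x|).
Proof.
move=> tr x; apply: continuous_comp; first exact: test_continuous.
exact: norm_continuous.
Qed.

Lemma test_norm_int rho : test_function rho -> integrableR (fun x => `|rho x|).
Proof. by move=> /test_integrable/integrable_norm. Qed.

Lemma massE rho : test_function rho -> (\int[mu]_x `|rho x|%:E = (mass rho)%:E)%E.
Proof.
move=> tr; rewrite /mass /Rintegral fineK //.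
by apply: integrable_fin_num => //; exact: test_norm_int.
Qed.

Lemma mass_ge0 rho : 0 <= mass rho.
Proof. exact: Rintegral_ge0. Qed.

Lemma mass_shift rho y : test_function rho ->
  (\int[mu]_x `|rho (x - y)|%:E = (mass rho)%:E)%E.
Proof.
move=> tr; rewrite -massE // (@int_affine (fun x => `|rho x|) 1 (- y)) //.
  by apply: eq_integral => x _; rewrite mulr1 mul1r.
exact: test_norm_cont.
Qed.

Definition mirror rho x : R := rho (- x).

Lemma mirror_test rho : test_function rho -> test_function (mirror rho).
Proof.
move=> tr; have := test_shift 0 tr; rewrite /mirror.
by under eq_fun do rewrite sub0r.
Qed.

Lemma mass_shiftr rho x : test_function rho ->
  (\int[mu]_y `|rho (x - y)|%:E = (mass (mirror rho))%:E)%E.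
Proof.
move=> tr; rewrite -(mass_shift x (mirror_test tr)).
by apply: eq_integral => y _; rewrite /mirror opprB.
Qed.

Lemma kernel_meas rho : test_function rho ->
  measurable_fun setT (fun z : measurableTypeR R * measurableTypeR R => rho (z.1 - z.2)).
Proof.
move=> tr; apply: (@measurableT_comp _ _ _ _ _ _ rho); first exact: test_meas.
by apply: measurable_funB; [exact: measurable_fst|exact: measurable_snd].
Qed.

(** This identity carries the bounds of the convolution in both norms. *)
Lemma tonelli_conv (h : R -> R) rho : measurable_fun setT h -> (forall x, 0 <= h x) ->
  test_function rho ->
  (\int[mu]_x \int[mu]_y (h y * `|rho (x - y)|)%:E =
   (mass rho)%:E * \int[mu]_y (h y)%:E)%E.
Proof.
move=> mh h0 tr.
have mk : measurable_fun setT (fun z : measurableTypeR R * measurableTypeR R =>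
    (h z.2 * `|rho (z.1 - z.2)|)%:E).
  apply/measurable_EFinP; apply: measurable_funM.
    by apply: (measurableT_comp mh); exact: measurable_snd.
  by apply: measurableT_comp => //; exact: kernel_meas.
rewrite (@fubini_tonelli _ _ _ _ R mu mu (fun z => (h z.2 * `|rho (z.1 - z.2)|)%:E)) //=; last first.
  by move=> z; rewrite lee_fin mulr_ge0.
have E y : (\int[mu]_x (h y * `|rho (x - y)|)%:E = (h y)%:E * (mass rho)%:E)%E.
{ under eq_integral do rewrite EFinM.
  have mr : measurable_fun setT (fun x => `|rho (x - y)|).
    apply: measurableT_comp => //.
    have := @test_affine R rho 1 (- y) 1 (oner_neq0 _) tr => /test_meas.
    by under eq_fun do rewrite !mul1r.
  rewrite ge0_integralZl //=.
  all: first [by rewrite mass_shift|by move=> x _; rewrite lee_fin|by rewrite lee_fin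
    |exact/measurable_EFinP]. }
under eq_integral do rewrite E.
rewrite ge0_integralZr //=.
all: first [by rewrite muleC|by move=> x _; rewrite lee_fin|exact/measurable_EFinP
  |by rewrite lee_fin mass_ge0].
Qed.

End convolution.

(** * Young's inequality for square integrable functions *)

Section young.
Context {R : realType}.
Local Notation mu := (@lebesgue_measure R).
Implicit Types (f g eta rho : R -> R) (x y : R).

Lemma RintegralE f : integrableR f -> (\int[mu]_x (f x)%:E = (Rintegral mu setT f)%:E)%E.
Proof. by move=> fi; rewrite /Rintegral fineK //; exact: integrable_fin_num. Qed.

Lemma L2_test_int f rho : L2 f -> test_function rho -> integrableR (fun y => f y * rho y).
Proof. by move=> lf tr; apply: L2_mul => //; exact: test_L2. Qed.

Lemma bounded_int f rho : integrableR f -> test_function rho ->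
  integrableR (fun y => f y * `|rho y|).
Proof.
move=> fi tr; have [B [B0 rB]] := test_bounded tr.
have mf : measurable_fun setT f by move/integrableP : fi => [/measurable_EFinP].
apply: (@le_integrable _ _ R mu setT measurableT _ (EFin \o (fun y => B * f y))).
- apply/measurable_EFinP; apply: measurable_funM => //.
  by apply: measurableT_comp => //; exact: test_meas.
- move=> y _ /=; rewrite lee_fin !normrM normr_id (gtr0_norm B0) mulrC.
  by rewrite ler_wpM2r.
- exact: integrableRZ.
Qed.

(** The Cauchy-Schwarz inequality for the measure of density [rho (x - y)] in
    absolute value. *)
Lemma conv_sqr f rho x : L2 f -> test_function rho ->
  conv f rho x * conv f rho x <=
  Rintegral mu setT (fun y => f y * f y * `|rho (x - y)|) * mass (mirror rho).
Proof.
move=> lf tr; have ts := test_shift x tr.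
have i1 : integrableR (fun y => f y * f y * `|rho (x - y)|).
  by apply: bounded_int (L2_sqr lf) ts.
have i2 : integrableR (fun y => f y * rho (x - y)) by exact: L2_test_int lf ts.
have i3 : integrableR (fun y => `|rho (x - y)|) by exact: test_norm_int ts.
have -> : mass (mirror rho) = Rintegral mu setT (fun y => `|rho (x - y)|).
  by apply/EFin_inj; rewrite -(mass_shiftr x tr); exact: RintegralE i3.
apply: discriminant; first exact: Rintegral_ge0.
move=> l; rewrite /conv /dist -RintegralZl // -RintegralZl // -RintegralD //; last first.
  exact: integrableRZ.
rewrite -RintegralD //; last 2 first.
- by apply: integrableRD => //; exact: integrableRZ.
- exact: integrableRZ.
apply: Rintegral_ge0 => y _.
have h1 := ler_norm (rho (x - y)); have h2 := ler_norm (- rho (x - y)).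
rewrite normrN in h2.
rewrite [X in 0 <= X](_ : _ = 2^-1 * ((`|rho (x - y)| + rho (x - y)) * (f y + l) ^+ 2
    + (`|rho (x - y)| - rho (x - y)) * (f y - l) ^+ 2)); last by rewrite /=; field.
by rewrite mulr_ge0 ?invr_ge0 // addr_ge0 // mulr_ge0 ?sqr_ge0 //; lra.
Qed.

Lemma conv_L2 f rho : L2 f -> test_function rho -> L2 (conv f rho) /\
  dist (conv f rho) (conv f rho) <= mass rho * mass (mirror rho) * dist f f.
Proof.
move=> lf tr.
have mc : measurable_fun setT (conv f rho).
  by apply: continuous_measurable_fun; apply: smooth_continuous; exact: conv_smooth.
have mff : measurable_fun setT (fun y => f y * f y).
  by apply: measurable_funM; exact: L2_meas.
have mk : measurable_fun setT (fun z : measurableTypeR R * measurableTypeR R =>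
    (f z.2 * f z.2 * `|rho (z.1 - z.2)|)%:E).
  apply/measurable_EFinP; apply: measurable_funM.
    by apply: (measurableT_comp mff); exact: measurable_snd.
  by apply: measurableT_comp => //; exact: kernel_meas.
have k0 z : (0 <= (f z.2 * f z.2 * `|rho (z.1 - z.2)|)%:E)%E.
  by rewrite lee_fin mulr_ge0 // -expr2 sqr_ge0.
have mF := @measurable_fun_fubini_tonelli_F _ _ (measurableTypeR R) (measurableTypeR R) R mu _ mk k0.
rewrite /fubini_F /= in mF.
have m0 := mass_ge0 rho; have mm0 := mass_ge0 (mirror rho).
have B : (\int[mu]_x (conv f rho x * conv f rho x)%:E <=
    (mass rho * mass (mirror rho) * dist f f)%:E)%E.
  apply: (@le_trans _ _ (\int[mu]_x ((mass (mirror rho))%:E *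
      \int[mu]_y (f y * f y * `|rho (x - y)|)%:E))%E).
    apply: ge0_le_integral => //.
    - by move=> x _; rewrite lee_fin -expr2 sqr_ge0.
    - by apply/measurable_EFinP; exact: measurable_funM.
    - apply: emeasurable_funM => //.
    - move=> x _; rewrite (RintegralE (bounded_int (L2_sqr lf) (test_shift x tr))).
      by rewrite -EFinM lee_fin [leRHS]mulrC; exact: conv_sqr.
  rewrite ge0_integralZl //; last first.
  - by move=> x _; apply: integral_ge0 => y _; rewrite lee_fin mulr_ge0 // -expr2 sqr_ge0.
  rewrite tonelli_conv // => [|x]; last by rewrite -expr2 sqr_ge0.
  by rewrite RintegralE; [rewrite -!EFinM mulrA (mulrC (mass rho))|exact: L2_sqr].
have ci : integrableR (fun x => conv f rho x * conv f rho x).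
  apply/integrableP; split; first by apply/measurable_EFinP; exact: measurable_funM.
  apply: (le_lt_trans _ (ltry _)); apply: le_trans B.
  rewrite le_eqVlt; apply/orP; left; apply/eqP; apply: eq_integral => x _ /=.
  by rewrite ger0_norm // -expr2 sqr_ge0.
split; first exact: L2P.
by rewrite -lee_fin -RintegralE.
Qed.

End young.

(** * Calculus on the line *)

Section calculus_on_the_line.
Context {R : realType}.
Local Notation mu := (@lebesgue_measure R).
Implicit Types (f g u v eta rho : R -> R) (x y a b : R).

Definition C1 u v := (forall x, is_derive x (1 : R) u (v x)) /\ continuous v.

Lemma C1_continuous u v : C1 u v -> continuous u.
Proof.
move=> [du _] x; apply: differentiable_continuous; apply/derivable1_diffP.
by have [] := du x.
Qed.

Lemma smooth_C1 f : smooth f -> C1 f (f^`())%classic.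
Proof.
move=> sf; split=> [x|]; last exact: smooth_continuous (smooth_derive sf).
by apply: DeriveDef; [exact: smooth_derivable|rewrite derive1E].
Qed.

Lemma C1M u v u' v' : C1 u u' -> C1 v v' ->
  C1 (fun x => u x * v x) (fun x => u x * v' x + u' x * v x).
Proof.
move=> cu cv; split=> [x|x].
  have [du _] := cu; have [dv _] := cv.
  apply: (is_derive_eq (is_deriveM (du x) (dv x))).
  by rewrite /GRing.scale /= [v x * _]mulrC.
have [_ cu'] := cu; have [_ cv'] := cv.
by apply: cvgD; apply: cvgM; (exact: (C1_continuous cu)) || (exact: (C1_continuous cv))
  || (exact: cu') || exact: cv'.
Qed.

Lemma FTC_segment u v a b : C1 u v -> a < b ->
  (\int[mu]_(x in `[a, b]) (v x)%:E = (u b)%:E - (u a)%:E)%E.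
Proof.
move=> cu ab; have cc := C1_continuous cu; have [du cv] := cu.
apply: continuous_FTC2 => //.
- exact: continuous_subspaceT.
- split; first by move=> x _; have [] := du x.
    by apply: cvg_at_right_filter; exact: cc.
  by apply: cvg_at_left_filter; exact: cc.
- by move=> x _; rewrite derive1E (@derive_val _ _ _ _ _ _ _ (du x)).
Qed.

(** The pointwise bound is obtained by integrating the derivative of
    [r(y) f(y)^2], where [r] grows from [0] to [1] on the segment [[x - a, x]].
    With [a = tau] the right hand side is a multiple of the quadratic form of
    [1 - tau^2 D^2]. *)
Lemma agmon f f' a x : 0 < a -> C1 f f' -> L2 f -> L2 f' ->
  f x * f x <= 2 / a * dist f f + a * dist f' f'.
Proof.
move=> a0 cf lf lf'; have [df cf'] := cf.
pose r y := a^-1 * y + (1 - a^-1 * x).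
have cr : C1 r (fun=> a^-1).
  split=> [y|]; last by move=> y; exact: cvg_cst.
  apply: (is_derive_eq (is_deriveD (is_deriveZ a^-1 (is_derive_id y (1 : R)))
    (is_derive_cst (1 - a^-1 * x) y 1))).
  exact: (etrans (addr0 _) (mulr1 _)).
have cu := C1M cr (C1M cf cf).
pose g y := 2 / a * (f y * f y) + a * (f' y * f' y).
have gi : integrableR g.
  by apply: integrableRD; apply: integrableRZ; exact: L2_sqr.
have g0 y : 0 <= g y.
  by rewrite addr_ge0 // mulr_ge0 -?expr2 ?sqr_ge0 ?divr_ge0 // ltW.
have mg : measurable_fun setT (EFin \o g) by move/integrableP : gi => [].
have xa : x - a < x by lra.
have rx : r x = 1 by rewrite /r addrCA subrr addr0.
have rxa : r (x - a) = 0 by rewrite /r mulrBr mulVf ?gt_eqF //; lra.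
have := FTC_segment cu xa; rewrite rx rxa mul1r mul0r sube0 => E.
have -> : 2 / a * dist f f + a * dist f' f' = Rintegral mu setT g.
  rewrite /dist -!RintegralZl //; try exact: L2_sqr.
  by rewrite -RintegralD //; apply: integrableRZ; exact: L2_sqr.
rewrite -lee_fin -RintegralE // -E.
apply: (@le_trans _ _ (\int[mu]_(y in `[(x - a)%R, x]) (g y)%:E)%E); last first.
  apply: ge0_subset_integral => //=.
  by move=> y _; rewrite lee_fin.
apply: le_integral => //=.
- apply: continuous_compact_integrable; first exact: segment_compact.
  by apply: continuous_subspaceT; case: cu.
- exact: integrableS gi.
- move=> y; rewrite inE /= in_itv /= => /andP[y1 y2]; rewrite lee_fin /g.
  have r0 : 0 <= r y.
    by rewrite -rxa /r lerD2r ler_wpM2l // invr_ge0 ltW.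
  have r1 : r y <= 1 by rewrite -rx /r lerD2r ler_wpM2l // invr_ge0 ltW.
  have ai : 0 < a^-1 by rewrite invr_gt0.
  rewrite -subr_ge0 (_ : _ - _ = a^-1 * (1 - r y ^+ 2) * (f y * f y) +
    a^-1 * (r y * f y - a * f' y) ^+ 2); last by field; rewrite gt_eqF.
  apply: addr_ge0; last by apply: mulr_ge0; rewrite ?sqr_ge0 // ltW.
  apply: mulr_ge0; last by rewrite -expr2 sqr_ge0.
  by apply: mulr_ge0; [exact: ltW|rewrite subr_ge0 expr_le1].
Qed.

Lemma int_deriv_compact u v M : C1 u v -> (forall x, M < `|x| -> u x = 0) ->
  (forall x, M < `|x| -> v x = 0) -> Rintegral mu setT v = 0.
Proof.
move=> cu uM vM; pose N := `|M| + 1.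
have MN : M < N by rewrite (le_lt_trans (ler_norm M)) // ltrDl.
have N0 : 0 < N by rewrite ltr_wpDl.
have vE : v = v \_ `[- N, N].
  apply/funext => x; rewrite patchE; case: ifPn => // /negP xN.
  apply: vM; apply: (lt_trans MN); rewrite ltNge ler_norml; apply/negP => xN'.
  by apply: xN; rewrite inE/= in_itv.
have NN : - N < N by lra.
rewrite vE -Rintegral_mkcond /Rintegral (FTC_segment cu NN).
rewrite !uM ?normrN ?(gtr0_norm N0) //; first by rewrite sube0.
Qed.

(** Smooth, equal to [1] at the origin and spread over a length of order [n]. *)
Definition cutoff n x := (bump 0)^-1 * bump (n.+1%:R^-1 * x + 0) : R.

Lemma cutoff_test n : test_function (cutoff n).
Proof. by apply: test_affine; [rewrite invr_eq0 pnatr_eq0|exact: bump_test]. Qed.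

Lemma cutoff_ge0 n x : 0 <= cutoff n x.
Proof. by rewrite mulr_ge0 ?bump_ge0 // invr_ge0 bump_ge0. Qed.

Lemma cutoff_le n x : cutoff n x <= (bump 0)^-1.
Proof. by rewrite ler_piMr ?bump_le1 // invr_ge0 bump_ge0. Qed.

Lemma harmonic_cvg : (n.+1%:R^-1 : R) @[n --> \oo] --> (0 : R).
Proof. exact: cvg_harmonic. Qed.

Lemma cutoff_cvg x : cutoff n x @[n --> \oo] --> (1 : R).
Proof.
have <- : (bump 0)^-1 * bump 0 = 1 :> R by rewrite mulVf // gt_eqF // bump0_gt0.
apply: cvgMr.
apply: (@cvg_comp _ _ _ (fun n : nat => n.+1%:R^-1 * x + 0 : R) bump _ (nbhs (0 : R))).
  have h : (n.+1%:R^-1 * x + 0 : R) @[n --> \oo] --> 0 * x + (0 : R).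
    by apply: cvgD; [apply: cvgMl; exact: harmonic_cvg|exact: cvg_cst].
  by rewrite mul0r addr0 in h.
exact: test_continuous bump_test 0.
Qed.

Lemma cutoff_derive : exists B : R, 0 <= B /\ forall n x,
  `|(cutoff n)^`()%classic x| <= B * n.+1%:R^-1.
Proof.
have [B [B0 H]] := test_bounded (test_derive (@bump_test R)).
exists ((bump 0)^-1 * B); split; first by rewrite mulr_ge0 ?invr_ge0 ?bump_ge0 ?ltW.
move=> n x; rewrite derive1E.
have daff : is_derive x (1 : R) (fun x => n.+1%:R^-1 * x + 0) n.+1%:R^-1.
  apply: (is_derive_eq (is_deriveD (is_deriveZ n.+1%:R^-1 (is_derive_id x (1 : R)))
    (is_derive_cst 0 x 1))).
  exact: (etrans (addr0 _) (mulr1 _)).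
have := is_deriveZ (bump 0)^-1 (@is_derive1_comp R bump _ x _ _
  (test_is_derive _ bump_test) daff).
move=> /(@derive_val _ _ _ _ _ _ _) ->.
have b0 : 0 <= (bump (0 : R))^-1 by rewrite invr_ge0 bump_ge0.
have n0 : 0 <= n.+1%:R^-1 :> R by rewrite invr_ge0.
rewrite /GRing.scale /= 2!normrM (ger0_norm b0) (ger0_norm n0) -mulrA.
by rewrite (ler_wpM2l b0) // ler_wpM2r.
Qed.

Lemma int_cutoff f : integrableR f ->
  Rintegral mu setT (fun x => f x * cutoff n x) @[n --> \oo] --> Rintegral mu setT f.
Proof.
move=> fi; have mf : measurable_fun setT f by move/integrableP : fi => [/measurable_EFinP].
have H : (\int[mu]_x (f x * cutoff n x)%:E @[n --> \oo] --> \int[mu]_x (f x)%:E)%E.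
  have B0 : 0 <= (bump (0 : R))^-1 by rewrite invr_ge0 bump_ge0.
  apply: (@dominated_cvg _ _ R mu setT measurableT
    (fun n x => (f x * cutoff n x)%:E) _ (fun x => ((bump 0)^-1 * `|f x|)%:E)).
  - move=> n; apply/measurable_EFinP; apply: measurable_funM => //.
    exact: test_meas (cutoff_test n).
  - move=> x _; apply: cvg_EFin; first by exact: nearW.
    have h : f x * cutoff n x @[n --> \oo] --> f x * 1 by apply: cvgMr; exact: cutoff_cvg.
    by rewrite mulr1 in h.
  - by [].
  - apply: integrableRZ; exact: integrable_norm.
  - move=> n x _; rewrite /= lee_fin normrM mulrC ler_wpM2r //.
    by rewrite ger0_norm ?cutoff_ge0 // cutoff_le.
apply: fine_cvg; rewrite -RintegralE //.
Qed.

(** No boundary term at infinity: the integral is computed with the cutoffs,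
    whose derivatives are of order [1/n]. *)
Lemma int_deriv u v : C1 u v -> integrableR u -> integrableR v -> Rintegral mu setT v = 0.
Proof.
move=> cu ui vi.
have mc := int_cutoff vi.
suff Z : Rintegral mu setT (fun x => v x * cutoff n x) @[n --> \oo] --> (0 : R).
  exact: (cvg_unique _ mc Z).
have [B [B0 H]] := cutoff_derive.
have mu' : measurable_fun setT u by move/integrableP : ui => [/measurable_EFinP].
have vE n : Rintegral mu setT (fun x => v x * cutoff n x) =
    - Rintegral mu setT (fun x => u x * (cutoff n)^`()%classic x).
  have tc := cutoff_test n; have tc' := test_derive tc.
  have [M [M0 cM]] := test_supp tc; have [M' [_ cM']] := test_supp tc'.
  have [K [_ cK]] := test_bounded tc; have [K' [_ cK']] := test_bounded tc'.
  have dom w k eta : integrableR w -> test_function eta -> (forall x, `|eta x| <= k) ->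
      integrableR (fun x => w x * eta x).
    move=> wi te ek; have mw : measurable_fun setT w by move/integrableP : wi => [/measurable_EFinP].
    apply: (@le_integrable _ _ R mu setT measurableT _ (EFin \o (fun y => k * w y))).
    - by apply/measurable_EFinP; apply: measurable_funM => //; exact: test_meas.
    - move=> y _ /=; rewrite lee_fin !normrM mulrC ler_wpM2r //.
      by apply: (le_trans (ek y)); exact: ler_norm.
    - exact: integrableRZ.
  apply/eqP; rewrite -addr_eq0 -RintegralD //; last 2 first.
    exact: dom cK.
    exact: dom cK'.
  apply/eqP; under eq_Rintegral do rewrite addrC.
  have := C1M cu (smooth_C1 (test_smooth tc)).
  move/(@int_deriv_compact _ _ (Num.max M M')); apply.
  - by move=> x; rewrite gt_max => /andP[xM _]; rewrite cM // mulr0.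
  - by move=> x; rewrite gt_max => /andP[xM xM']; rewrite cM // cM' // !mulr0 addr0.
apply: norm_cvg0.
apply: (@squeeze_cvgr _ _ _ _ (fun=> 0) (fun n => B * n.+1%:R^-1 * Rintegral mu setT (fun x => `|u x|))).
- apply: nearW => n; rewrite normr_ge0 /= vE normrN.
  have ii : integrableR (fun x => B * n.+1%:R^-1 * `|u x|).
    by apply: integrableRZ; exact: integrable_norm.
  have ii' : integrableR (fun x => u x * (cutoff n)^`()%classic x).
    apply: (@le_integrable _ _ R mu setT measurableT _ (EFin \o (fun x => B * n.+1%:R^-1 * `|u x|))) => //.
      apply/measurable_EFinP; apply: measurable_funM => //.
      exact: test_meas (test_derive (cutoff_test n)).
    move=> y _ /=; rewrite lee_fin normrM mulrC [leRHS]normrM normr_id ler_wpM2r //.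
    by apply: (le_trans (H n y)); exact: ler_norm.
  apply: (le_trans (le_normr_Rintegral _ ii')) => //.
  rewrite -RintegralZl //; last exact: integrable_norm.
  apply: le_Rintegral => //; first exact: integrable_norm.
  by move=> y _; rewrite normrM mulrC ler_wpM2r.
- exact: cvg_cst.
- have h : B * n.+1%:R^-1 * Rintegral mu setT (fun x => `|u x|) @[n --> \oo] -->
      B * 0 * Rintegral mu setT (fun x => `|u x|).
    by apply: cvgMl; apply: cvgMr; exact: harmonic_cvg.
  by rewrite mulr0 mul0r in h.
Qed.

End calculus_on_the_line.

(** * Convergence of mollifications *)

Section mollification.
Context {R : realType}.
Local Notation mu := (@lebesgue_measure R).
Implicit Types (f g u v eta zeta rho : R -> R) (x y a b : R).

Lemma integrableRB f g : integrableR f -> integrableR g -> integrableR (fun x => f x - g x).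
Proof.
move=> fi gi; have -> : (fun x => f x - g x) = (fun x => f x + (-1) * g x).
  by apply/funext => x; rewrite mulN1r.
by apply: integrableRD => //; exact: integrableRZ.
Qed.

Lemma conv_int f rho : integrableR f -> L2 f -> test_function rho ->
  integrableR (conv f rho) /\
  Rintegral mu setT (fun x => `|conv f rho x|) <= mass rho * Rintegral mu setT (fun x => `|f x|).
Proof.
move=> fi lf tr.
have mc : measurable_fun setT (conv f rho).
  by apply: continuous_measurable_fun; apply: smooth_continuous; exact: conv_smooth.
have mf : measurable_fun setT (fun y => `|f y|).
  by apply: measurableT_comp => //; exact: L2_meas.
have mk : measurable_fun setT (fun z : measurableTypeR R * measurableTypeR R =>
    (`|f z.2| * `|rho (z.1 - z.2)|)%:E).
  apply/measurable_EFinP; apply: measurable_funM.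
    by apply: (measurableT_comp mf); exact: measurable_snd.
  by apply: measurableT_comp => //; exact: kernel_meas.
have k0 z : (0 <= (`|f z.2| * `|rho (z.1 - z.2)|)%:E)%E by rewrite lee_fin mulr_ge0.
have mF := @measurable_fun_fubini_tonelli_F _ _ (measurableTypeR R) (measurableTypeR R) R mu _ mk k0.
rewrite /fubini_F /= in mF.
have fi' : integrableR (fun y => `|f y|) by exact: integrable_norm.
have B : (\int[mu]_x `|conv f rho x|%:E <=
    (mass rho * Rintegral mu setT (fun x => `|f x|))%:E)%E.
  rewrite EFinM -(RintegralE fi') -tonelli_conv //.
  apply: ge0_le_integral => //.
  - by apply/measurable_EFinP; exact: measurableT_comp.
  - move=> x _; have i1 := bounded_int fi' (test_shift x tr).
    rewrite (RintegralE i1) lee_fin.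
    apply: (le_trans (le_normr_Rintegral _ _)) => //; first exact: L2_test_int (test_shift x tr).
    by rewrite le_eqVlt; apply/orP; left; apply/eqP; apply: eq_Rintegral => y _; rewrite normrM.
have ci : integrableR (conv f rho).
  apply/integrableP; split; first exact/measurable_EFinP.
  exact: (le_lt_trans B (ltry _)).
split=> //; rewrite -lee_fin -RintegralE //; exact: integrable_norm.
Qed.

Lemma conv_test eta rho : test_function eta -> test_function rho ->
  test_function (conv eta rho).
Proof.
move=> te tr; split; first exact: conv_smooth (test_L2 te) tr.
have [M [M0 eM]] := test_supp te; have [N [N0 rN]] := test_supp tr.
exists (M + N) => x xM; rewrite /conv /dist; have -> : (fun y => eta y * rho (x - y)) = fun=> 0.
  apply/funext => y; have [yM|/eM ->] := leP `|y| M; last by rewrite mul0r.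
  rewrite rN ?mulr0 //; have := ler_normD (x - y) y; rewrite subrK; lra.
by rewrite /Rintegral integral0.
Qed.

(** Fubini's theorem. The product is integrable because, on each line, the
    product of [f] and [rho] is at most the square of [f] plus a multiple
    of [rho]. *)
Lemma conv_adjoint f rho zeta : L2 f -> test_function rho -> test_function zeta ->
  dist (conv f rho) zeta = dist f (conv zeta (mirror rho)).
Proof.
move=> lf tr tz.
have mk : measurable_fun setT (fun z : measurableTypeR R * measurableTypeR R =>
    (f z.2 * rho (z.1 - z.2) * zeta z.1)%:E).
  apply/measurable_EFinP; apply: measurable_funM; last first.
    by apply: (measurableT_comp (test_meas tz)); exact: measurable_fst.
  apply: measurable_funM; last exact: kernel_meas.
  by apply: (measurableT_comp (L2_meas lf)); exact: measurable_snd.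
have [B [B0 rB]] := test_bounded tr.
have i1 x : integrableR (fun y => f y * f y + B * `|rho (x - y)|).
  apply: integrableRD; first exact: L2_sqr.
  by apply: integrableRZ; exact: test_norm_int (test_shift x tr).
pose C := Rintegral mu setT (fun y => f y * f y) + B * mass (mirror rho).
have CE x : Rintegral mu setT (fun y => f y * f y + B * `|rho (x - y)|) = C.
  have tn := test_norm_int (test_shift x tr).
  rewrite RintegralD //; [|exact: L2_sqr|exact: integrableRZ].
  rewrite RintegralZl //; congr (_ + B * _).
  by apply: EFin_inj; rewrite -(mass_shiftr x tr) RintegralE.
have CZ (x : R) : C * `|zeta x| =
    Rintegral mu setT (fun y => `|zeta x| * (f y * f y + B * `|rho (x - y)|)).
  by rewrite mulrC -(CE x) -RintegralZl //; exact: i1.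
have bnd : (\int[mu]_x \int[mu]_y `|(f y * rho (x - y) * zeta x)%:E| < +oo)%E.
  have m1 : measurable_fun setT (fun z : measurableTypeR R * measurableTypeR R =>
    (`|f z.2 * rho (z.1 - z.2) * zeta z.1|)%:E).
    by apply/measurable_EFinP; apply: measurableT_comp => //; apply/measurable_EFinP; exact: mk.
  have k0 (z : measurableTypeR R * measurableTypeR R) :
    (0 <= (`|f z.2 * rho (z.1 - z.2) * zeta z.1|)%:E)%E by rewrite lee_fin.
  have mF := @measurable_fun_fubini_tonelli_F _ _ (measurableTypeR R) (measurableTypeR R) R mu _ m1 k0.
  rewrite /fubini_F /= in mF.
  have ci : integrableR (fun x => C * `|zeta x|).
    by apply: integrableRZ; exact: test_norm_int.
  apply: (@le_lt_trans _ _ (\int[mu]_x (C * `|zeta x|)%:E)%E); last first.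
    by rewrite (RintegralE ci) ltry.
  apply: ge0_le_integral => //.
  - by move=> x _; apply: integral_ge0 => y _; rewrite lee_fin.
  - apply/measurable_EFinP; apply: measurable_funM => //.
    by apply: measurableT_comp => //; exact: test_meas.
  - move=> x _.
    rewrite CZ -RintegralE; last exact: integrableRZ.
    apply: ge0_le_integral => //.
    + apply/measurable_EFinP; apply: measurableT_comp => //; apply: measurable_funM => //.
      apply: measurable_funM; first exact: L2_meas.
      exact: test_meas (test_shift x tr).
    + have := integrableRZ `|zeta x| (i1 x); by move=> /integrableP[].
    + move=> y _; rewrite lee_fin normrM [leLHS]mulrC ler_wpM2l // normrM.
      have h1 := rB (x - y); have h2 := normr_ge0 (rho (x - y)); have h3 := normr_ge0 (f y).
      have -> : f y * f y = `|f y| * `|f y| by rewrite -normrM -expr2 ger0_norm ?sqr_ge0.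
      nra.
have ik := (@integrable12ltyP _ _ (measurableTypeR R) (measurableTypeR R) R mu mu _ mk).2 bnd.
have F := @Fubini _ _ (measurableTypeR R) (measurableTypeR R) R mu mu _ ik.
rewrite /= in F.
rewrite /dist /Rintegral; congr fine.
transitivity (\int[mu]_x \int[mu]_y (f y * rho (x - y) * zeta x)%:E)%E.
  apply: eq_integral => x _.
  have ii := L2_test_int lf (test_shift x tr).
  rewrite mulrC /conv /dist -RintegralZl // -RintegralE; last exact: integrableRZ.
  by apply: eq_integral => y _; congr EFin; rewrite mulrC.
rewrite F; apply: eq_integral => y _.
have ii := L2_test_int (test_L2 tz) (test_shift y (mirror_test tr)).
rewrite /conv /dist -RintegralZl // -RintegralE; last exact: integrableRZ.
by apply: eq_integral => x _; rewrite /mirror opprB; congr EFin; ring.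
Qed.

(** Since [0 <= bump <= 1], a bump of mass zero would have a vanishing square
    integral, and then vanish at the origin by Agmon's inequality with a small
    length. *)
Lemma mass_bump_gt0 : 0 < mass (@bump R).
Proof.
have tb := @bump_test R.
rewrite lt_def mass_ge0 andbT; apply/negP => /eqP m0.
have lb := test_L2 tb; have tb' := test_derive tb.
have d0 : dist (@bump R) bump <= 0.
  rewrite -m0; apply: le_Rintegral => //; first exact: L2_mul.
    exact: test_norm_int.
  by move=> x _; rewrite ger0_norm ?bump_ge0 // ler_piMr ?bump_ge0 ?bump_le1.
have d1 : 0 <= dist (@bump R)^`()%classic (@bump R)^`()%classic by exact: distff_ge0.
have b0 := @bump0_gt0 R.
set E := dist _ _ in d1.
pose a := bump 0 * bump 0 / (2 * (E + 1)) : R.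
have E1 : 0 < E + 1 by rewrite ltr_wpDl.
have a0 : 0 < a by apply: divr_gt0; exact: mulr_gt0.
have := @agmon R bump _ a 0 a0 (smooth_C1 (@bump_smooth R)) lb (test_L2 tb').
rewrite -/E.
have h : 2 / a * dist (@bump R) bump <= 0 by rewrite mulr_ge0_le0 // divr_ge0 // ltW.
have h2 : a * E <= bump 0 * bump 0 / 2.
  have -> : bump 0 * bump 0 / 2 = a * (E + 1) :> R by rewrite /a; field; lra.
  by rewrite ler_pM2l // lerDl.
have : 0 < bump 0 * bump 0 :> R by rewrite mulr_gt0.
lra.
Qed.

Definition moll n x : R := n.+1%:R / mass bump * bump (n.+1%:R * x + 0).

Lemma moll_test n : test_function (moll n).
Proof. by apply: test_affine; [rewrite pnatr_eq0|exact: bump_test]. Qed.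

Lemma moll_ge0 n x : 0 <= moll n x.
Proof. by rewrite mulr_ge0 ?bump_ge0 // divr_ge0 ?mass_ge0. Qed.

Lemma moll_mirror n : mirror (moll n) = moll n.
Proof.
apply/funext => x; rewrite /mirror /moll !addr0 mulrN; congr (_ * _).
by rewrite /bump opprK mulrC.
Qed.

Lemma moll_out n x : n.+1%:R^-1 < `|x| -> moll n x = 0.
Proof.
move=> xn; rewrite /moll addr0 bump_out ?mulr0 // normrM gtr0_norm ?ltr0n //.
by rewrite mulrC -ltr_pdivrMr ?ltr0n // div1r.
Qed.

Lemma moll_mass n : mass (moll n) = 1.
Proof.
have m0 := mass_bump_gt0.
apply: EFin_inj; rewrite -(massE (moll_test n)).
have E (x : R) : `|moll n x|%:E = ((`|bump (n.+1%:R * x + 0)| * n.+1%:R) / mass bump)%:E.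
  by rewrite ger0_norm ?moll_ge0 // ger0_norm ?bump_ge0 // /moll; congr EFin; ring.
under eq_integral do rewrite E EFinM.
have mb : measurable_fun setT (fun x => `|bump (n.+1%:R * x + 0)| * n.+1%:R : R).
  apply: measurable_funM => //; apply: measurableT_comp => //.
  have := @test_affine R bump n.+1%:R 0 1 _ bump_test.
  rewrite pnatr_eq0 => /(_ isT)/test_meas.
  by under eq_fun do rewrite mul1r.
rewrite ge0_integralZr //; first last.
all: try by [move=> x _; rewrite lee_fin mulr_ge0|rewrite lee_fin invr_ge0 mass_ge0
  |exact/measurable_EFinP].
rewrite -(@int_affine R (fun x => `|bump x|)) ?ltr0n //; last first.
  exact: test_norm_cont bump_test.
by rewrite (massE bump_test) -EFinM divff // gt_eqF.
Qed.

Lemma moll_approx zeta : test_function zeta -> exists B, 0 < B /\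
  forall n x, `|conv zeta (moll n) x - zeta x| <= B * n.+1%:R^-1.
Proof.
move=> tz; have [B [B0 zB]] := test_lipschitz tz; exists B; split=> // n x.
have tm := test_shift x (moll_test n).
have tn := test_norm_int tm.
have m1 : Rintegral mu setT (fun y => `|moll n (x - y)|) = 1.
  by apply: EFin_inj; rewrite -RintegralE // mass_shiftr ?moll_mirror ?moll_mass //; exact: moll_test.
have -> : zeta x = Rintegral mu setT (fun y => zeta x * moll n (x - y)).
  rewrite RintegralZl //; last exact: test_integrable.
  rewrite -[LHS]mulr1 -m1; congr (_ * _); apply: eq_Rintegral => y _.
  by rewrite ger0_norm ?moll_ge0.
have i1 := L2_test_int (test_L2 tz) tm.
have i2 : integrableR (fun y => zeta x * moll n (x - y)).
  by apply: integrableRZ; exact: test_integrable.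
rewrite /conv /dist -RintegralB //.
apply: (le_trans (le_normr_Rintegral _ _)) => //; first exact: integrableRB.
have -> : B * n.+1%:R^-1 = Rintegral mu setT (fun y => B * n.+1%:R^-1 * `|moll n (x - y)|).
  by rewrite RintegralZl // m1 mulr1.
apply: le_Rintegral => //.
- by apply: integrable_norm; exact: integrableRB.
- exact: integrableRZ.
- move=> y _; rewrite -mulrBl normrM.
  have [h|/moll_out ->] := leP `|x - y| n.+1%:R^-1; last by rewrite normr0 !mulr0.
  rewrite ler_wpM2r // distrC; apply: (le_trans (zB x y)).
  by rewrite ler_pM2l.
Qed.

(** By duality the mollification is carried to the test function, where it
    converges uniformly and inside a fixed segment. *)
Lemma moll_cvg f zeta : L2 f -> test_function zeta ->
  dist (conv f (moll n)) zeta @[n --> \oo] --> dist f zeta.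
Proof.
move=> lf tz; have [B [B0 zB]] := moll_approx tz.
have [M [M0 zM]] := test_supp tz.
have lp : L2 (plateau 1 (M + 1)) by exact: plateau_L2.
have lfn := L2_norm lf.
pose K := dist (fun x => `|f x|) (plateau 1 (M + 1)).
apply/subr_cvg0; apply: norm_cvg0.
apply: (@squeeze_cvgr _ _ _ _ (fun=> 0) (fun n => B * n.+1%:R^-1 * K)); last 2 first.
- by apply: cvg_cst.
- have h : B * n.+1%:R^-1 * K @[n --> \oo] --> B * 0 * K.
    by apply: cvgMl; apply: cvgMr; exact: harmonic_cvg.
  by rewrite mulr0 mul0r in h.
apply: nearW => n; rewrite normr_ge0 /= conv_adjoint //; last exact: moll_test.
rewrite moll_mirror.
have tc := conv_test tz (moll_test n).
have i1 := L2_test_int lf tc; have i2 := L2_test_int lf tz.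
rewrite /dist -RintegralB //.
apply: (le_trans (le_normr_Rintegral _ _)) => //; first exact: integrableRB.
rewrite -RintegralZl //; last exact: L2_mul.
apply: le_Rintegral => //.
- by apply: integrable_norm; exact: integrableRB.
- by apply: integrableRZ; exact: L2_mul.
move=> x _; rewrite -mulrBr normrM mulrCA ler_wpM2l //.
rewrite /plateau; case: (leP `|x| (M + 1)) => [_|xM]; first by rewrite mulr1.
rewrite (zM x); last by lra.
rewrite subr0 mulr0 /conv /dist (_ : (fun y => _) = fun=> 0) ?/Rintegral ?integral0 ?normr0 //.
apply/funext => y; have [yM|/zM ->] := leP `|y| M; last by rewrite mul0r.
rewrite moll_out ?mulr0 //.
have := ler_normD (x - y) y; rewrite subrK.
have : n.+1%:R^-1 <= 1 :> R by rewrite invf_le1 ?ltr0n // ler1n.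
move: (n.+1%:R^-1) => q q1 xy; apply: (le_lt_trans q1); lra.
Qed.

End mollification.

(** * Completeness of the space of square integrable functions *)

Section completeness.
Context {R : realType}.
Local Notation mu := (@lebesgue_measure R).
Implicit Types (f g u v eta zeta rho : R -> R) (x y a b : R).

Local Notation h := (2^-1 : R).

Lemma small_le (x c : R) : (forall k, x <= c * h ^+ k) -> x <= 0.
Proof.
move=> H; have cv : c * h ^+ k @[k --> \oo] --> (0 : R).
  have : `|h| < 1 by rewrite ger0_norm // invf_lt1 // ltr1n.
  by move/(@cvg_geometric R c).
by apply: (cvgr_to_ge cv); exact: nearW.
Qed.

Lemma geometric_cauchy (u : nat -> R) s : 0 <= s ->
  (forall i, `|u i.+1 - u i| <= s * h ^+ i) ->
  cvgn u /\ forall k, `|limn u - u k| <= 2 * s * h ^+ k.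
Proof.
move=> s0 H.
have hE i : s * h ^+ i = 2 * s * h ^+ i - 2 * s * h ^+ i.+1.
  by rewrite exprS; field.
pose w i := u i + 2 * s * h ^+ i; pose z i := u i - 2 * s * h ^+ i.
have hk0 i : 0 <= 2 * s * h ^+ i by rewrite mulr_ge0 ?mulr_ge0 // exprn_ge0.
have wd : nonincreasing_seq w.
  apply/nonincreasing_seqP => i; rewrite /w; have := H i; rewrite hE ler_norml.
  by move=> /andP[_ ?]; lra.
have zi : nondecreasing_seq z.
  apply/nondecreasing_seqP => i; rewrite /z; have := H i; rewrite hE ler_norml.
  by move=> /andP[? _]; lra.
have cw : cvgn w.
  apply: nonincreasing_is_cvgn => //; exists (z 0%N) => _ [i _ <-].
  apply: (@le_trans _ _ (z i)); first exact: zi.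
  by rewrite /z /w; have := hk0 i; lra.
have c0 : 2 * s * h ^+ i @[i --> \oo] --> (0 : R).
  have : `|h| < 1 by rewrite ger0_norm // invf_lt1 // ltr1n.
  by move/(@cvg_geometric R (2 * s)).
have cu : u @ \oo --> limn w.
  have cc := cvgB cw c0; rewrite subr0 in cc.
  have uE : u = (fun i => w i - 2 * s * h ^+ i) by apply/funext => i; rewrite /w addrK.
  rewrite [X in X @ _]uE; exact: cc.
split; first by apply/cvg_ex; exists (limn w).
move=> k; rewrite (cvg_lim _ cu) //.
have W i : z k <= u (k + i)%N <= w k.
  have a1 := wd _ _ (leq_addr i k); have a2 := zi _ _ (leq_addr i k).
  have a3 := hk0 (k + i)%N; rewrite /w /z in a1 a2 *; apply/andP; split; lra.
have near_k (P : R -> Prop) : (forall i, P (u (k + i)%N)) -> \forall i \near \oo, P (u i).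
  by move=> Pk; exists k => // i /= ki; rewrite -(subnKC ki).
have l1 : z k <= limn w.
  by apply: (cvgr_to_ge cu (near_k (fun y => z k <= y) _)) => i; case/andP: (W i).
have l2 : limn w <= w k.
  by apply: (cvgr_to_le cu (near_k (fun y => y <= w k) _)) => i; case/andP: (W i).
by rewrite ler_norml; rewrite /w /z in l1 l2; apply/andP; split; lra.
Qed.

(** With a geometric rate there is no need to extract a subsequence. The series
    [G] of the terms [4^i (u_(i+1) - u_i)^2] has a finite integral; where it
    is finite the sequence converges and the distance of [u_k] to the limit is at
    most a multiple of [2^-k] times the square root of [G]. Elsewhere the limit
    is set to zero and the bound holds because its right hand side is infinite. *)
Lemma riesz_fischer (u : nat -> R -> R) : (forall i, L2 (u i)) ->
  (forall i, dist (fun x => u i.+1 x - u i x) (fun x => u i.+1 x - u i x) <= (h ^+ i) ^+ 3) ->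
  exists g, L2 g /\ forall k, dist (fun x => g x - u k x) (fun x => g x - u k x) <= 8 * h ^+ k.
Proof.
move=> lu du.
pose d i x := u i.+1 x - u i x.
have ld i : L2 (d i) by apply: L2D => //; exact: L2N.
pose F i x : \bar R := (4 ^+ i * (d i x * d i x))%:E.
have mF i : measurable_fun setT (F i).
  apply/measurable_EFinP; apply: measurable_funM => //.
  by apply: measurable_funM; exact: L2_meas.
have F0 i x : (0 <= F i x)%E by rewrite lee_fin mulr_ge0 ?exprn_ge0 // -expr2 sqr_ge0.
pose G x : \bar R := (\sum_(i <oo) F i x)%E.
have mG : measurable_fun setT G by exact: ge0_emeasurable_sum.
have G0 x : (0 <= G x)%E by apply: nneseries_ge0.
have IG : (\int[mu]_x G x <= 2%:E)%E.
  rewrite integral_nneseries //.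
  apply: (@le_trans _ _ (\sum_(i <oo) (2 / (2 ^ i.+1)%:R)%:E)%E); last exact: epsilon_trick0.
  apply: lee_nneseries => [i _ _|i _]; first exact: integral_ge0.
  rewrite RintegralE; last by apply: integrableRZ; exact: L2_sqr.
  rewrite RintegralZl //; last exact: L2_sqr.
  have -> : 2 / (2 ^ i.+1)%:R = 4 ^+ i * (h ^+ i) ^+ 3 :> R.
    rewrite natrX exprS -exprM mulnC exprM -exprMn (_ : 4 * h ^+ 3 = h); last by field.
    by rewrite exprVn; field; rewrite expf_neq0.
  by rewrite lee_fin ler_pM2l ?exprn_gt0 //; exact: du.
pose g x := if (G x \is a fin_num) then limn (fun k => u k x) else 0.
have step x : G x \is a fin_num -> forall i, `|u i.+1 x - u i x| <= Num.sqrt (fine (G x)) * h ^+ i.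
  move=> Gf i.
  have FG : (F i x <= G x)%E.
    apply: le_trans (nneseries_lim_ge i.+1 _) => //.
    by rewrite big_nat_recr //= leeDr // sume_ge0.
  have : 4 ^+ i * (d i x * d i x) <= fine (G x) by rewrite -lee_fin fineK.
  have f0 : 0 <= fine (G x) by apply: fine_ge0.
  have h0 : 0 < h ^+ i by rewrite exprn_gt0.
  move=> dG; rewrite -ler_pdivrMr // -[X in X / _]sqrtr_sqr -/(d i x).
  have -> : Num.sqrt (d i x ^+ 2) / h ^+ i = Num.sqrt (4 ^+ i * (d i x * d i x)).
    have -> : 4 ^+ i * (d i x * d i x) = (d i x / h ^+ i) ^+ 2.
      by rewrite expr_div_n -expr2 mulrC -exprM mulnC exprM -exprVn expr2 invfM invrK -natrM.
    by rewrite !sqrtr_sqr normrM normfV (ger0_norm (ltW h0)).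
  exact: ler_wsqrtr.
have gcv x : G x \is a fin_num -> cvgn (fun k => u k x) /\
    forall k, `|g x - u k x| <= 2 * Num.sqrt (fine (G x)) * h ^+ k.
  by move=> Gf; rewrite /g Gf; exact: (geometric_cauchy (sqrtr_ge0 _) (step x Gf)).
have mg : measurable_fun setT g.
  apply: (@measurable_fun_cvg _ _ R setT (fun k x => if G x \is a fin_num then u k x else 0)).
    move=> k; apply: measurable_fun_if => //.
    - apply: (measurable_fun_bool true); rewrite setTI.
      have := emeasurable_fin_num measurableT mG; rewrite setTI.
      by congr measurable; apply/seteqP; split=> x /=.
    - by apply: measurable_funTS; exact: L2_meas.
  move=> x _; rewrite /g; case: ifPn => Gf; last exact: cvg_cst.
  by have [] := gcv x Gf.
exists g.
have bound k x : (((g x - u k x) * (g x - u k x))%:E <= (4 * h ^+ k)%:E * G x)%E.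
  have hk : 0 < h ^+ k by rewrite exprn_gt0.
  have [Gf|] := boolP (G x \is a fin_num); last first.
    have := G0 x; case: (G x) => //= _ _.
    by rewrite gt0_muley ?leey // lte_fin mulr_gt0.
  have [_ /(_ k) B] := gcv x Gf.
  rewrite -(fineK Gf) -EFinM lee_fin.
  have f0 : 0 <= fine (G x) by apply: fine_ge0.
  rewrite -[leLHS]ger0_norm -?expr2 ?sqr_ge0 // expr2 normrM.
  apply: (@le_trans _ _ ((2 * Num.sqrt (fine (G x)) * h ^+ k) * (2 * Num.sqrt (fine (G x)) * h ^+ k))).
    by apply: ler_pM.
  have -> : 2 * Num.sqrt (fine (G x)) * h ^+ k * (2 * Num.sqrt (fine (G x)) * h ^+ k) =
      4 * h ^+ k * (Num.sqrt (fine (G x)) ^+ 2) * h ^+ k by ring.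
  rewrite sqr_sqrtr // ler_piMr ?mulr_ge0 ?exprn_ge0 //.
  by rewrite exprn_ile1 // invf_le1 // ler1n.
have gint k : (\int[mu]_x ((g x - u k x) * (g x - u k x))%:E <= (8 * h ^+ k)%:E)%E.
  have hk : 0 <= 4 * h ^+ k :> R by rewrite mulr_ge0 // exprn_ge0.
  apply: (@le_trans _ _ (\int[mu]_x ((4 * h ^+ k)%:E * G x))%E).
    apply: ge0_le_integral => //.
    - by move=> x _; rewrite lee_fin -expr2 sqr_ge0.
    - apply/measurable_EFinP; apply: measurable_funM; apply: measurable_funB => //; exact: L2_meas.
    - exact: measurable_funeM.
  rewrite ge0_integralZl //.
  have -> : (8 * h ^+ k)%:E = ((4 * h ^+ k)%:E * 2%:E)%E by rewrite -EFinM; congr EFin; ring.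
  by apply: lee_wpmul2l.
have lgu k : L2 (fun x => g x - u k x).
  have mgu : measurable_fun setT (fun x => g x - u k x).
    by apply: measurable_funB => //; exact: L2_meas.
  apply: L2P => //; apply/integrableP; split.
    by apply/measurable_EFinP; exact: measurable_funM.
  apply: (le_lt_trans _ (ltry _)); apply: le_trans (gint k).
  rewrite le_eqVlt; apply/orP; left; apply/eqP; apply: eq_integral => x _ /=.
  by rewrite ger0_norm // -expr2 sqr_ge0.
split.
  have := L2D (lgu 0%N) (lu 0%N); congr L2.
  by apply/funext => x; rewrite subrK.
by move=> k; rewrite -lee_fin -RintegralE //; exact: L2_sqr.
Qed.

End completeness.

(** * Representation of bounded functionals on test functions *)

Section representation.
Context {R : realType}.
Local Notation mu := (@lebesgue_measure R).
Implicit Types (f g u v eta zeta rho : R -> R) (x y a b : R).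
Local Notation h := (2^-1 : R).

Lemma test_0 : test_function (fun=> 0 : R).
Proof.
have := @test_affine R bump 1 0 0 (oner_neq0 _) (@bump_test R).
by under eq_fun do rewrite mul0r.
Qed.

Lemma test_add eta zeta : test_function eta -> test_function zeta ->
  test_function (fun x => eta x + zeta x).
Proof.
move=> te tz; split.
  apply: (@smooth_coind _ (fun f => exists u v, [/\ smooth u, smooth v & f = (fun x => u x + v x)])).
    move=> _ [u [v [su sv ->]]].
    have du := smooth_derivable su; have dv := smooth_derivable sv.
    split=> [x|]; first exact: derivableD.
    exists (u^`())%classic, (v^`())%classic; split; [exact: smooth_derive|exact: smooth_derive|].
    by apply/funext => x; rewrite derive1E deriveD // -!derive1E.
  by exists eta, zeta; split=> //; exact: test_smooth.
have [M [M0 eM]] := test_supp te; have [N [N0 zN]] := test_supp tz.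
exists (M + N) => x xM; rewrite eM ?zN ?addr0 //; lra.
Qed.

Lemma test_scale c eta : test_function eta -> test_function (fun x => c * eta x).
Proof.
move=> te; have := @test_affine R eta 1 0 c (oner_neq0 _) te.
by under eq_fun do rewrite mul1r addr0.
Qed.

Lemma distDr f g v : L2 f -> L2 g -> L2 v ->
  dist v (fun x => f x + g x) = dist v f + dist v g.
Proof. by move=> lf lg lv; rewrite distC distDl // !(distC v). Qed.

Lemma distZr c f v : L2 f -> L2 v -> dist v (fun x => c * f x) = c * dist v f.
Proof. by move=> lf lv; rewrite distC distZl // (distC v). Qed.

Lemma dist_expand f g c : L2 f -> L2 g ->
  dist (fun x => f x + c * g x) (fun x => f x + c * g x) =
  dist f f + 2 * c * dist f g + c * c * dist g g.
Proof.
move=> lf lg; have lcg := L2Z c lg; have ls := L2D lf lcg.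
by rewrite distDl // distZl // !distDr // !distZr // (distC g f); ring.
Qed.

(** The Riesz representation theorem on the space of test functions, which is
    not complete: a minimizing sequence of [|eta|^2 - 2 T eta] is a Cauchy
    sequence, and its limit represents [T]. This is the form in which weak
    compactness is used. *)
Lemma riesz_test (T : (R -> R) -> R) (M : R) :
  (forall eta zeta c, test_function eta -> test_function zeta ->
     T (fun x => eta x + c * zeta x) = T eta + c * T zeta) ->
  (forall eta, test_function eta -> T eta * T eta <= M * dist eta eta) ->
  0 <= M ->
  exists g, [/\ L2 g, dist g g <= M &
    forall eta, test_function eta -> dist g eta = T eta].
Proof.
move=> TL TB M0.
pose J eta := dist eta eta - 2 * T eta.
have JM eta : test_function eta -> - M <= J eta.
  move=> te; have tb := TB _ te; have n0 := distff_ge0 eta.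
  have : 0 <= (M + dist eta eta - 2 * T eta).
    rewrite subr_ge0; have : (2 * T eta) ^+ 2 <= (M + dist eta eta) ^+ 2.
      have s0 : 0 <= (M - dist eta eta) ^+ 2 by rewrite sqr_ge0.
      by move: tb s0; rewrite !expr2; nra.
    move=> sq; apply: (le_trans (ler_norm _)).
    rewrite -ler_sqr ?nnegrE ?addr_ge0 //.
    by rewrite -normrX ger0_norm ?sqr_ge0.
  by rewrite /J; lra.
pose E := [set J eta | eta in [set eta | test_function eta]].
have hE : has_inf E.
  split; first by exists (J (fun=> 0)), (fun=> 0) => //=; exact: test_0.
  by exists (- M) => _ [eta te <-]; exact: JM.
pose ep i := (h ^+ i) ^+ 3 / 4.
have e0 i : 0 < ep i by rewrite divr_gt0 // !exprn_gt0.
have /choice [u uP] i : exists eta, test_function eta /\ J eta <= inf E + ep i.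
  by have [_ [eta te <-] Je] := inf_adherent (e0 i) hE; exists eta; split=> //; exact: ltW.
have tu i : test_function (u i) by have [] := uP i.
have lu i : L2 (u i) by exact: test_L2.
have Jinf eta : test_function eta -> inf E <= J eta.
  by move=> te; apply: ge_inf; [case: hE|exists eta].
have epd i : ep i.+1 <= ep i.
  rewrite /ep ler_pM2r ?invr_gt0 // ler_pXn2r ?nnegrE ?exprn_ge0 //.
  by rewrite exprS ler_piMl ?exprn_ge0 // invf_le1 // ler1n.
have JD eta zeta c : test_function eta -> test_function zeta ->
    J (fun x => eta x + c * zeta x) =
    J eta + 2 * c * (dist eta zeta - T zeta) + c * c * dist zeta zeta.
  move=> te tz; rewrite /J TL // dist_expand; [ring|exact: test_L2|exact: test_L2].
have diffE eta zeta : (fun x => eta x - zeta x) = (fun x => eta x + (-1) * zeta x).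
  by apply/funext => x; rewrite mulN1r.
have ud i : dist (fun x => u i.+1 x - u i x) (fun x => u i.+1 x - u i x) <= (h ^+ i) ^+ 3.
  pose w x := u i.+1 x - u i x.
  have tw : test_function w by rewrite /w diffE; apply: test_add => //; exact: test_scale.
  have J1 : J (u i.+1) = J (fun x => u i x + 1 * w x).
    by congr J; apply/funext => x; rewrite /w mul1r addrC subrK.
  have := Jinf _ (test_add (tu i) (test_scale h tw)).
  have [_ a1] := uP i; have [_ a2] := uP i.+1; have a3 := epd i.
  rewrite J1 in a2; move: a2; rewrite !JD // -/w => a2 a4.
  have -> : (h ^+ i) ^+ 3 = 4 * ep i by rewrite /ep; field.
  by lra.
have [g [lg gu]] := riesz_fischer lu ud.
have lgu k : L2 (fun x => g x - u k x) by apply: L2D => //; exact: L2N.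
have epk k : ep k <= h ^+ k.
  rewrite /ep ler_pdivrMr // (_ : (_ ^+ 3) = h ^+ k * (h ^+ k) ^+ 2) ?exprS ?expr0 ?mulr1 //.
  rewrite ler_pM2l ?exprn_gt0 //.
  have h1 : h ^+ k <= 1 by rewrite exprn_ile1 // invf_le1 // ler1n.
  have h0 : 0 <= h ^+ k by rewrite exprn_ge0.
  by nra.
have gT zeta : test_function zeta -> dist g zeta = T zeta.
  move=> tz; have lz := test_L2 tz.
  have B1 k : (dist (u k) zeta - T zeta) * (dist (u k) zeta - T zeta) <= ep k * dist zeta zeta.
    apply: discriminant => [|c]; first exact: distff_ge0.
    have := Jinf _ (test_add (tu k) (test_scale c tz)).
    rewrite JD //; have [_] := uP k; lra.
  have B2 k : dist (fun x => g x - u k x) zeta * dist (fun x => g x - u k x) zeta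
      <= 8 * h ^+ k * dist zeta zeta.
    apply: (le_trans (dist_sqr (lgu k) lz)).
    by apply: ler_wpM2r; [exact: distff_ge0|exact: gu].
  have S : (dist g zeta - T zeta) * (dist g zeta - T zeta) <= 0.
    apply: (@small_le _ _ (18 * dist zeta zeta)) => k.
    have gE : dist g zeta = dist (fun x => g x - u k x) zeta + dist (u k) zeta.
      rewrite -distDl //; congr dist; by apply/funext => x; rewrite subrK.
    have := B1 k; have := B2 k; rewrite gE; have := epk k.
    have z0 := distff_ge0 zeta.
    set p := dist (fun _ => _) zeta; set q := dist (u k) zeta - T zeta => e1 e2 e3.
    have -> : p + dist (u k) zeta - T zeta = p + q by rewrite /q; ring.
    have e4 : ep k * dist zeta zeta <= h ^+ k * dist zeta zeta by rewrite ler_wpM2r.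
    have s0 : 0 <= (p - q) ^+ 2 by rewrite sqr_ge0.
    have -> : (p + q) * (p + q) = 2 * (p * p) + 2 * (q * q) - (p - q) ^+ 2 by ring.
    lra.
  apply/eqP; rewrite -subr_eq0; apply/eqP.
  have : (dist g zeta - T zeta) ^+ 2 = 0.
    by apply: le_anti; rewrite sqr_ge0 andbT expr2.
  by move/eqP; rewrite sqrf_eq0 => /eqP.
exists g; split=> //.
rewrite -subr_le0; apply: (@small_le _ _ 8) => k.
have := gu k; have := JM _ (tu k).
rewrite diffE dist_expand // (gT (u k)) // /J; lra.
Qed.

End representation.

(** * The resolvent equation as two first order equations *)

Section resolvent_equation.
Context {R : realType}.
Local Notation mu := (@lebesgue_measure R).
Implicit Types (f g u v : R -> R) (x y a b : R).

Lemma int_segments (D : set (measurableTypeR R)) (G : R -> R) (C : \bar R) :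
  measurable D -> measurable_fun setT G -> (forall x, 0 <= G x) ->
  (forall i : nat, (\int[mu]_(x in D `&` `[(- i%:R)%R, i%:R]%classic) (G x)%:E <= C)%E) ->
  (\int[mu]_(x in D) (G x)%:E <= C)%E.
Proof.
move=> mD mG G0 H.
pose F (i : nat) : set (measurableTypeR R) := D `&` `[(- i%:R)%R, i%:R]%classic.
have FD : \bigcup_i F i = D.
  apply/seteqP; split=> [x [i _ []]//|x Dx]; exists (Num.bound `|x|) => //; split=> //=.
  by rewrite in_itv /= -ler_norml; apply: ltW; exact: archi_boundP (normr_ge0 x).
have mF i : measurable (F i) by apply: measurableI => //; exact: measurable_itv.
have nF : nondecreasing_seq F.
  move=> i j ij; apply/subsetPset => x [Dx] /=; rewrite in_itv /= => /andP[x1 x2].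
  split=> //=; rewrite in_itv /=; have : i%:R <= j%:R :> R by rewrite ler_nat.
  by move=> ?; apply/andP; split; lra.
have mG' : measurable_fun setT (EFin \o G) by exact/measurable_EFinP.
have cv := @ge0_nondecreasing_set_cvg_integral _ _ R F (EFin \o G) mu nF mF
  (fun i => measurable_funTS mG') (fun i x _ => G0 x).
rewrite FD in cv.
by apply: (cvge_to_le cv); exact: nearW.
Qed.

Lemma Rintegral_onE (D : set (measurableTypeR R)) f : measurable D ->
  mu.-integrable D (EFin \o f) ->
  ((Rintegral mu D f)%:E = \int[mu]_(x in D) (f x)%:E)%E.
Proof. by move=> mD fi; rewrite /Rintegral fineK //; exact: integrable_fin_num. Qed.

Lemma integrable_onZ (D : set (measurableTypeR R)) c f : measurable D ->
  mu.-integrable D (EFin \o f) -> mu.-integrable D (EFin \o (fun x => c * f x)).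
Proof. by move=> mD fi; have := integrableZl mD c fi. Qed.

Lemma C1_derive1 u v : C1 u v -> (u^`())%classic = v.
Proof.
by move=> [du _]; apply/funext => x; rewrite derive1E (@derive_val _ _ _ _ _ _ _ (du x)).
Qed.

Lemma is_derive_exp (c x : R) : is_derive x (1 : R) (fun y => expR (c * y)) (c * expR (c * x)).
Proof.
have dl : is_derive x (1 : R) (fun y => c * y) c.
  by apply: (is_derive_eq (is_deriveZ c (is_derive_id x (1 : R)))); exact: mulr1.
apply: (is_derive_eq (@is_derive1_comp R expR (fun y => c * y) x _ _ (is_derive_expR _) dl)).
exact: mulrC.
Qed.

Lemma exp_continuous (c : R) : continuous (fun y => expR (c * y)).
Proof.
move=> x; apply: differentiable_continuous; apply/derivable1_diffP.
by have [] := is_derive_exp c x.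
Qed.

Lemma exp_ray (c u : R) : 0 < c ->
  (\int[mu]_(y in `]-oo, u]) (expR (c * y))%:E <= (c^-1 * expR (c * u))%:E)%E.
Proof.
move=> c0; apply: int_segments => //.
  by apply: continuous_measurable_fun; exact: exp_continuous.
move=> i; pose N := i%:R + `|u| + 1 : R.
have N0 : - N < u.
  have := ler_norm (- u); rewrite normrN /N; have : 0 <= i%:R :> R by []. lra.
have cE : C1 (fun y => c^-1 * expR (c * y)) (fun y => expR (c * y)).
  split; last exact: exp_continuous.
  move=> x; apply: (is_derive_eq (is_deriveZ c^-1 (is_derive_exp c x))).
  by rewrite /GRing.scale /= mulKf // gt_eqF.
apply: (@le_trans _ _ (\int[mu]_(y in `[(- N)%R, u]) (expR (c * y))%:E)%E); last first.
  by rewrite (FTC_segment cE N0) -EFinB lee_fin gerBl mulr_ge0 ?expR_ge0 // invr_ge0 ltW.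
apply: ge0_subset_integral => //.
- by apply: measurableI => //; exact: measurable_itv.
- apply: measurable_funTS; apply/measurable_EFinP.
  by apply: continuous_measurable_fun; exact: exp_continuous.
- move=> x [] /=; rewrite !in_itv /= => xu /andP[xi _]; rewrite xu andbT.
  apply: le_trans xi; rewrite lerN2 /N; have := normr_ge0 u; lra.
Qed.

(** The solution is [c exp(- c x)] times the integral of [exp(c y) f(y)] over the
    half line of the [y <= x]. *)
Lemma ode_bounded f c : 0 < c -> continuous f -> (exists B, forall x, `|f x| <= B) ->
  exists h, C1 h (fun x => c * (f x - h x)) /\ exists B, forall x, `|h x| <= B.
Proof.
move=> c0 cf [B fB].
have B0 : 0 <= B by apply: le_trans (fB 0).
pose E y := expR (c * y).
have cE : continuous E by exact: exp_continuous.
have mE : measurable_fun setT E by exact: continuous_measurable_fun.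
have mf : measurable_fun setT f by exact: continuous_measurable_fun.
have iE (z : R) : mu.-integrable `]-oo, z] (EFin \o E).
  apply/integrableP; split; first by apply: measurable_funTS; exact/measurable_EFinP.
  apply: (@le_lt_trans _ _ (c^-1 * expR (c * z))%:E); last exact: ltry.
  apply: le_trans (exp_ray z c0); rewrite le_eqVlt; apply/orP; left; apply/eqP.
  by apply: eq_integral => x _ /=; rewrite ger0_norm // expR_ge0.
have iEB (z : R) : mu.-integrable `]-oo, z] (EFin \o (fun y => B * E y)).
  by apply: integrable_onZ => //; exact: measurable_itv.
have ig (z : R) : mu.-integrable `]-oo, z] (EFin \o (fun y => E y * f y)).
  apply: (@le_integrable _ _ R mu _ (measurable_itv _) _ (EFin \o (fun y => B * E y))) => //.
    by apply: measurable_funTS; apply/measurable_EFinP; exact: measurable_funM.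
  move=> y _ /=; rewrite lee_fin normrM mulrC [leRHS]normrM ler_wpM2r //.
  by rewrite (ger0_norm B0).
pose F x := Rintegral mu `]-oo, x] (fun y => E y * f y).
have dF x : is_derive x (1 : R) F (E x * f x).
  have xu : x < x + 1 by rewrite ltrDl.
  have cg : {for x, continuous (fun y => E y * f y)} by apply: cvgM; [exact: cE|exact: cf].
  have [|d1 d2] := @continuous_FTC1 R (fun y => E y * f y) -oo%O x _ xu (ig _) _ cg.
    by rewrite ltNyr.
  by apply: DeriveDef; [exact: d1|rewrite -derive1E; exact: d2].
pose h x := c * expR (- c * x) * F x.
have EE x : expR (- c * x) * E x = 1.
  by rewrite /E mulNr expRN mulVf // gt_eqF // expR_gt0.
have dh x : is_derive x (1 : R) h (c * (f x - h x)).
  apply: (is_derive_eq (is_deriveM (is_deriveZ c (is_derive_exp (- c) x)) (dF x))).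
  rewrite /GRing.scale /= /h.
  transitivity (c * (expR (- c * x) * E x * f x - c * expR (- c * x) * F x)); last by rewrite EE mul1r.
  rewrite (_ : c *: expR (- c * x) = c * expR (- c * x)) //; ring.
exists h; split.
  split=> // x; apply: cvgMr; apply: cvgB; first exact: cf.
  by apply: differentiable_continuous; apply/derivable1_diffP; case: (dh x).
exists B => x.
have FB : `|F x| <= B * (c^-1 * E x).
  rewrite /F; apply: (le_trans (le_normr_Rintegral _ (ig x))) => //.
  rewrite -lee_fin Rintegral_onE //; last first.
    by have := integrable_norm (ig x).
  apply: (@le_trans _ _ (\int[mu]_(y in `]-oo, x]) (B%:E * (E y)%:E))%E).
    apply: ge0_le_integral => //.
    - apply: measurable_funTS; apply/measurable_EFinP; apply: measurableT_comp => //.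
      exact: measurable_funM.
    - by apply: measurable_funTS; apply/measurable_EFinP; exact: measurable_funM.
    - move=> y _; rewrite -EFinM lee_fin normrM mulrC (ger0_norm (expR_ge0 _)).
      by rewrite ler_wpM2r ?expR_ge0.
  rewrite ge0_integralZl //; last 2 first.
  - by apply: measurable_funTS; exact/measurable_EFinP.
  - by move=> y _; rewrite lee_fin expR_ge0.
  by rewrite EFinM; apply: lee_wpmul2l => //; exact: exp_ray.
rewrite /h !normrM (gtr0_norm c0) (ger0_norm (expR_ge0 _)).
apply: (@le_trans _ _ (c * expR (- c * x) * (B * (c^-1 * E x)))).
  by rewrite ler_wpM2l // mulr_ge0 ?expR_ge0 // ltW.
have -> : c * expR (- c * x) * (B * (c^-1 * E x)) = (c * c^-1) * B * (expR (- c * x) * E x) by ring.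
by rewrite EE mulr1 divff ?mul1r // gt_eqF.
Qed.

(** Multiplying the equation by [h] bounds the square integral of [h] over every
    segment, uniformly since the boundary terms are bounded. *)
Lemma ode_L2 f h c B : c != 0 -> continuous f -> C1 h (fun x => c * (f x - h x)) ->
  (forall x, `|h x| <= B) -> L2 f -> L2 h.
Proof.
move=> c0 cf ch hB lf.
have hc := C1_continuous ch.
have mh : measurable_fun setT h by exact: continuous_measurable_fun.
pose u x := c^-1 * (h x * h x).
pose u' x := 2 * (h x * f x - h x * h x).
have cu : C1 u u'.
  have [dm cm] := C1M ch ch; split=> x.
    apply: (is_derive_eq (is_deriveZ c^-1 (dm x))).
    by rewrite /GRing.scale /= /u'; field.
  by apply: cvgMr; apply: cvgB; apply: cvgM; (exact: hc || exact: cf).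
pose K := dist f f + 2 * `|c^-1| * B ^+ 2.
have seg a b : a < b -> (\int[mu]_(x in `[a, b]) (h x * h x)%:E <= K%:E)%E.
  move=> ab.
  have ff : mu.-integrable `[a, b] (EFin \o (fun x => f x * f x)).
    by apply: integrableS (L2_sqr lf).
  have iu' : mu.-integrable `[a, b] (EFin \o u').
    apply: continuous_compact_integrable; first exact: segment_compact.
    by apply: continuous_subspaceT; case: cu.
  apply: (@le_trans _ _ (\int[mu]_(x in `[a, b]) ((f x * f x)%:E - (u' x)%:E))%E).
    apply: ge0_le_integral => //.
    - by move=> x _; rewrite lee_fin -expr2 sqr_ge0.
    - by apply: measurable_funTS; apply/measurable_EFinP; exact: measurable_funM.
    - by have := @integrableB _ _ R mu _ (measurable_itv _) _ _ ff iu'; move=> /integrableP[].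
    - move=> x _; rewrite -EFinB lee_fin /u' -subr_ge0.
      by rewrite (_ : _ - _ = (f x - h x) ^+ 2) ?sqr_ge0 //; ring.
  rewrite integralB //= (FTC_segment cu ab).
  have -> : K%:E = ((dist f f)%:E - (- (2 * `|c^-1| * B ^+ 2))%:E)%E by rewrite -EFinB opprK.
  apply: leeB.
    rewrite -RintegralE; last exact: L2_sqr.
    apply: ge0_subset_integral => //.
      by apply/measurable_EFinP; apply: measurable_funM; exact: L2_meas.
    by move=> x _; rewrite lee_fin -expr2 sqr_ge0.
  rewrite -EFinB lee_fin.
  have ub x : `|u x| <= `|c^-1| * B ^+ 2.
    by rewrite /u normrM ler_wpM2l // normrM expr2; apply: ler_pM.
  by have := ub a; have := ub b; rewrite !ler_norml => /andP[? ?] /andP[? ?]; lra.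
have I : (\int[mu]_x (h x * h x)%:E <= K%:E)%E.
  apply: int_segments => //.
  - exact: measurable_funM.
  - by move=> x; rewrite -expr2 sqr_ge0.
  move=> i; have ab : - i.+1%:R < i.+1%:R :> R.
    have : 0 < i.+1%:R :> R by rewrite ltr0n.
    move: (i.+1%:R : R) => q; lra.
  apply: le_trans (seg _ _ ab); apply: ge0_subset_integral => //.
  - by apply: measurableI => //; exact: measurable_itv.
  - by apply: measurable_funTS; apply/measurable_EFinP; exact: measurable_funM.
  - by move=> x _; rewrite lee_fin -expr2 sqr_ge0.
  - move=> x [_] /=; rewrite !in_itv /= => /andP[x1 x2].
    have : i%:R <= i.+1%:R :> R by rewrite ler_nat.
    by move=> ?; apply/andP; split; lra.
apply: L2P => //; apply/integrableP; split.
  by apply/measurable_EFinP; exact: measurable_funM.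
apply: (le_lt_trans _ (ltry _)); apply: le_trans I.
rewrite le_eqVlt; apply/orP; left; apply/eqP; apply: eq_integral => x _ /=.
by rewrite ger0_norm // -expr2 sqr_ge0.
Qed.

End resolvent_equation.

(** * The space of smooth functions with square integrable derivatives *)

Section smooth_square_integrable.
Context {R : realType}.
Local Notation mu := (@lebesgue_measure R).
Implicit Types (f g u v : R -> R) (x y a b : R).

Definition Hinf f := smooth f /\ forall n, L2 (f^`(n))%classic.

Lemma Hinf_coind (P : (R -> R) -> Prop) :
  (forall f, P f -> [/\ forall x, derivable f x 1, L2 f & P (f^`())%classic]) ->
  forall f, P f -> Hinf f.
Proof.
move=> H f Pf; split; first by apply: (smooth_coind (P := P)) => // g /H[].
move=> n; have : P (f^`(n))%classic.
  by elim: n => // n IH; rewrite derive1nS; case: (H _ IH).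
by move=> /H[].
Qed.

Lemma Hinf_derive f : Hinf f -> Hinf (f^`())%classic.
Proof.
move=> [sf lf]; split; first exact: smooth_derive.
by move=> n; have := lf n.+1; rewrite derive1Sn.
Qed.

Lemma Hinf_L2 f : Hinf f -> L2 f. Proof. by move=> [_ /(_ 0%N)]. Qed.

Lemma Hinf_C1 f : Hinf f -> C1 f (f^`())%classic.
Proof. by move=> [sf _]; exact: smooth_C1. Qed.

Lemma Hinf_continuous f : Hinf f -> continuous f.
Proof. by move=> /Hinf_C1/C1_continuous. Qed.

Lemma derive1_add f g : Hinf f -> Hinf g ->
  ((fun x => f x + g x)^`())%classic = (fun x => (f^`())%classic x + (g^`())%classic x).
Proof.
move=> [sf _] [sg _]; apply/funext => x.
rewrite derive1E deriveD; [|exact: smooth_derivable|exact: smooth_derivable].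
by rewrite -!derive1E.
Qed.

Lemma derive1_scale c f : Hinf f ->
  ((fun x => c * f x)^`())%classic = (fun x => c * (f^`())%classic x).
Proof.
move=> [sf _]; apply/funext => x; have [df _] := smooth_C1 sf.
by rewrite derive1E (@derive_val _ _ _ _ _ _ _ (is_deriveZ c (df x))).
Qed.

Lemma Hinf_add f g : Hinf f -> Hinf g -> Hinf (fun x => f x + g x).
Proof.
move=> hf hg.
apply: (@Hinf_coind (fun h => exists u v, [/\ Hinf u, Hinf v & h = (fun x => u x + v x)])).
  move=> _ [u [v [hu hv ->]]]; split.
  - by move=> x; apply: derivableD; apply: smooth_derivable; [case: hu|case: hv].
  - by apply: L2D; exact: Hinf_L2.
  - by exists (u^`())%classic, (v^`())%classic; split; [exact: Hinf_derive|exact: Hinf_derive|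
      exact: derive1_add].
by exists f, g.
Qed.

Lemma Hinf_scale c f : Hinf f -> Hinf (fun x => c * f x).
Proof.
move=> hf.
apply: (@Hinf_coind (fun h => exists u, Hinf u /\ h = (fun x => c * u x))).
  move=> _ [u [hu ->]]; split.
  - by move=> x; apply: derivableZ; apply: smooth_derivable; case: hu.
  - by apply: L2Z; exact: Hinf_L2.
  - by exists (u^`())%classic; split; [exact: Hinf_derive|exact: derive1_scale].
by exists f.
Qed.

Lemma test_Hinf eta : test_function eta -> Hinf eta.
Proof. by move=> te; split=> [|n]; [exact: test_smooth|apply: test_L2; exact: test_deriven]. Qed.

Lemma Hinf_bounded f : Hinf f -> exists B, forall x, `|f x| <= B.
Proof.
move=> hf; have hf' := Hinf_derive hf.
pose A := 2 / 1 * dist f f + 1 * dist (f^`())%classic (f^`())%classic.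
have d0 := distff_ge0 f; have d1 := distff_ge0 (f^`())%classic.
exists (A + 1) => x.
have := @agmon R f _ 1 x ltr01 (Hinf_C1 hf) (Hinf_L2 hf) (Hinf_L2 hf').
rewrite -/A => H.
have A0 : 0 <= A by rewrite /A; lra.
have : `|f x| * `|f x| <= A by rewrite -normrM ger0_norm // -expr2 sqr_ge0.
have := normr_ge0 (f x); move: `|f x| => q q0 qA; nra.
Qed.

Lemma Hinf_parts f g : Hinf f -> Hinf g ->
  dist (f^`())%classic g = - dist f (g^`())%classic.
Proof.
move=> hf hg; have hf' := Hinf_derive hf; have hg' := Hinf_derive hg.
have i1 := L2_mul (Hinf_L2 hf) (Hinf_L2 hg').
have i2 := L2_mul (Hinf_L2 hf') (Hinf_L2 hg).
have Z := int_deriv (C1M (Hinf_C1 hf) (Hinf_C1 hg)) (L2_mul (Hinf_L2 hf) (Hinf_L2 hg))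
  (integrableRD i1 i2).
by apply/eqP; rewrite -addr_eq0 addrC /dist -RintegralD // Z.
Qed.

Lemma Hinf_definite f : Hinf f -> dist f f = 0 -> f = fun=> 0.
Proof.
move=> hf f0; apply/funext => x; have hf' := Hinf_derive hf.
pose A := dist (f^`())%classic (f^`())%classic.
have A0 : 0 <= A by exact: distff_ge0.
have H a : 0 < a -> f x * f x <= a * A.
  move=> a0; have := @agmon R f _ a x a0 (Hinf_C1 hf) (Hinf_L2 hf) (Hinf_L2 hf').
  by rewrite f0 mulr0 add0r.
apply/eqP; rewrite -sqrf_eq0 expr2 eq_le -expr2 sqr_ge0 andbT leNgt; apply/negP => p.
have A1 : 0 < A + 1 by rewrite ltr_wpDl.
have := H (f x ^+ 2 / (2 * (A + 1))).
have A2 : 0 < 2 * (A + 1) by rewrite mulr_gt0.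
rewrite divr_gt0 // => /(_ isT).
by rewrite mulrAC (ler_pdivlMr _ _ A2) -expr2; nra.
Qed.

(** The derivative of [h] solves the same equation, with [f'] instead of [f]. *)
Lemma Hinf_ode c f h B : c != 0 -> Hinf f -> C1 h (fun x => c * (f x - h x)) ->
  (forall x, `|h x| <= B) -> Hinf h.
Proof.
move=> c0 hf ch hB.
apply: (@Hinf_coind (fun h => exists f B, [/\ Hinf f, C1 h (fun x => c * (f x - h x)) &
  forall x, `|h x| <= B])); last by exists f, B.
move=> {f h B hf ch hB} h [f [B [hf ch hB]]].
have cf := Hinf_C1 hf; have hf' := Hinf_derive hf.
have E := C1_derive1 ch; split.
- by move=> x; case: ch => /(_ x)[].
- exact: (ode_L2 c0 (Hinf_continuous hf) ch hB (Hinf_L2 hf)).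
have [A fA] := Hinf_bounded hf.
exists (f^`())%classic, (`|c| * (A + B)); split=> // [|x]; rewrite E; last first.
  rewrite normrM ler_wpM2l //; apply: (le_trans (ler_normB _ _)).
  by apply: lerD.
have [dh ch'] := ch; have [df cf'] := cf; split=> [x|x].
  by apply: (is_derive_eq (is_deriveZ c (is_deriveB (df x) (dh x)))).
apply: cvgMr; apply: cvgB; first exact: cf'.
exact: ch'.
Qed.

(** The operator factorizes as [(1 + tau D) (1 - tau D)]. The second factor
    becomes the first one when the line is reversed. *)
Lemma Hinf_res tau f : 0 < tau -> Hinf f -> exists g, Hinf g /\
  f = (fun x => g x - tau ^+ 2 * (g^`())%classic^`()%classic x).
Proof.
move=> t0 hf; pose c := tau^-1; have c0 : 0 < c by rewrite invr_gt0.
have [h [ch [A hA]]] := ode_bounded c0 (Hinf_continuous hf) (Hinf_bounded hf).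
have hh : Hinf h by apply: (Hinf_ode _ hf ch hA); rewrite gt_eqF.
have hc := Hinf_continuous hh.
have opp_c (u : R -> R) : continuous u -> continuous (fun x => u (- x)).
  move=> cu x; apply: (@continuous_comp _ _ _ (fun x : R => - x) u); first exact: opp_continuous.
  exact: cu.
have [|k [ck [B kB]]] := @ode_bounded R (fun x => h (- x)) c c0 (opp_c _ hc).
  by exists A => x.
pose g x := k (- x).
have dg x : is_derive x (1 : R) g (- c * (h x - g x)).
  have dl : is_derive x (1 : R) (fun y : R => - y) (- 1) by apply: is_deriveN.
  have [dk _] := ck.
  apply: (is_derive_eq (@is_derive1_comp R k (fun y => - y) x _ _ (dk (- x)) dl)).
  by rewrite opprK /g; ring.
have cg : C1 g (fun x => - c * (h x - g x)).
  split=> // x; apply: cvgMr; apply: cvgB; first exact: hc.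
  by apply: differentiable_continuous; apply/derivable1_diffP; case: (dg x).
have nc : - c != 0 by rewrite oppr_eq0 gt_eqF.
have hg : Hinf g by apply: (Hinf_ode nc hh cg) => x; exact: kB.
exists g; split=> //; apply/funext => x.
have E1 := C1_derive1 cg; have E2 := C1_derive1 ch.
rewrite E1.
have -> : (fun x => - c * (h x - g x)) = (fun x => - c * (h x + -1 * g x)).
  by apply/funext => y; rewrite mulN1r.
rewrite derive1_scale; last by apply: Hinf_add => //; exact: Hinf_scale.
rewrite derive1_add ?derive1_scale //; last exact: Hinf_scale.
by rewrite E1 E2 /c; field; rewrite gt_eqF.
Qed.

End smooth_square_integrable.

Section smooth_space.
Context {R : realType}.

Record hinf := HinfFun { hfun :> R -> R; hfunP : Hinf hfun }.

Lemma hinf_eq (f g : hinf) : (forall x, f x = g x) -> f = g.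
Proof.
case: f g => [f fP] [g gP] /= fg; have E : f = g by apply/funext.
by case: _ / E gP => gP; congr HinfFun; exact: Prop_irrelevance.
Qed.

HB.instance Definition _ := gen_eqMixin hinf.
HB.instance Definition _ := gen_choiceMixin hinf.

Definition hinf0 := HinfFun (test_Hinf test_0).
Definition hinfN (f : hinf) := HinfFun (Hinf_scale (-1) (hfunP f)).
Definition hinfD (f g : hinf) := HinfFun (Hinf_add (hfunP f) (hfunP g)).
Definition hinfZ (a : R) (f : hinf) := HinfFun (Hinf_scale a (hfunP f)).

Lemma hinfDA : associative hinfD.
Proof. by move=> f g h; apply: hinf_eq => x /=; rewrite addrA. Qed.
Lemma hinfDC : commutative hinfD.
Proof. by move=> f g; apply: hinf_eq => x /=; rewrite addrC. Qed.
Lemma hinfD0 : left_id hinf0 hinfD.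
Proof. by move=> f; apply: hinf_eq => x /=; rewrite add0r. Qed.
Lemma hinfDN : left_inverse hinf0 hinfN hinfD.
Proof. by move=> f; apply: hinf_eq => x /=; rewrite mulN1r addNr. Qed.

HB.instance Definition _ := GRing.isZmodule.Build hinf hinfDA hinfDC hinfD0 hinfDN.

Lemma hinfZA (a b : R) (f : hinf) : hinfZ a (hinfZ b f) = hinfZ (a * b) f.
Proof. by apply: hinf_eq => x /=; rewrite mulrA. Qed.
Lemma hinfZ1 : left_id 1 hinfZ.
Proof. by move=> f; apply: hinf_eq => x /=; rewrite mul1r. Qed.
Lemma hinfZDr : right_distributive hinfZ +%R.
Proof. by move=> a f g; apply: hinf_eq => x /=; rewrite mulrDr. Qed.
Lemma hinfZDl (f : hinf) : {morph hinfZ^~ f : a b / a + b}.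
Proof. by move=> a b; apply: hinf_eq => x /=; rewrite mulrDl. Qed.

HB.instance Definition _ :=
  GRing.Zmodule_isLmodule.Build R hinf hinfZA hinfZ1 hinfZDr hinfZDl.

Definition hder (f : hinf) : hinf := HinfFun (Hinf_derive (hfunP f)).

Lemma hder_linear : linear hder.
Proof.
move=> a f g; apply: hinf_eq => x /=.
rewrite derive1_add; [|exact: Hinf_scale (hfunP f)|exact: hfunP].
by rewrite derive1_scale //; exact: hfunP.
Qed.

HB.instance Definition _ := GRing.isLinear.Build R hinf hinf _ hder hder_linear.

Definition hdot (f g : hinf) : R := dist f g.

Lemma hdotDl f g h : hdot (f + g) h = hdot f h + hdot g h.
Proof. by apply: distDl; apply: Hinf_L2; exact: hfunP. Qed.

Lemma hdotZl a f g : hdot (a *: f) g = a * hdot f g.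
Proof. by apply: distZl; apply: Hinf_L2; exact: hfunP. Qed.

Lemma hdot_eq0 f : hdot f f = 0 -> f = 0.
Proof. by move=> f0; apply: hinf_eq => x; rewrite (Hinf_definite (hfunP f) f0). Qed.

Lemma hder_parts f g : hdot (hder f) g = - hdot f (hder g).
Proof. by apply: Hinf_parts; exact: hfunP. Qed.

Lemma hres_ex tau f : 0 < tau -> exists g : hinf, g - tau ^+ 2 *: hder (hder g) = f.
Proof.
move=> t0; have [g [hg E]] := Hinf_res t0 (hfunP f).
by exists (HinfFun hg); apply: hinf_eq => x /=; rewrite E mulN1r.
Qed.

Definition Xinf : skewSpace R := @SkewSpace R hinf hdot hder (fun f g => distC f g)
  hdotDl hdotZl (fun f => distff_ge0 f) hdot_eq0 hder_parts hres_ex.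

End smooth_space.

(** * Mollification of weak evolution equations *)

Section mollified_curves.
Context {R : realType}.
Local Notation mu := (@lebesgue_measure R).
Local Notation X := (@Xinf R).
Implicit Types (f g u v eta zeta xi rho : R -> R) (x y a b t : R).

Lemma conv_Hinf f rho : L2 f -> test_function rho -> Hinf (conv f rho).
Proof.
move=> lf tr; split=> [|n]; first exact: conv_smooth.
by rewrite conv_deriven //; apply: (conv_L2 lf _).1; exact: test_deriven.
Qed.

(** The mollification of [f], as a point of the space of smooth functions. The
    junk value [0] makes it a total function of the time, since nothing is
    assumed of a solution for negative times. *)
Definition cv rho f : X :=
  match pselect (L2 f /\ test_function rho) with
  | left H => HinfFun (conv_Hinf H.1 H.2)
  | right _ => 0
  end.

Lemma cvE rho f : L2 f -> test_function rho -> hfun (cv rho f) = conv f rho.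
Proof. by move=> lf tr; rewrite /cv; case: pselect => // -[]. Qed.

Lemma X_eq (c d : X) : (forall x, hfun c x = hfun d x) -> c = d.
Proof. exact: hinf_eq. Qed.

Lemma cvD rho f g : L2 f -> L2 g -> test_function rho ->
  cv rho (fun x => f x + g x) = cv rho f + cv rho g.
Proof.
move=> lf lg tr; apply: X_eq => x; have lfg := L2D lf lg.
rewrite cvE //= -[RHS]/(hfun (cv rho f) x + hfun (cv rho g) x) !cvE //.
exact: convDl.
Qed.

Lemma cvZ rho c f : L2 f -> test_function rho -> cv rho (fun x => c * f x) = c *: cv rho f.
Proof.
move=> lf tr; apply: X_eq => x; have lcf := L2Z c lf.
rewrite cvE //= -[RHS]/(c * hfun (cv rho f) x) cvE //.
exact: convZl.
Qed.

Lemma cv_der rho f : L2 f -> test_function rho ->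
  der (cv rho f) = cv (rho^`())%classic f.
Proof.
move=> lf tr; apply: X_eq => x; have tr' := test_derive tr.
rewrite cvE //= -[LHS]/((hfun (cv rho f))^`()%classic x) cvE //.
by rewrite conv_derive.
Qed.

Lemma cv_bound rho f : L2 f -> test_function rho ->
  nn (cv rho f) <= mass rho * mass (mirror rho) * dist f f.
Proof.
move=> lf tr; rewrite -[nn _]/(dist (hfun (cv rho f)) (hfun (cv rho f))) cvE //.
exact: (conv_L2 lf tr).2.
Qed.

Lemma shift_derive rho x : test_function rho ->
  ((fun y => rho (x - y))^`())%classic = (fun y => - (rho^`())%classic (x - y)).
Proof.
move=> tr; have [dr _] := smooth_C1 (test_smooth tr); apply/funext => y.
have ds : is_derive y (1 : R) (fun y => x - y) (- 1).
  apply: (is_derive_eq (is_deriveD (is_derive_cst x y 1) (is_deriveN (is_derive_id y (1 : R))))).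
  exact: add0r.
rewrite derive1E (@derive_val _ _ _ _ _ _ _ (@is_derive1_comp R rho (fun y => x - y) y _ _ (dr _) ds)).
exact: mulrN1.
Qed.

Lemma conv_derivel xi rho : test_function xi -> test_function rho ->
  ((conv xi rho)^`())%classic = conv (xi^`())%classic rho.
Proof.
move=> tx tr; rewrite conv_derive //; last exact: test_L2.
apply/funext => x; rewrite /conv.
have ts := test_shift x tr.
rewrite (Hinf_parts (test_Hinf tx) (test_Hinf ts)) shift_derive //.
have -> : (fun y => - (rho^`())%classic (x - y)) = (fun y => -1 * (rho^`())%classic (x - y)).
  by apply/funext => y; rewrite mulN1r.
rewrite distZr; [by rewrite mulN1r opprK|by apply: test_L2; exact: test_shift (test_derive tr)|exact: test_L2].
Qed.

Definition L2curve (F : R -> R -> R) :=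
  (forall t, 0 <= t -> L2 (F t)) /\
  forall t0, 0 <= t0 ->
    dist (fun x => F t x - F t0 x) (fun x => F t x - F t0 x)
      @[t --> within `[0, +oo[ (nbhs t0)] --> (0 : R).

(** The functionals [T t] on test functions are those given by a continuous
    curve of square integrable functions and their derivatives; the mollified
    curve is [G rho]. *)
Definition realized (T : R -> (R -> R) -> R) (G : (R -> R) -> R -> X) :=
  [/\ forall t rho xi, 0 <= t -> test_function rho -> test_function xi ->
        dist (hfun (G rho t)) xi = T t (conv xi (mirror rho)),
      forall t rho, 0 <= t -> test_function rho -> der (G rho t) = G (rho^`())%classic t &
      forall rho t0, test_function rho -> 0 <= t0 ->
        nn (G rho t - G rho t0) @[t --> within `[0, +oo[ (nbhs t0)] --> (0 : R)].

Lemma near_ge0 t0 : \forall t \near within `[0, +oo[ (nbhs t0), 0 <= t.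
Proof.
by rewrite near_withinE; apply: nearW => t /=; rewrite in_itv /= andbT.
Qed.

Lemma nn_squeeze (F : set_system R) {FF : Filter F} (c : R -> X) (d : R -> R) (K : R) :
  (\forall t \near F, nn (c t) <= K * d t) -> d t @[t --> F] --> (0 : R) ->
  nn (c t) @[t --> F] --> (0 : R).
Proof.
move=> H cd; apply: (@squeeze_cvgr _ _ _ _ (fun=> 0) (fun t => K * d t)).
- by apply: filterS H => t ->; rewrite nn_ge0.
- exact: cvg_cst.
- have h : K * d t @[t --> F] --> K * 0 by exact: cvgMr.
  by rewrite mulr0 in h.
Qed.

Lemma hfun_L2 (c : X) : L2 (hfun c).
Proof. exact: Hinf_L2 (hfunP c). Qed.

Lemma realized_dist (f : R -> R -> R) : L2curve f ->
  realized (fun t => dist (f t)) (fun rho t => cv rho (f t)).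
Proof.
move=> [lf cf]; split=> [t rho xi t0 tr tx|t rho t0 tr|rho t0 tr t00].
- by rewrite cvE ?conv_adjoint //; exact: lf.
- by rewrite cv_der //; exact: lf.
- apply: (nn_squeeze (K := mass rho * mass (mirror rho))) (cf _ t00).
  apply: filterS (near_ge0 t0) => t t1.
  have lN := L2Z (-1) (lf _ t00).
  have -> : (fun x => f t x - f t0 x) = (fun x => f t x + -1 * f t0 x).
    by apply/funext => x; rewrite mulN1r.
  have -> : cv rho (f t) - cv rho (f t0) = cv rho (fun x => f t x + -1 * f t0 x).
    by rewrite cvD ?cvZ ?scaleN1r //; exact: lf.
  by apply: cv_bound => //; apply: L2D => //; exact: lf.
Qed.

Lemma realized_ext T T' G : (forall t eta, 0 <= t -> test_function eta -> T t eta = T' t eta) ->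
  realized T G -> realized T' G.
Proof.
move=> E [a b c]; split=> // t rho xi t0 tr tx; rewrite a // E //.
by apply: conv_test => //; exact: mirror_test.
Qed.

Lemma realized_add T T' G G' : realized T G -> realized T' G' ->
  realized (fun t => T t + T' t) (fun rho t => G rho t + G' rho t).
Proof.
move=> [a b c] [a' b' c']; split=> [t rho xi t0 tr tx|t rho t0 tr|rho t0 tr t00].
- rewrite -[RHS]/(T t _ + T' t _) -a // -a' //.
  by rewrite -distDl //; [exact: hfun_L2|exact: hfun_L2|exact: test_L2].
- by rewrite derD b // b'.
- have h : 2 * nn (G rho t - G rho t0) + 2 * nn (G' rho t - G' rho t0)
      @[t --> within `[0, +oo[ (nbhs t0)] --> 2 * (0 : R) + 2 * 0.
    by apply: cvgD; apply: cvgMr; [exact: c|exact: c'].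
  rewrite mulr0 addr0 in h.
  apply: (nn_squeeze (K := 1)) h; apply: nearW => t.
  by rewrite mul1r opprD addrACA; exact: nnD.
Qed.

Lemma realized_scale k T G : realized T G ->
  realized (fun t => k *: T t) (fun rho t => k *: G rho t).
Proof.
move=> [a b c]; split=> [t rho xi t0 tr tx|t rho t0 tr|rho t0 tr t00].
- rewrite -[RHS]/(k * T t _) -a //.
  by rewrite -distZl //; [exact: hfun_L2|exact: test_L2].
- by rewrite derZ b.
- apply: (nn_squeeze (K := k ^+ 2)) (c _ _ tr t00); apply: nearW => t.
  by rewrite -scalerBr nnZ.
Qed.

Lemma realized_opp T G : realized T G ->
  realized (fun t => - T t) (fun rho t => - G rho t).
Proof.
move=> /(realized_scale (-1)).
have -> : (fun rho t => -1 *: G rho t) = (fun rho t => - G rho t).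
  by apply/funext => rho; apply/funext => t; rewrite scaleN1r.
apply: realized_ext => t eta _ _.
by rewrite -[LHS]/(-1 * T t eta) mulN1r.
Qed.

Lemma realized_ddx T G : realized T G ->
  realized (fun t => ddx (T t)) (fun rho t => der (G rho t)).
Proof.
move=> [a b c]; split=> [t rho xi t0 tr tx|t rho t0 tr|rho t0 tr t00].
- have tx' := test_derive tx.
  rewrite /ddx conv_derivel //; last exact: mirror_test.
  rewrite -a //.
  have -> : hfun (@der R X (G rho t)) = ((hfun (G rho t))^`())%classic by [].
  by rewrite Hinf_parts //; [exact: hfunP|exact: test_Hinf].
- by rewrite !b //; exact: test_derive.
- have tr' := test_derive tr.
  apply: (nn_squeeze (K := 1)) (c _ _ tr' t00).
  by apply: filterS (near_ge0 t0) => t t1; rewrite mul1r !b.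
Qed.

Lemma realized_iter T G j t rho : realized T G -> 0 <= t -> test_function rho ->
  iter j der (G rho t) = G (rho^`(j))%classic t.
Proof.
move=> [a b c] t0 tr; elim: j => // j IH.
by rewrite iterS IH derive1nS b //; exact: test_deriven.
Qed.

Lemma iter_derB j (c d : X) : iter j der (c - d) = iter j der c - iter j der d.
Proof. by rewrite iter_derD -scaleN1r iter_derZ scaleN1r. Qed.

Lemma realized_Xcvg T G rho t0 : realized T G -> test_function rho -> 0 <= t0 ->
  Xcvg (within `[0, +oo[ (nbhs t0)) (G rho) (G rho t0).
Proof.
move=> rG tr t00 j; have [a b c] := rG.
have tj := test_deriven j tr.
apply: (nn_squeeze (K := 1)) (c _ _ tj t00).
by apply: filterS (near_ge0 t0) => t t1; rewrite mul1r iter_derB !(realized_iter j rG).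
Qed.

(** Testing against [w chi], with [chi] a cutoff, recovers the norm of [w]. *)
Lemma nn_by_tests (w : X) (e : R) :
  (forall xi, test_function xi -> dist (hfun w) xi * dist (hfun w) xi <= e * dist xi xi) ->
  0 <= e -> nn w <= (bump (0 : R))^-1 * e.
Proof.
move=> H e0; have lw := hfun_L2 w; have hw := hfunP w.
have K0 : 0 <= (bump (0 : R))^-1 by rewrite invr_ge0 bump_ge0.
have cw := int_cutoff (L2_sqr lw).
apply: (cvgr_to_le cw); apply: nearW => n.
have tc := cutoff_test (R := R) n.
have txi : test_function (fun x => hfun w x * cutoff n x).
  by apply: test_mul => //; case: hw.
set A := Rintegral _ _ _.
have EA : dist (hfun w) (fun x => hfun w x * cutoff n x) = A.
  by apply: eq_Rintegral => x _; rewrite mulrA.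
have iA : integrableR (fun x => hfun w x * hfun w x * cutoff n x).
  have := L2_mul lw (test_L2 txi); congr integrableR.
  by apply/funext => x; rewrite mulrA.
have A0 : 0 <= A.
  by apply: Rintegral_ge0 => x _; rewrite mulr_ge0 ?cutoff_ge0 // -expr2 sqr_ge0.
have B : dist (fun x => hfun w x * cutoff n x) (fun x => hfun w x * cutoff n x) <=
    (bump (0 : R))^-1 * A.
  rewrite /A -RintegralZl //; apply: le_Rintegral => //.
  - by apply: L2_mul; exact: test_L2.
  - exact: integrableRZ.
  - move=> x _; have -> : hfun w x * cutoff n x * (hfun w x * cutoff n x) =
      cutoff n x * (hfun w x * hfun w x * cutoff n x) by ring.
    rewrite ler_wpM2r ?cutoff_le // mulr_ge0 ?cutoff_ge0 // -expr2 sqr_ge0 //.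
have := H _ txi; rewrite EA => HA.
have [A1|] := ltP 0 A; last by move=> /le_trans; apply; rewrite mulr_ge0.
rewrite -(ler_pM2r A1); apply: (le_trans HA).
by rewrite [_^-1 * e]mulrC -mulrA ler_wpM2l.
Qed.

(** A weak derivative in time becomes a strong one after mollification. By the
    mean value theorem the difference quotient of the mollified curve, paired
    with a test function, is the pairing of [G rho s] for some [s] close to [t];
    since [G rho] is continuous it is close to that of [G rho t], uniformly in
    the test function. Derivatives in space only change the kernel [rho]. *)
Lemma curve_weak TF GF T G rho : realized TF GF -> realized T G ->
  (forall eta, test_function eta -> forall t, 0 < t ->
     is_derive t 1 (fun s => TF s eta) (T t eta)) ->
  test_function rho -> curve (GF rho) (G rho).
Proof.
move=> rF rG dF tr; split=> [t t0|t t0 j]; first exact: (realized_Xcvg rF).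
have tj := test_deriven j tr; have t00 := ltW t0.
have [aF bF cF] := rF; have [aG bG cG] := rG.
set sig := (rho^`(j))%classic in tj *.
pose K := (bump (0 : R))^-1; have K0 : 0 < K by rewrite invr_gt0 bump0_gt0.
have key e : 0 < e -> \forall h \near (0 : R)^',
    nn (iter j der (h^-1 *: (GF rho (h + t) - GF rho t) - G rho t)) <= K * e.
  move=> e0.
  have : \forall s \near nbhs t, nn (G sig s - G sig t) <= e /\ 0 < s.
    have cG' : nn (G sig s - G sig t) @[s --> nbhs t] --> (0 : R).
      move=> P PP; have W := cG sig t tj t00 P PP.
      have D0 : \forall s \near nbhs t, 0 < s by near=> s; near: s; exact: lt_nbhsr.
      apply: filterS2 D0 W => s s0; apply.
      by rewrite /= in_itv /= andbT ltW.
    have D0 : \forall s \near nbhs t, 0 < s by near=> s; near: s; exact: lt_nbhsr.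
    have D1 : \forall s \near nbhs t, nn (G sig s - G sig t) <= e.
      have := @cvgr_le R R (nbhs t) _ _ 0 cG' e; apply; exact: e0.
    by apply: filterS2 D0 D1.
  move=> [d d0 dP].
  exists d => // h /=; rewrite sub0r normrN => hd h0.
  have ball s : `|t - s| <= `|h| -> nn (G sig s - G sig t) <= e /\ 0 < s.
    by move=> sh; apply: dP => /=; apply: le_lt_trans hd.
  have ht0 : 0 <= h + t.
    apply: ltW; apply: (ball (h + t) _).2.
    by rewrite opprD addrCA subrr addr0 normrN.
  have -> : iter j der (h^-1 *: (GF rho (h + t) - GF rho t) - G rho t) =
      h^-1 *: (GF sig (h + t) - GF sig t) - G sig t.
    by rewrite iter_derB iter_derZ iter_derB !(realized_iter j rF) // (realized_iter j rG).
  apply: nn_by_tests (ltW e0) => xi tx.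
  set w := (_ - _ : X).
  pose zeta := conv xi (mirror sig).
  have tz : test_function zeta by apply: conv_test => //; exact: mirror_test.
  have lx := test_L2 tx.
  have distB (c d' : X) : dist (hfun (c - d')) xi = dist (hfun c) xi - dist (hfun d') xi.
    rewrite -scaleN1r -[hfun _]/(fun x => hfun c x + -1 * hfun d' x).
    by rewrite distDl ?distZl ?mulN1r //; [exact: hfun_L2|exact: hfun_L2|apply: L2Z; exact: hfun_L2].
  have distS k (c : X) : dist (hfun (k *: c)) xi = k * dist (hfun c) xi.
    by rewrite -distZl //; exact: hfun_L2.
  have mvt a b : a < b -> (forall s, a <= s <= b -> 0 < s) -> exists2 s, a <= s <= b &
      TF b zeta - TF a zeta = T s zeta * (b - a).
    move=> ab pos.
    have dd s : s \in `]a, b[ -> is_derive s 1 (fun s => TF s zeta) (T s zeta).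
      by rewrite in_itv /= => /andP[s1 s2]; apply: dF => //; apply: pos; rewrite !ltW.
    have [|s si E] := @MVT R (fun s => TF s zeta) (fun s => T s zeta) a b ab dd.
      apply: derivable_within_continuous => s; rewrite in_itv /= => sab.
      by have [] := dF zeta tz s (pos s sab).
    by exists s => //; move: si; rewrite in_itv /= => /andP[s1 s2]; rewrite !ltW.
  have [s sb E] : exists2 s, `|t - s| <= `|h| & h^-1 * (TF (h + t) zeta - TF t zeta) = T s zeta.
    have [hn|hp|hz] := ltgtP h 0; last by rewrite hz eqxx in h0.
    - have ab : h + t < t by rewrite gtrDr.
      have [|s /andP[s1 s2] E] := mvt _ _ ab.
        move=> s /andP[s1 s2]; apply: (ball s _).2.
        by rewrite (ltr0_norm hn) ger0_norm; lra.
      exists s; first by rewrite (ltr0_norm hn) ger0_norm; lra.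
      rewrite -opprB E; field; rewrite lt_eqF //.
    - have ab : t < h + t by rewrite ltrDr.
      have [|s /andP[s1 s2] E] := mvt _ _ ab.
        by move=> s /andP[s1 s2]; apply: lt_le_trans s1.
      exists s; first by rewrite (gtr0_norm hp) ler0_norm; lra.
      rewrite E; field; rewrite gt_eqF //.
  have [ns s0] := ball s sb.
  have -> : dist (hfun w) xi = dist (hfun (G sig s - G sig t)) xi.
    by rewrite /w !distB distS distB !aF // !aG // ?ltW // -/zeta E.
  apply: (le_trans (dist_sqr (hfun_L2 _) lx)).
  by rewrite ler_wpM2r //; exact: distff_ge0.
apply/cvgr0Pnorm_le => e e0.
have := key (K^-1 * e) (mulr_gt0 _ e0); rewrite invr_gt0 => /(_ K0).
apply: filterS => h; rewrite mulrA mulfV ?gt_eqF // mul1r.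
by rewrite ger0_norm // nn_ge0.
Unshelve. all: by end_near. Qed.

End mollified_curves.

(** * Locally integrable functions and vector valued norms *)

Section locally_integrable_functions.
Context {R : realType}.
Local Notation mu := (@lebesgue_measure R).
Implicit Types (f g eta : R -> R) (x y t : R).

Lemma locL1_test f eta : locL1 f -> test_function eta -> integrableR (fun x => f x * eta x).
Proof.
move=> [mf _ If] te; have [M [_ eM]] := test_supp te; have [B [B0 eB]] := test_bounded te.
have mfe : measurable_fun setT (fun x => f x * eta x).
  by apply: measurable_funM => //; exact: test_meas.
have fE : (fun x => f x * eta x) = (fun x => f x * eta x) \_ `[- M, M].
  apply/funext => x; rewrite patchE; case: ifPn => // /negP xM.
  rewrite eM ?mulr0 // ltNge ler_norml; apply/negP => xM'; apply: xM.
  by rewrite inE/= in_itv.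
rewrite /integrableR fE (_ : EFin \o _ = (EFin \o (fun x => f x * eta x)) \_ `[- M, M]); last first.
  by apply/funext => x; rewrite /= !patchE; case: ifP.
refine (proj1 (@integrable_mkcond _ _ R mu _ (EFin \o (fun x => f x * eta x)) _) _).
  exact: measurable_itv.
have iB : mu.-integrable `[- M, M] (EFin \o (fun x => B * f x)).
  apply: integrable_onZ; first exact: measurable_itv.
  apply/integrableP; split; first by apply: measurable_funTS; exact/measurable_EFinP.
  by apply: If => //; exact: segment_compact.
apply: (@le_integrable _ _ R mu _ (measurable_itv _) _ _ _ _ iB).
  by apply: measurable_funTS; exact/measurable_EFinP.
move=> x _ /=; rewrite lee_fin !normrM mulrC ler_wpM2r //.
by apply: (le_trans (eB x)); exact: ler_norm.
Qed.

Lemma dist_addl f g eta : locL1 f -> locL1 g -> test_function eta ->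
  dist (fun x => f x + g x) eta = dist f eta + dist g eta.
Proof.
move=> lf lg te; rewrite /dist -RintegralD //; try exact: locL1_test.
by apply: eq_Rintegral => x _; rewrite mulrDl.
Qed.

Lemma locL1Z c f : locL1 f -> locL1 (fun x => c * f x).
Proof.
move=> [mf o If]; split=> //; first exact: measurable_funM.
move=> K _ cK; have mK : measurable K by exact: compact_measurable.
have fi : mu.-integrable K (EFin \o f).
  apply/integrableP; split; first by apply: measurable_funTS; exact/measurable_EFinP.
  exact: If.
by have /integrableP[] := integrable_onZ c mK fi.
Qed.

Lemma dist_scalel c f eta : locL1 f -> test_function eta ->
  dist (fun x => c * f x) eta = c * dist f eta.
Proof.
move=> lf te; rewrite /dist -RintegralZl //; last exact: locL1_test.
by apply: eq_Rintegral => x _; rewrite mulrA.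
Qed.

Lemma locL1D f g : locL1 f -> locL1 g -> locL1 (fun x => f x + g x).
Proof.
move=> [mf o If] [mg _ Ig]; split=> //; first exact: measurable_funD.
move=> K _ cK; have mK : measurable K by exact: compact_measurable.
have fi : mu.-integrable K (EFin \o f).
  apply/integrableP; split; first by apply: measurable_funTS; exact/measurable_EFinP.
  exact: If.
have gi : mu.-integrable K (EFin \o g).
  apply/integrableP; split; first by apply: measurable_funTS; exact/measurable_EFinP.
  exact: Ig.
by have /integrableP[] := @integrableD _ _ R mu _ mK _ _ fi gi.
Qed.

End locally_integrable_functions.

Section norms_of_vector_functions.
Context {R : realType} {m : nat}.
Local Notation mu := (@lebesgue_measure R).
Implicit Types (V W : R -> 'rV[R]_m).

Lemma Rintegral_sum (I : Type) (s : seq I) (f : I -> R -> R) : (forall i, integrableR (f i)) ->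
  integrableR (fun x => \sum_(i <- s) f i x) /\
  Rintegral mu setT (fun x => \sum_(i <- s) f i x) = \sum_(i <- s) Rintegral mu setT (f i).
Proof.
move=> fi; elim: s => [|i s [IH1 IH2]].
  under eq_fun do rewrite big_nil; rewrite big_nil; split; first exact: integrable0.
  by rewrite /Rintegral integral0.
have -> : (fun x => \sum_(j <- i :: s) f j x) = (fun x => f i x + \sum_(j <- s) f j x).
  by apply/funext => x; rewrite big_cons.
rewrite big_cons; split; first exact: integrableRD.
by rewrite -IH2 -RintegralD //; exact: fi.
Qed.

Definition sqnorm V : R := \sum_(j < m) dist (entry V j) (entry V j).

Lemma sqnorm_ge0 V : 0 <= sqnorm V.
Proof. by apply: sumr_ge0 => j _; exact: distff_ge0. Qed.

Lemma L2normE V : in_L2 V -> L2norm V = (Num.sqrt (sqnorm V))%:E.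
Proof.
move=> lV; have [si sE] := @Rintegral_sum _ (index_enum 'I_m)
  (fun j x => entry V j x * entry V j x) (fun j => L2_sqr (lV j)).
rewrite /L2norm unlock /= -powR12_sqrt ?sqnorm_ge0 // -poweR_EFin; congr (_ `^ _)%E.
rewrite /sqnorm /dist -sE -RintegralE //; apply: eq_integral => x _.
rewrite /= powR_mulrn ?normr_ge0 //; congr EFin.
rewrite ger0_norm ?sqrtr_ge0 // sqr_sqrtr; first by apply: eq_bigr => j _; rewrite expr2.
by apply: sumr_ge0 => j _; exact: sqr_ge0.
Qed.

Lemma L1norm_ge V (j : 'I_m) : in_L2 V -> in_L1 V ->
  ((Rintegral mu setT (fun x => `|entry V j x|))%:E <= L1norm V)%E.
Proof.
move=> l2 lV; have mV i : measurable_fun setT (entry V i) by exact: L2_meas (l2 i).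
have ij : integrableR (fun x => `|entry V j x|).
  by apply: integrable_norm; apply/Lfun1_integrable; exact: lV.
rewrite -RintegralE // /L1norm Lnorm1; apply: ge0_le_integral => //.
- by case/integrableP: ij.
- apply/measurable_EFinP; apply: measurableT_comp => //.
  apply: (@measurableT_comp _ _ _ _ _ _ (@Num.sqrt R)).
    by apply: continuous_measurable_fun; exact: sqrt_continuous.
  apply: measurable_sum => i; apply: measurable_funX.
  exact: mV.
- move=> x _; rewrite lee_fin ger0_norm ?sqrtr_ge0 // -sqrtr_sqr; apply: ler_wsqrtr.
  rewrite (bigD1 j) //= lerDl; apply: sumr_ge0 => i _; exact: sqr_ge0.
Qed.

Lemma L2curve_entry (V : R -> R -> 'rV[R]_m) (j : 'I_m) : L2_continuous V ->
  L2curve (fun t => entry (V t) j).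
Proof.
move=> [lV cV]; split=> [t t0|t0 t00]; first exact: lV.
have cv := cV t0 t00.
have ll t : 0 <= t -> in_L2 (fun x => V t x - V t0 x).
  move=> t1 i; have := L2D (lV t t1 i) (L2N (lV t0 t00 i)); congr L2.
  by apply/funext => x; rewrite /entry !mxE.
have cs : (Num.sqrt (sqnorm (fun x => V t x - V t0 x)))%:E
    @[t --> within `[0, +oo[ (nbhs t0)] --> (0%:E : \bar R).
  apply: cvg_trans cv; apply: near_eq_cvg.
  apply: filterS (near_ge0 t0) => t t1; rewrite L2normE //; exact: ll.
have {}cs : Num.sqrt (sqnorm (fun x => V t x - V t0 x))
    @[t --> within `[0, +oo[ (nbhs t0)] --> (0 : R) by exact: (fine_cvg cs).
have c2 : Num.sqrt (sqnorm (fun x => V t x - V t0 x)) * Num.sqrt (sqnorm (fun x => V t x - V t0 x))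
    @[t --> within `[0, +oo[ (nbhs t0)] --> (0 * 0 : R) by exact: cvgM.
rewrite mul0r in c2.
apply: squeeze_cvgr c2; last exact: cvg_cst.
apply: nearW => t; rewrite distff_ge0 /= -expr2 sqr_sqrtr ?sqnorm_ge0 //.
rewrite /sqnorm (bigD1 j) //= (_ : (fun x => _) = entry (fun x => V t x - V t0 x) j); last first.
  by apply/funext => x; rewrite /entry !mxE.
by rewrite lerDl; apply: sumr_ge0 => i _; exact: distff_ge0.
Qed.

End norms_of_vector_functions.

Section L2_curves.
Context {R : realType}.

Lemma L2curve_scale c (F : R -> R -> R) : L2curve F -> L2curve (fun t x => c * F t x).
Proof.
move=> [lF cF]; split=> [t t0|t0 t00]; first exact: L2Z (lF t t0).
have h : c * c * dist (fun x => F t x - F t0 x) (fun x => F t x - F t0 x)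
    @[t --> within `[0, +oo[ (nbhs t0)] --> (c * c * 0 : R) by apply: cvgMr; exact: cF.
rewrite mulr0 in h; apply: cvg_trans h; apply: near_eq_cvg.
apply: filterS (near_ge0 t0) => t t1.
have l : L2 (fun x => F t x - F t0 x) by apply: L2D; [exact: lF|apply: L2N; exact: lF].
have -> : (fun x => c * F t x - c * F t0 x) = (fun x => c * (F t x - F t0 x)).
  by apply/funext => x; rewrite mulrBr.
by rewrite distZl ?distZr ?mulrA //; exact: L2Z.
Qed.

Lemma L2curve_0 : L2curve (fun _ _ => 0 : R).
Proof.
split=> [t _|t0 _]; first exact: L2_0.
have -> : (fun t : R => dist (fun _ : R => 0 - 0 : R) (fun _ => 0 - 0)) = (fun=> 0).
  apply/funext => t; rewrite /dist /Rintegral; under eq_integral do rewrite subr0 mul0r.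
  by rewrite integral0.
exact: cvg_cst.
Qed.

Lemma L2curve_unscale c (F : R -> R -> R) : 0 < c ->
  L2curve (fun t x => Num.sqrt c * F t x) -> L2curve F.
Proof.
move=> c0 /(L2curve_scale (Num.sqrt c)^-1); congr L2curve.
by apply/funext => t; apply/funext => x; rewrite mulrA mulVf ?mul1r // gt_eqF // sqrtr_gt0.
Qed.

End L2_curves.

(** * Mollified solutions are smooth solutions *)

Section mollified_solutions.
Context {R : realType}.
Local Notation X := (@Xinf R).
Implicit Types (eta rho : R -> R) (t : R).

Lemma wfun_dx (f : wfun R) t eta : is_wfun f -> 0 <= t -> test_function eta ->
  dist (dx f t) eta = - dist (f t) (eta^`())%classic.
Proof. by move=> [_ wf _] t0 te; rewrite -(wf t t0 eta te). Qed.

Lemma wfun_dt (f : wfun R) t eta : is_wfun f -> 0 < t -> test_function eta ->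
  is_derive t 1 (fun s => dist (f s) eta) (dist (dt f t) eta).
Proof. by move=> [_ _ wf] t0 te; case: (wf eta te) => _; exact. Qed.

Lemma near_gt0 t : 0 < t -> \forall s \near nbhs t, 0 < s.
Proof. by move=> t0; near=> s; near: s; exact: lt_nbhsr. Unshelve. all: by end_near. Qed.

Lemma is_derive_gt0 (f g : R -> R) t a : 0 < t -> (forall s, 0 <= s -> f s = g s) ->
  is_derive t 1 f a -> is_derive t 1 g a.
Proof.
move=> t0 E df; apply: (near_eq_is_derive _ df).
by apply: filterS (near_gt0 t0) => s s0; rewrite E // ltW.
Qed.

Lemma dx_evolution (f : wfun R) t eta : is_wfun f -> 0 < t -> test_function eta ->
  is_derive t 1 (fun s => dist (dx f s) eta) (ddx (dist (dt f t)) eta).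
Proof.
move=> wf t0 te; have d := wfun_dt wf t0 (test_derive te).
apply: (is_derive_gt0 t0 _ (is_deriveN d)) => s s0.
by rewrite (wfun_dx wf).
Qed.

Lemma shear_dist (phi psi omega : wfun R) l t eta :
  is_wfun phi -> is_wfun psi -> is_wfun omega -> 0 <= t -> test_function eta ->
  dist (shear l phi psi omega t) eta =
  dist (dx phi t) eta - dist (psi t) eta - l * dist (omega t) eta.
Proof.
move=> [lp _ _] [lq _ _] [lo _ _] t0 te.
have [_ _ h1] := lp t t0; have [h2 _ _] := lq t t0; have [h3 _ _] := lo t t0.
have -> : shear l phi psi omega t =
    (fun x => dx phi t x + (-1 * psi t x + - l * omega t x)).
  by apply/funext => x; rewrite /shear; ring.
rewrite dist_addl ?dist_addl ?dist_scalel //; [ring|exact: locL1Z|exact: locL1Z|].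
by apply: locL1D; exact: locL1Z.
Qed.

Lemma stretch_dist (phi omega : wfun R) l t eta :
  is_wfun phi -> is_wfun omega -> 0 <= t -> test_function eta ->
  dist (stretch l phi omega t) eta = dist (dx omega t) eta - l * dist (phi t) eta.
Proof.
move=> [lp _ _] [lo _ _] t0 te.
have [h1 _ _] := lp t t0; have [_ _ h3] := lo t t0.
have -> : stretch l phi omega t = (fun x => dx omega t x + - l * phi t x).
  by apply/funext => x; rewrite /stretch; ring.
by rewrite dist_addl ?dist_scalel //; [ring|exact: locL1Z].
Qed.

Section system.
Variables (p : coefs R) (phi psi omega : wfun R) (t1 t2 c1 c2 : R -> R -> R).
Local Notation S := (shear (ll p) phi psi omega).
Local Notation N := (stretch (ll p) phi omega).

Definition unknown (i : comp) : R -> R -> R :=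
  match i with
  | Cv => dt phi | Cu => dt psi | Cw => dt omega
  | Ct1 => t1 | Cc1 => c1 | Ct2 => t2 | Cc2 => c2
  | Cz => dx psi | CS => S | CN => N
  end.

Hypotheses (wphi : is_wfun phi) (wpsi : is_wfun psi) (womega : is_wfun omega).
Hypothesis cont : forall i, L2curve (unknown i).
Hypothesis ev_v : weak_evolution (fun t x => rho1 p * dt phi t x)
  (fun t => kk p *: ddx (dist (S t)) + (k0 p * ll p) *: dist (N t)
            - (ll p * ga p) *: dist (t1 t)).
Hypothesis ev_u : weak_evolution (fun t x => rho2 p * dt psi t x)
  (fun t => bb p *: ddx (ddx (dist (psi t))) + kk p *: dist (S t)
            - ga p *: ddx (dist (t2 t))).
Hypothesis ev_w : weak_evolution (fun t x => rho1 p * dt omega t x)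
  (fun t => k0 p *: ddx (dist (N t)) + (kk p * ll p) *: dist (S t)
            - ga p *: ddx (dist (t1 t))).
Hypothesis ev_t1 : forall eta, test_function eta -> forall t, 0 < t ->
  is_derive t 1 (fun s => dist (fun x => t1 s x + m1 p * N s x) eta)
    ((ka1 p *: ddx (dist (c1 t)) + al1 p *: ddx (ddx (dist (t1 t)))) eta).
Hypothesis ev_t2 : forall eta, test_function eta -> forall t, 0 < t ->
  is_derive t 1 (fun s => dist (fun x => t2 s x + m2 p * dx psi s x) eta)
    ((ka2 p *: ddx (dist (c2 t)) + al2 p *: ddx (ddx (dist (t2 t)))) eta).
Hypothesis ev_c1 : forall eta, test_function eta -> forall t, 0 < t ->
  is_derive t 1 (fun s => dist (c1 s) eta) ((ind (ka1 p) *: ddx (dist (t1 t))) eta).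
Hypothesis ev_c2 : forall eta, test_function eta -> forall t, 0 < t ->
  is_derive t 1 (fun s => dist (c2 s) eta) ((ind (ka2 p) *: ddx (dist (t2 t))) eta).

Definition mollified rho (t : R) : state X := fun i => cv rho (unknown i t).

Let rz i : realized (fun t => dist (unknown i t)) (fun rho t => cv rho (unknown i t)).
Proof. exact: realized_dist. Qed.

Let rzZ c i : realized (fun t => dist (fun x => c * unknown i t x))
  (fun rho t => c *: cv rho (unknown i t)).
Proof.
apply: realized_ext (realized_scale c (rz i)) => t eta t0 te.
have [li _] := cont i; rewrite distZl //; [exact: li|exact: test_L2].
Qed.

Let rzDZ c i j : realized (fun t => dist (fun x => unknown i t x + c * unknown j t x))
  (fun rho t => cv rho (unknown i t) + c *: cv rho (unknown j t)).
Proof.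
apply: realized_ext (realized_add (rz i) (realized_scale c (rz j))) => t eta t0 te.
have [li _] := cont i; have [lj _] := cont j; have le := test_L2 te.
by rewrite distDl ?distZl //; [exact: lj|exact: li|apply: L2Z; exact: lj].
Qed.

Lemma curve_N rho : test_function rho ->
  curve (fun t => cv rho (N t)) (fun t => der (cv rho (dt omega t)) - ll p *: cv rho (dt phi t)).
Proof.
move=> tr.
have rT := realized_add (realized_ddx (rz Cw)) (realized_opp (realized_scale (ll p) (rz Cv))).
have dN eta : test_function eta -> forall t, 0 < t -> is_derive t 1 (fun s => dist (N s) eta)
    ((ddx (dist (dt omega t)) - ll p *: dist (dt phi t)) eta).
  move=> te t t0.
  have d1 := dx_evolution womega t0 te; have d2 := wfun_dt wphi t0 te.
  apply: (is_derive_gt0 t0 _ (is_deriveB d1 (is_deriveZ (ll p) d2))) => s s0.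
  by rewrite stretch_dist.
have c := curve_weak (rz CN) rT dN tr.
exact: c.
Qed.

Lemma curve_z rho : test_function rho ->
  curve (fun t => cv rho (dx psi t)) (fun t => der (cv rho (dt psi t))).
Proof.
move=> tr.
have dz eta : test_function eta -> forall t, 0 < t -> is_derive t 1 (fun s => dist (dx psi s) eta)
    (ddx (dist (dt psi t)) eta).
  by move=> te t t0; exact: dx_evolution.
have c := curve_weak (rz Cz) (realized_ddx (rz Cu)) dz tr.
exact: c.
Qed.

(** The velocities follow from the equations of motion, the temperatures from the
    heat equations after subtraction of the evolution of the stretch or of the
    derivative of [psi], and the other unknowns from the compatibility of the
    weak derivatives in time and in space. *)
Lemma mollified_sol rho : test_function rho -> sol p (mollified rho).
Proof.
move=> tr i; rewrite /mollified.
have r1 := gt_eqF (rho1_gt0 p); have r2 := gt_eqF (rho2_gt0 p).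
case: i.
- have rT := realized_add (realized_add (realized_scale (kk p) (realized_ddx (rz CS)))
    (realized_scale (k0 p * ll p) (rz CN))) (realized_opp (realized_scale (ll p * ga p) (rz Ct1))).
  have := curveZ (rho1 p)^-1 (curve_weak (rzZ (rho1 p) Cv) rT (fun eta te => (ev_v te).2) tr).
  by congr (curve _ _); apply/funext => t; rewrite /= ?scalerA ?mulVf ?r1 ?scale1r.
- have rpsi : realized (fun t => ddx (ddx (dist (psi t)))) (fun rho t => der (cv rho (dx psi t)) : X).
    apply: realized_ext (realized_ddx (rz Cz)) => t eta t0 te.
    by rewrite /ddx (wfun_dx wpsi) //; exact: test_derive.
  have rT := realized_add (realized_add (realized_scale (bb p) rpsi) (realized_scale (kk p) (rz CS)))
    (realized_opp (realized_scale (ga p) (realized_ddx (rz Ct2)))).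
  have := curveZ (rho2 p)^-1 (curve_weak (rzZ (rho2 p) Cu) rT (fun eta te => (ev_u te).2) tr).
  by congr (curve _ _); apply/funext => t; rewrite /= ?scalerA ?mulVf ?r2 ?scale1r.
- have rT := realized_add (realized_add (realized_scale (k0 p) (realized_ddx (rz CN)))
    (realized_scale (kk p * ll p) (rz CS)))
    (realized_opp (realized_scale (ga p) (realized_ddx (rz Ct1)))).
  have := curveZ (rho1 p)^-1 (curve_weak (rzZ (rho1 p) Cw) rT (fun eta te => (ev_w te).2) tr).
  by congr (curve _ _); apply/funext => t; rewrite /= ?scalerA ?mulVf ?r1 ?scale1r.
- have rT := realized_add (realized_scale (ka1 p) (realized_ddx (rz Cc1)))
    (realized_scale (al1 p) (realized_ddx (realized_ddx (rz Ct1)))).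
  have := curveD (curve_weak (rzDZ (m1 p) Ct1 CN) rT ev_t1 tr)
    (curveZ (- m1 p) (curve_N tr)).
  by congr (curve _ _); apply/funext => t; rewrite /= scaleNr ?addrK.
- have c := curve_weak (rz Cc1) (realized_scale (ind (ka1 p)) (realized_ddx (rz Ct1))) ev_c1 tr.
  exact: c.
- have rT := realized_add (realized_scale (ka2 p) (realized_ddx (rz Cc2)))
    (realized_scale (al2 p) (realized_ddx (realized_ddx (rz Ct2)))).
  have := curveD (curve_weak (rzDZ (m2 p) Ct2 Cz) rT ev_t2 tr)
    (curveZ (- m2 p) (curve_z tr)).
  by congr (curve _ _); apply/funext => t; rewrite /= scaleNr ?addrK.
- have c := curve_weak (rz Cc2) (realized_scale (ind (ka2 p)) (realized_ddx (rz Ct2))) ev_c2 tr.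
  exact: c.
- exact: curve_z.
- have rT := realized_add (realized_add (realized_ddx (rz Cv)) (realized_opp (rz Cu)))
    (realized_opp (realized_scale (ll p) (rz Cw))).
  have dS eta : test_function eta -> forall t, 0 < t -> is_derive t 1 (fun s => dist (S s) eta)
      ((ddx (dist (dt phi t)) - dist (dt psi t) - ll p *: dist (dt omega t)) eta).
    move=> te t t0.
    have d1 := dx_evolution wphi t0 te; have d2 := wfun_dt wpsi t0 te.
    have d3 := wfun_dt womega t0 te.
    apply: (is_derive_gt0 t0 _ (is_deriveB (is_deriveB d1 d2) (is_deriveZ (ll p) d3))) => s s0.
    by rewrite shear_dist.
  have c := curve_weak (rz CS) rT dS tr.
  exact: c.
- exact: curve_N.
Qed.

End system.
End mollified_solutions.

(** * Passage to the limit *)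

Section weak_derivatives.
Context {R : realType}.
Local Notation mu := (@lebesgue_measure R).
Local Notation X := (@Xinf R).
Implicit Types (f g eta rho : R -> R) (t x : R).

Lemma iter_ddx n (T : (R -> R) -> R) eta :
  iter n ddx T eta = (-1) ^+ n * T (eta^`(n))%classic.
Proof.
elim: n eta => [|n IH] eta; first by rewrite mul1r.
by rewrite iterS /ddx IH -derive1Sn exprS; ring.
Qed.

Lemma Hinf_deriven n f : Hinf f -> Hinf (f^`(n))%classic.
Proof. by move=> hf; elim: n => // n; rewrite derive1nS; exact: Hinf_derive. Qed.

Lemma hfun_iter n (c : X) : hfun (iter n der c) = ((hfun c)^`(n))%classic.
Proof. by elim: n => // n IH; rewrite iterS derive1nS -IH. Qed.

Lemma parts_iter n f g : Hinf f -> Hinf g ->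
  dist (f^`(n))%classic g = (-1) ^+ n * dist f (g^`(n))%classic.
Proof.
move=> hf; elim: n g => [|n IH] g hg; first by rewrite mul1r.
rewrite derive1nS (Hinf_parts (Hinf_deriven n hf) hg) IH; last exact: Hinf_derive.
by rewrite -derive1Sn exprS; ring.
Qed.

Lemma shift_deriven n rho x : test_function rho ->
  ((fun y => rho (x - y))^`(n))%classic = (fun y => (-1) ^+ n * (rho^`(n))%classic (x - y)).
Proof.
move=> tr; elim: n => [|n IH]; first by apply/funext => y; rewrite mul1r.
have tn := test_deriven n tr.
rewrite derive1nS IH derive1_scale; last exact: test_Hinf (test_shift x tn).
by rewrite shift_derive //; apply/funext => y; rewrite derive1nS exprS; ring.
Qed.

Lemma cv_weak_derivative n f g rho : L2 f -> L2 g -> test_function rho ->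
  weak_derivative n f g -> iter n der (cv rho f) = cv rho g.
Proof.
move=> lf lg tr wfg; apply: X_eq => x.
rewrite hfun_iter !cvE // conv_deriven // /conv.
have tn := test_shift x (test_deriven n tr).
have := wfg _ (test_shift x tr); rewrite iter_ddx shift_deriven // => <-.
rewrite distZr; [|exact: test_L2|by []].
by rewrite mulrA -exprD addnn -mul2n exprM sqrrN expr1n expr1n mul1r.
Qed.

Lemma weak_derivative_scale n c f g : L2 f -> L2 g -> weak_derivative n f g ->
  weak_derivative n (fun x => c * f x) (fun x => c * g x).
Proof.
move=> lf lg w eta te; have tn := test_deriven n te.
have := w eta te; rewrite !iter_ddx !distZl //; try exact: test_L2.
by move=> <-; ring.
Qed.

(** By Agmon's inequality [`|res tau c|] is at most the square root of
    [2 / tau] times the energy of the resolvent, which is itself the pairing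
    of [c] and [res tau c]. *)
Lemma res_L1 tau (c : X) : 0 < tau -> integrableR (hfun c) ->
  nn (res tau c) <= 2 / tau * (Rintegral mu setT (fun x => `|hfun c x|)) ^+ 2.
Proof.
move=> t0 ic; set g := res tau c; set m := Rintegral _ _ _.
have m0 : 0 <= m by exact: Rintegral_ge0.
have t1 : 0 < 2 / tau by rewrite divr_gt0.
have hg := hfunP g.
pose E := nn g + tau ^+ 2 * nn (der g).
have n0 := nn_ge0 g; have n1 := nn_ge0 (der g).
have E0 : 0 <= E by rewrite addr_ge0 // mulr_ge0 // sqr_ge0.
have gB x : `|hfun g x| <= Num.sqrt (2 / tau * E).
  rewrite -sqrtr_sqr; apply: ler_wsqrtr; rewrite expr2.
  apply: (le_trans (agmon x t0 (Hinf_C1 hg) (Hinf_L2 hg) (Hinf_L2 (Hinf_derive hg)))).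
  rewrite -[dist (hfun g) (hfun g)]/(nn g).
  have -> : dist ((hfun g)^`())%classic ((hfun g)^`())%classic = nn (der g) by [].
  have -> : 2 / tau * E = 2 / tau * nn g + 2 * (tau * nn (der g)).
    by rewrite /E; field; rewrite gt_eqF.
  have h : 0 <= tau * nn (der g) by rewrite mulr_ge0 // ltW.
  by rewrite lerD2l; move: h; lra.
have EB : E <= Num.sqrt (2 / tau * E) * m.
  have EE : E = dist (hfun c) (hfun g) by rewrite /E (res_energy c t0).
  rewrite {1}EE.
  have i1 := L2_mul (hfun_L2 c) (hfun_L2 g).
  rewrite /m -RintegralZl //; last exact: integrable_norm.
  apply: le_Rintegral => //.
    by apply: integrableRZ; exact: integrable_norm.
  move=> x _; apply: (le_trans (ler_norm _)); rewrite normrM mulrC.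
  by rewrite ler_wpM2r.
apply: (@le_trans _ _ E); first by rewrite lerDl mulr_ge0 // sqr_ge0.
have [E1|] := ltP 0 E; last by move=> /le_trans; apply; rewrite mulr_ge0 ?sqr_ge0 // ltW.
rewrite -(ler_pM2l E1).
apply: (@le_trans _ _ ((Num.sqrt (2 / tau * E) * m) ^+ 2)).
  by rewrite expr2; apply: ler_pM.
rewrite exprMn sqr_sqrtr; last by rewrite mulr_ge0 // ltW.
by rewrite le_eqVlt; apply/orP; left; apply/eqP; ring.
Qed.

End weak_derivatives.

Section passage_to_the_limit.
Context {R : realType}.
Local Notation mu := (@lebesgue_measure R).
Local Notation X := (@Xinf R).
Variables (p : coefs R) (U : comp -> R -> R -> R).
Hypothesis cont : forall i, L2curve (U i).
Hypothesis solU : forall rho, test_function rho -> sol p (fun t i => cv rho (U i t) : X).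
Hypothesis U1 : forall i, integrableR (U i 0).

Definition decays (n r : nat) (C : R) := forall V : R -> state X, sol p V ->
  forall t tau, 0 <= t -> 0 < tau -> tau ^+ 4 = 1 + t ->
  energy p (smap (iter n der) (V t)) <= C * ((tau ^+ n.*2)^-1 * energy p (smap (res tau) (V 0))
     + (tau ^+ r.*2)^-1 * energy p (smap (iter (n + r) der) (V 0))).

Let mass2 k : mass (@moll R k) * mass (mirror (@moll R k)) = 1.
Proof. by rewrite moll_mirror !moll_mass mulr1. Qed.

(** The derivative is represented by [riesz_test], from the functional that
    defines it: the functional is bounded because it is a limit of the pairings
    with the mollified solutions, whose norms are uniformly bounded by
    [smooth_decay]. The mollifiers have mass one, so that they do not increase
    the norms of the data. *)
Lemma weak_decay n r C (W : comp -> R -> R) (t tau : R) : 0 <= C -> decays n r C ->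
  (forall i, L2 (W i)) -> (forall i, weak_derivative (n + r) (U i 0) (W i)) ->
  0 <= t -> 0 < tau -> tau ^+ 4 = 1 + t ->
  forall i, 0 < wt p i -> exists f, [/\ L2 f, weak_derivative n (U i t) f &
    wt p i * dist f f <= C * ((tau ^+ n.*2)^-1 * (2 / tau *
        \sum_(j <- comps) wt p j * (Rintegral mu setT (fun x => `|U j 0 x|)) ^+ 2)
      + (tau ^+ r.*2)^-1 * \sum_(j <- comps) wt p j * dist (W j) (W j))].
Proof.
move=> C0 dec lW wW t0 tau0 tau4 i wi; set M := _ * (_ + _).
have [lU _] := cont i; have lUt := lU t t0.
have l0 j : L2 (U j 0) by have [l _] := cont j; exact: l.
have bound k : nn (iter n der (cv (moll k) (U i t) : X)) <= (wt p i)^-1 * M.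
  have tm := @moll_test R k.
  rewrite ler_pdivlMl //.
  apply: (le_trans (energy_comp p i (smap (iter n der) (fun j => cv (moll k) (U j t) : X)))).
  apply: (le_trans (dec _ (solU tm) t tau t0 tau0 tau4)).
  have pw j : 0 <= (tau ^+ j)^-1 by rewrite invr_ge0 exprn_ge0 // ltW.
  apply: (ler_wpM2l C0); apply: lerD; apply: (ler_wpM2l (pw _)).
    rewrite /energy mulr_sumr; apply: ler_sum => j _; rewrite mulrCA ler_wpM2l ?wt_ge0 //.
    have [ci cb] := conv_int (U1 j) (l0 j) tm.
    rewrite moll_mass mul1r in cb.
    apply: (le_trans (res_L1 (c := cv (moll k) (U j 0)) tau0 _)); rewrite cvE //.
    apply: ler_wpM2l; first by rewrite divr_ge0 // ltW.
    by rewrite ler_sqr ?nnegrE //; exact: Rintegral_ge0.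
  rewrite /energy; apply: ler_sum => j _; rewrite ler_wpM2l ?wt_ge0 // /smap (cv_weak_derivative _ (lW j)) //.
  by apply: (le_trans (cv_bound (lW j) tm)); rewrite mass2 mul1r.
have K0 : 0 <= (wt p i)^-1 * M by apply: le_trans (bound 0%N); exact: nn_ge0.
have lin eta zeta c : test_function eta -> test_function zeta ->
    iter n ddx (dist (U i t)) (fun x => eta x + c * zeta x) =
    iter n ddx (dist (U i t)) eta + c * iter n ddx (dist (U i t)) zeta.
  move=> te tz; rewrite !iter_ddx.
  have -> j : ((fun x => eta x + c * zeta x)^`(j))%classic =
      (fun x => (eta^`(j))%classic x + c * (zeta^`(j))%classic x).
    elim: j => // j IH; rewrite !derive1nS IH.
    have he := Hinf_deriven j (test_Hinf te); have hz := Hinf_deriven j (test_Hinf tz).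
    by rewrite derive1_add ?derive1_scale //; exact: Hinf_scale.
  have ln := test_L2 (test_deriven n te); have lm := test_L2 (test_deriven n tz).
  rewrite distDr ?distZr //; [ring|exact: L2Z].
have bnd eta : test_function eta ->
    iter n ddx (dist (U i t)) eta * iter n ddx (dist (U i t)) eta <=
    (wt p i)^-1 * M * dist eta eta.
  move=> te; have tn := test_deriven n te.
  pose q k := dist (hfun (iter n der (cv (moll k) (U i t) : X))) eta.
  have c1 : q k @[k --> \oo] --> iter n ddx (dist (U i t)) eta.
    have -> : q = (fun k => (-1) ^+ n * dist (conv (U i t) (moll k)) (eta^`(n))%classic).
      apply/funext => k; have tm := @moll_test R k; rewrite /q hfun_iter cvE //.
      by rewrite parts_iter //; [exact: conv_Hinf|exact: test_Hinf].
    by rewrite iter_ddx; apply: cvgMr; exact: moll_cvg.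
  have c2 : q k * q k @[k --> \oo] -->
      iter n ddx (dist (U i t)) eta * iter n ddx (dist (U i t)) eta by exact: cvgM.
  apply: (cvgr_to_le c2); apply: nearW => k.
  apply: (le_trans (dist_sqr (hfun_L2 _) (test_L2 te))).
  by rewrite ler_wpM2r ?distff_ge0 //; exact: bound.
have [f [lf fM fT]] := riesz_test lin bnd K0.
exists f; split=> //; first by move=> eta te; rewrite fT.
by rewrite -ler_pdivlMl.
Qed.

End passage_to_the_limit.

(** * From components to vector solutions *)

Section uniform_constants.
Context {R : realType}.

Lemma uniform_decay (p : coefs R) s : exists K, 0 < K /\
  forall n r, (n + r <= s)%N -> forall K', K <= K' -> decays p n r K'.
Proof.
have /choice [C CP] n : exists c : nat -> R, forall r, 0 < c r /\ decays p n r (c r).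
  have /choice [c cP] r : exists c : R, 0 < c /\ decays p n r c.
    by have [c [c0 cP]] := @smooth_decay R (@Xinf R) p n r; exists c.
  by exists c.
have C0 n r : 0 <= C n r by rewrite ltW //; case: (CP n r).
exists (1 + \sum_(n < s.+1) \sum_(r < s.+1) C n r); split.
  by rewrite ltr_wpDr // sumr_ge0 // => n _; exact: sumr_ge0.
move=> n r nr K' KK' V sV t tau t0 tau0 tau4.
have [_ dec] := CP n r; apply: (le_trans (dec V sV t tau t0 tau0 tau4)).
apply: ler_wpM2r.
  by apply: addr_ge0; rewrite mulr_ge0 ?energy_ge0 // invr_ge0 exprn_ge0 // ltW.
apply: le_trans KK'; have ns : (n < s.+1)%N by lia.
have rs : (r < s.+1)%N by lia.
apply: (@le_trans _ _ (\sum_(k < s.+1) C (Ordinal ns) k)).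
  by rewrite (bigD1 (Ordinal rs)) //= lerDl sumr_ge0.
apply: (@le_trans _ _ (\sum_(m < s.+1) \sum_(k < s.+1) C m k)); last by rewrite lerDr.
rewrite [leRHS](bigD1 (Ordinal ns)) //= lerDl; apply: sumr_ge0 => m _; exact: sumr_ge0.
Qed.

End uniform_constants.

Section vector_solutions.
Context {R : realType}.
Local Notation mu := (@lebesgue_measure R).
Local Notation X := (@Xinf R).
Variables (p : coefs R) (U : comp -> R -> R -> R) (m : nat) (V : R -> R -> 'rV[R]_m).
Variable iota : 'I_m -> comp.
Hypothesis entries : forall j t x, V t x 0 j = Num.sqrt (wt p (iota j)) * U (iota j) t x.
Hypothesis wt_gt0 : forall j, 0 < wt p (iota j).
Hypothesis cover : forall i, (exists j, iota j = i) \/ U i = fun _ _ => 0.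
Hypothesis Vcont : L2_continuous V.

Let entryE j t : entry (V t) j = fun x => Num.sqrt (wt p (iota j)) * U (iota j) t x.
Proof. by apply/funext => x; rewrite /entry entries. Qed.

Lemma unknowns_continuous i : L2curve (U i).
Proof.
have [[j <-]|->] := cover i; last exact: L2curve_0.
apply: (L2curve_unscale (wt_gt0 j)).
by have := L2curve_entry j Vcont; congr L2curve; apply/funext => t; rewrite entryE.
Qed.

Hypothesis solU : forall rho, test_function rho -> sol p (fun t i => cv rho (U i t) : X).
Hypothesis V1 : in_L1 (V 0).
Hypothesis m10 : (m <= 10)%N.

Let unscale j t x : U (iota j) t x = (Num.sqrt (wt p (iota j)))^-1 * entry (V t) j x.
Proof. by rewrite entryE mulKf // gt_eqF // sqrtr_gt0. Qed.

Lemma unknowns_integrable i : integrableR (U i 0).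
Proof.
have [[j <-]|->] := cover i; last exact: integrable0.
have ie : integrableR (entry (V 0) j) by apply/Lfun1_integrable; exact: V1.
have := integrableRZ (Num.sqrt (wt p (iota j)))^-1 ie; congr integrableR.
by apply/funext => x; rewrite unscale.
Qed.

Lemma powers (t : R) n : 0 <= t -> let tau := (1 + t) `^ (1 / 4) in
  [/\ 0 < tau, tau ^+ 4 = 1 + t,
      ((1 + t) `^ (- (1 / 8) - n%:R / 4)) ^+ 2 = (tau ^+ n.*2)^-1 * tau^-1 &
      ((1 + t) `^ (- (n%:R / 4))) ^+ 2 = (tau ^+ n.*2)^-1].
Proof.
move=> t0 tau; have s0 : 0 < 1 + t by rewrite ltr_pwDl.
have tau0 : 0 < tau by exact: powR_gt0.
have tk k : tau ^+ k = (1 + t) `^ (1 / 4 * k%:R).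
  by rewrite -powR_mulrn ?ltW // -powRrM.
have dn : n.*2%:R = 2 * n%:R :> R by rewrite -mul2n natrM.
split=> //.
- by rewrite tk (_ : 1 / 4 * 4%:R = 1) ?powRr1 ?ltW //; field.
- rewrite -powR_mulrn ?powR_ge0 // -powRrM tk -!powRN -powRD; last first.
    by apply/implyP => _; rewrite gt_eqF.
  by congr powR; rewrite dn; field.
- rewrite -powR_mulrn ?powR_ge0 // -powRrM tk -!powRN.
  by congr powR; rewrite dn; field.
Qed.

(** The constant [15] leaves room for the sums over at most ten components: ten
    entries, each of them bounded by [20] and [10] times the two terms of the
    estimate, give [200] and [100], both smaller than [15^2]. *)
Lemma vector_decay s (K q : R) : 0 < K -> 4 <= q ->
  (forall n r, (n + r <= s)%N -> decays p n r K) ->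
  decay_estimates s (15 * Num.sqrt K) (15 * Num.sqrt K) q V.
Proof.
move=> K0 q4 dec n r nr dV0 [l0 w0] t t0.
have [tau0 tau4 pn _] := powers n t0; have [_ _ _ pr] := powers r t0.
set tau := (1 + t) `^ (1 / 4) in tau0 tau4 pn pr.
have lV0 : in_L2 (V 0) by case: Vcont => l _; exact: l.
have /choice [W WP] i : exists W, [/\ L2 W, weak_derivative (n + r) (U i 0) W &
    wt p i * dist W W <= sqnorm dV0].
  have [[j <-]|->] := cover i.
    exists (fun x => (Num.sqrt (wt p (iota j)))^-1 * entry dV0 j x).
    have le := l0 j; have w1 := wt_gt0 j; split; first exact: L2Z.
      have := weak_derivative_scale (Num.sqrt (wt p (iota j)))^-1 (lV0 j) le (w0 j).
      by congr weak_derivative; apply/funext => x; rewrite unscale.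
    rewrite distZl ?distZr //; last exact: L2Z.
    have cn : Num.sqrt (wt p (iota j)) != 0 by rewrite gt_eqF // sqrtr_gt0.
    rewrite -[X in X * _](sqr_sqrtr (ltW w1)) !mulrA expr2 mulfK // divff //.
    rewrite mul1r /sqnorm (bigD1 j) //= lerDl; apply: sumr_ge0 => k _; exact: distff_ge0.
  exists (fun=> 0); have z eta : dist (fun=> 0 : R) eta = 0.
    by rewrite /dist /Rintegral; under eq_integral do rewrite mul0r; rewrite integral0.
  split; [exact: L2_0| |by rewrite z mulr0 sqnorm_ge0].
  by move=> eta te; rewrite iter_ddx !z mulr0.
pose A := \sum_(j <- comps) wt p j * (Rintegral mu setT (fun x => `|U j 0 x|)) ^+ 2.
pose B := \sum_(j <- comps) wt p j * dist (W j) (W j).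
pose M := K * ((tau ^+ n.*2)^-1 * (2 / tau * A) + (tau ^+ r.*2)^-1 * B).
have /choice [f fP] j : exists f, [/\ L2 f, weak_derivative n (U (iota j) t) f &
    wt p (iota j) * dist f f <= M].
  apply: (weak_decay unknowns_continuous solU unknowns_integrable (ltW K0) (dec n r nr)
    (W := W)) => // [i|i]; by case: (WP i).
pose dV x : 'rV[R]_m := \row_j (Num.sqrt (wt p (iota j)) * f j x).
have dVE j : entry dV j = fun x => Num.sqrt (wt p (iota j)) * f j x.
  by apply/funext => x; rewrite /entry mxE.
have ldV : in_L2 dV.
  by move=> j; have [lf _ _] := fP j; rewrite dVE; exact: L2Z.
exists dV.
  split=> // j; rewrite dVE entryE; have [lf wf _] := fP j.
  have [lU _] := unknowns_continuous (iota j).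
  by apply: weak_derivative_scale => //; exact: lU.
rewrite L2normE // (L2normE l0).
set Q := Num.sqrt (sqnorm dV0); set Y1 := (15 * Num.sqrt K * _)%R; set Y2 := (15 * Num.sqrt K * _)%R.
have sK : 0 < Num.sqrt K by rewrite sqrtr_gt0.
have Y10 : 0 < Y1 by rewrite !mulr_gt0 // powR_gt0 // ltr_pwDl.
have Y20 : 0 < Y2 by rewrite !mulr_gt0 // powR_gt0 // ltr_pwDl.
have Q0 : 0 <= Q by exact: sqrtr_ge0.
have L0 : (0 <= L1norm (V 0))%E by exact: Lnorm_ge0.
have L1 j := L1norm_ge j lV0 V1.
case: (L1norm (V 0)) L0 L1 => [L|_ _|//]; last first.
  by rewrite gt0_muley ?lte_fin // addye ?leey // -EFinM.
rewrite lee_fin => L0 L1.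
rewrite -!EFinM -EFinD lee_fin.
have AL : A <= 10 * L ^+ 2.
  have term i : wt p i * Rintegral mu setT (fun x => `|U i 0 x|) ^+ 2 <= L ^+ 2.
    have [[j <-]|->] := cover i; last first.
      under eq_Rintegral do rewrite normr0.
      by rewrite /Rintegral integral0 expr0n mulr0 sqr_ge0.
    have := L1 j; rewrite lee_fin => Lj.
    have I0 : 0 <= Rintegral mu setT (fun x => `|U (iota j) 0 x|) by exact: Rintegral_ge0.
    have iU : integrableR (fun x => `|U (iota j) 0 x|).
      by apply: integrable_norm; exact: unknowns_integrable.
    rewrite -(sqr_sqrtr (ltW (wt_gt0 j))) -exprMn ler_sqr ?nnegrE ?mulr_ge0 ?sqrtr_ge0 //.
    rewrite -RintegralZl //; apply: le_trans Lj.
    rewrite le_eqVlt; apply/orP; left; apply/eqP; apply: eq_Rintegral => x _.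
    by rewrite entryE normrM (ger0_norm (sqrtr_ge0 _)).
  rewrite /A /comps !big_cons big_nil.
  have := (term Cv, term Cu, term Cw, term Ct1, term Cc1, term Ct2, term Cc2, term Cz, term CS, term CN).
  by move=> [[[[[[[[[h1 h2] h3] h4] h5] h6] h7] h8] h9] h10]; lra.
have BQ : B <= 10 * Q ^+ 2.
  have term i : wt p i * dist (W i) (W i) <= Q ^+ 2.
    by rewrite sqr_sqrtr ?sqnorm_ge0 //; case: (WP i).
  rewrite /B /comps !big_cons big_nil.
  have := (term Cv, term Cu, term Cw, term Ct1, term Cc1, term Ct2, term Cc2, term Cz, term CS, term CN).
  by move=> [[[[[[[[[h1 h2] h3] h4] h5] h6] h7] h8] h9] h10]; lra.
have M0 : 0 <= M.
  have tp k : 0 <= (tau ^+ k)^-1 by rewrite invr_ge0 exprn_ge0 // ltW.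
  rewrite /M mulr_ge0 ?addr_ge0 ?mulr_ge0 ?(ltW K0) ?tp ?invr_ge0 ?(ltW tau0) //.
    by apply: sumr_ge0 => i _; rewrite mulr_ge0 ?wt_ge0 // sqr_ge0.
  by apply: sumr_ge0 => i _; rewrite mulr_ge0 ?wt_ge0 // distff_ge0.
have SM : sqnorm dV <= 10 * M.
  apply: (@le_trans _ _ (\sum_(j < m) M)).
    apply: ler_sum => j _; have [lf _ fM] := fP j.
    rewrite dVE distZl ?distZr //; last exact: L2Z.
    by rewrite mulrA -expr2 sqr_sqrtr // ltW.
  have -> : \sum_(j < m) M = m%:R * M by rewrite sumr_const card_ord mulr_natl.
  apply: (ler_wpM2r M0).
  by have := m10; rewrite -(ler_nat R).
pose a := (1 + t) `^ (- (1 / 8) - n%:R / 4); pose b := (1 + t) `^ (- (r%:R / 4)).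
have a0 : 0 <= a by exact: powR_ge0.
have b0 : 0 <= b by exact: powR_ge0.
have bY : 15 * Num.sqrt K * b <= Y2.
  rewrite /Y2 ler_pM2l ?mulr_gt0 //; apply: ler_powR; first by rewrite lerDl.
  rewrite lerN2 ler_wpM2l // lef_pV2 ?posrE //; last exact: (lt_le_trans _ q4).
have MB : 10 * M <= 200 * K * (a * L) ^+ 2 + 100 * K * (b * Q) ^+ 2.
  have -> : 200 * K * (a * L) ^+ 2 + 100 * K * (b * Q) ^+ 2 =
    10 * (K * (a ^+ 2 * (2 * (10 * L ^+ 2)) + b ^+ 2 * (10 * Q ^+ 2))) by ring.
  rewrite /M ler_pM2l // ler_pM2l //; apply: lerD; last first.
    by rewrite -pr ler_wpM2l ?sqr_ge0.
  have -> : (tau ^+ n.*2)^-1 * (2 / tau * A) = a ^+ 2 * (2 * A).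
    by rewrite /a pn; move: (tau ^+ n.*2)^-1 tau^-1 => x y; ring.
  by apply: ler_wpM2l; [exact: sqr_ge0|rewrite ler_pM2l].
have Y0 : 0 <= Y1 * L + Y2 * Q by apply: addr_ge0; apply: mulr_ge0 => //; exact: ltW.
rewrite -(ger0_norm Y0) -sqrtr_sqr.
apply: ler_wsqrtr; apply: (le_trans SM); apply: (le_trans MB).
have Y1E : Y1 = 15 * Num.sqrt K * a by [].
have kk := sqr_sqrtr (ltW K0).
pose u := Num.sqrt K * (a * L); pose v := Num.sqrt K * (b * Q).
have u0 : 0 <= u by rewrite !mulr_ge0 // ltW.
have v0 : 0 <= v by rewrite !mulr_ge0 // ltW.
apply: (@le_trans _ _ ((15 * u + 15 * v) ^+ 2)).
  have uE : u ^+ 2 = K * (a * L) ^+ 2 by rewrite /u exprMn kk.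
  have vE : v ^+ 2 = K * (b * Q) ^+ 2 by rewrite /v exprMn kk.
  have uv : 0 <= u * v by exact: mulr_ge0.
  have := sqr_ge0 u; have := sqr_ge0 v.
  have -> : (15 * u + 15 * v) ^+ 2 = 225 * u ^+ 2 + 450 * (u * v) + 225 * v ^+ 2 by ring.
  have -> : 200 * K * (a * L) ^+ 2 = 200 * u ^+ 2 by rewrite uE; ring.
  have -> : 100 * K * (b * Q) ^+ 2 = 100 * v ^+ 2 by rewrite vE; ring.
  move: (u ^+ 2) (v ^+ 2) uv => u2 v2; lra.
rewrite ler_sqr ?nnegrE //; last by rewrite addr_ge0 // mulr_ge0.
apply: lerD; first by rewrite Y1E /u; lra.
have -> : 15 * v = 15 * Num.sqrt K * b * Q by rewrite /v; ring.
by rewrite ler_wpM2r.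
Qed.

End vector_solutions.

(** * The systems of Type I and of Type III *)

Section the_two_systems.
Context {R : realType}.
Variables (alpha1 alpha2 rho1 rho2 gamma b k k0 k1 k2 l m1 m2 : R).
Hypotheses (halpha1 : 0 < alpha1) (halpha2 : 0 < alpha2)
  (hrho1 : 0 < rho1) (hrho2 : 0 < rho2) (hgamma : 0 < gamma)
  (hb : 0 < b) (hk : 0 < k) (hk0 : 0 < k0) (hk1 : 0 < k1) (hk2 : 0 < k2)
  (hl : 0 < l) (hm1 : 0 < m1) (hm2 : 0 < m2).

(** In the system of Type I the conductivities [k1] and [k2] are in the place of
    [alpha1] and [alpha2]. *)
Definition coefs_I : coefs R := Coefs hrho1 hrho2 hgamma hb hk hk0 hl hk1 hk2
  (lexx 0) (lexx 0) hm1 hm2.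

Definition coefs_III : coefs R := Coefs hrho1 hrho2 hgamma hb hk hk0 hl halpha1 halpha2
  (ltW hk1) (ltW hk2) hm1 hm2.

Definition entry_I (j : 'I_8) : comp := nth Cv [:: Cv; Cu; Cw; Ct1; Ct2; Cz; CS; CN] j.

Definition entry_III (j : 'I_10) : comp :=
  nth Cv [:: Cv; Cu; Cw; Ct1; Cc1; Ct2; Cc2; Cz; CS; CN] j.

Lemma decay_I s (K q : R) phi psi omega (theta1 theta2 : R -> R -> R) : 0 < K -> 4 <= q ->
  (forall n r, (n + r <= s)%N -> decays coefs_I n r K) ->
  let V := V_I rho1 rho2 gamma b k k0 l m1 m2 phi psi omega theta1 theta2 in
  typeI_solution rho1 rho2 gamma b k k0 l k1 k2 m1 m2 phi psi omega theta1 theta2 ->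
  in_L1 (V 0) -> decay_estimates s (15 * Num.sqrt K) (15 * Num.sqrt K) q V.
Proof.
move=> K0 q4 dec V [[wphi wpsi womega] [Vc [ev_v ev_u ev_w ev_t1 ev_t2]]] V1.
pose z (t x : R) : R := 0.
pose U := unknown coefs_I phi psi omega theta1 theta2 z z.
have ent j t x : V t x 0 j = Num.sqrt (wt coefs_I (entry_I j)) * U (entry_I j) t x.
  by rewrite mxE; case: j; do 8![case=> //].
have pos j : 0 < wt coefs_I (entry_I j).
  by case: j; do 8![case; first by move=> ? /=; rewrite ?divr_gt0].
have cov i : (exists j, entry_I j = i) \/ U i = fun _ _ => 0.
  case: i; try (by right); left.
  - by exists (inord 0); rewrite /entry_I inordK.
  - by exists (inord 1); rewrite /entry_I inordK.
  - by exists (inord 2); rewrite /entry_I inordK.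
  - by exists (inord 3); rewrite /entry_I inordK.
  - by exists (inord 4); rewrite /entry_I inordK.
  - by exists (inord 5); rewrite /entry_I inordK.
  - by exists (inord 6); rewrite /entry_I inordK.
  - by exists (inord 7); rewrite /entry_I inordK.
have Uc := unknowns_continuous ent pos cov Vc.
apply: (vector_decay ent pos cov Vc _ V1) => //.
move=> rho tr; apply: (@mollified_sol R coefs_I phi psi omega theta1 theta2 z z) => //.
- move=> eta te t t0; have [_ /(_ t t0) d] := ev_t1 eta te.
  by apply: (is_derive_eq d); rewrite /= scale0r add0r.
- move=> eta te t t0; have [_ /(_ t t0) d] := ev_t2 eta te.
  by apply: (is_derive_eq d); rewrite /= scale0r add0r.
- move=> eta te t t0; rewrite /ind /= eqxx scale0r.
  exact: (is_derive_cst (dist (fun=> 0 : R) eta) t (1 : R)).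
- move=> eta te t t0; rewrite /ind /= eqxx scale0r.
  exact: (is_derive_cst (dist (fun=> 0 : R) eta) t (1 : R)).
Qed.

Lemma decay_III s (K q : R) phi psi omega (theta1 theta2 : wfun R) : 0 < K -> 4 <= q ->
  (forall n r, (n + r <= s)%N -> decays coefs_III n r K) ->
  let V := V_III rho1 rho2 gamma b k k0 l k1 k2 m1 m2 phi psi omega theta1 theta2 in
  typeIII_solution rho1 rho2 gamma b k k0 l alpha1 alpha2 k1 k2 m1 m2
    phi psi omega theta1 theta2 ->
  in_L1 (V 0) -> decay_estimates s (15 * Num.sqrt K) (15 * Num.sqrt K) q V.
Proof.
move=> K0 q4 dec V [[wphi wpsi womega w1 w2] [Vc [ev_v ev_u ev_w ev_t1 ev_t2]]] V1.
pose U := unknown coefs_III phi psi omega (dt theta1) (dt theta2) (dx theta1) (dx theta2).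
have ent j t x : V t x 0 j = Num.sqrt (wt coefs_III (entry_III j)) * U (entry_III j) t x.
  by rewrite mxE; case: j; do 10![case=> //].
have pos j : 0 < wt coefs_III (entry_III j).
  by case: j; do 10![case; first by move=> ? /=; rewrite ?divr_gt0 ?mulr_gt0].
have cov i : (exists j, entry_III j = i) \/ U i = fun _ _ => 0.
  left; case: i.
  - by exists (inord 0); rewrite /entry_III inordK.
  - by exists (inord 1); rewrite /entry_III inordK.
  - by exists (inord 2); rewrite /entry_III inordK.
  - by exists (inord 3); rewrite /entry_III inordK.
  - by exists (inord 4); rewrite /entry_III inordK.
  - by exists (inord 5); rewrite /entry_III inordK.
  - by exists (inord 6); rewrite /entry_III inordK.
  - by exists (inord 7); rewrite /entry_III inordK.
  - by exists (inord 8); rewrite /entry_III inordK.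
  - by exists (inord 9); rewrite /entry_III inordK.
have Uc := unknowns_continuous ent pos cov Vc.
have dxx (f : wfun R) t eta : is_wfun f -> 0 < t -> test_function eta ->
    ddx (ddx (dist (f t))) eta = ddx (dist (dx f t)) eta.
  by move=> wf t0 te; rewrite /ddx (wfun_dx wf) ?ltW //; exact: test_derive.
apply: (vector_decay ent pos cov Vc _ V1) => //.
move=> rho tr; apply: (@mollified_sol R coefs_III phi psi omega (dt theta1) (dt theta2)
  (dx theta1) (dx theta2)) => //.
- move=> eta te t t0; have [_ /(_ t t0) d] := ev_t1 eta te.
  apply: (is_derive_eq d); congr (_ + _).
  by rewrite -[LHS]/(k1 * ddx (ddx (dist (theta1 t))) eta) dxx.
- move=> eta te t t0; have [_ /(_ t t0) d] := ev_t2 eta te.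
  apply: (is_derive_eq d); congr (_ + _).
  by rewrite -[LHS]/(k2 * ddx (ddx (dist (theta2 t))) eta) dxx.
- move=> eta te t t0; apply: (is_derive_eq (dx_evolution w1 t0 te)).
  by rewrite /ind /= gt_eqF // scale1r.
- move=> eta te t t0; apply: (is_derive_eq (dx_evolution w2 t0 te)).
  by rewrite /ind /= gt_eqF // scale1r.
Qed.

End the_two_systems.

Theorem theorem1p1 (R : realType)
    (alpha1 alpha2 rho1 rho2 gamma b k k0 k1 k2 l m1 m2 : R)
    (halpha1 : 0 < alpha1) (halpha2 : 0 < alpha2)
    (hrho1 : 0 < rho1) (hrho2 : 0 < rho2) (hgamma : 0 < gamma)
    (hb : 0 < b) (hk : 0 < k) (hk0 : 0 < k0) (hk1 : 0 < k1) (hk2 : 0 < k2)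
    (hl : 0 < l) (hm1 : 0 < m1) (hm2 : 0 < m2) (s : nat) :
  exists C1 C2 : R, [/\ 0 < C1, 0 < C2,
    (forall (phi psi omega : wfun R) (theta1 theta2 : R -> R -> R),
       let V1 := V_I rho1 rho2 gamma b k k0 l m1 m2 phi psi omega theta1 theta2 in
       typeI_solution rho1 rho2 gamma b k k0 l k1 k2 m1 m2
         phi psi omega theta1 theta2 ->
       in_Hs s (V1 0) -> in_L1 (V1 0) ->
       (rho1 / rho2 = k / b /\ k = k0 -> decay_estimates s C1 C2 4 V1) /\
       (rho1 / rho2 <> k / b \/ k <> k0 -> decay_estimates s C1 C2 6 V1)) &
    (forall phi psi omega theta1 theta2 : wfun R,
       let V2 := V_III rho1 rho2 gamma b k k0 l k1 k2 m1 m2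
                   phi psi omega theta1 theta2 in
       typeIII_solution rho1 rho2 gamma b k k0 l alpha1 alpha2 k1 k2 m1 m2
         phi psi omega theta1 theta2 ->
       in_Hs s (V2 0) -> in_L1 (V2 0) ->
       (rho1 / rho2 = k / b /\ k = k0 -> decay_estimates s C1 C2 4 V2) /\
       (rho1 / rho2 <> k / b \/ k <> k0 -> decay_estimates s C1 C2 6 V2))].
Proof.
pose p1 := coefs_I hrho1 hrho2 hgamma hb hk hk0 hk1 hk2 hl hm1 hm2.
pose p3 := coefs_III halpha1 halpha2 hrho1 hrho2 hgamma hb hk hk0 hk1 hk2 hl hm1 hm2.
have [K1 [K10 D1]] := uniform_decay p1 s; have [K3 [K30 D3]] := uniform_decay p3 s.
have K0 : 0 < K1 + K3 by exact: addr_gt0.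
have C0 : 0 < 15 * Num.sqrt (K1 + K3) by rewrite mulr_gt0 // sqrtr_gt0.
have d1 n r : (n + r <= s)%N -> decays p1 n r (K1 + K3).
  by move=> nr; apply: D1 => //; rewrite lerDl ltW.
have d3 n r : (n + r <= s)%N -> decays p3 n r (K1 + K3).
  by move=> nr; apply: D3 => //; rewrite lerDr ltW.
have q6 : 4 <= 6 :> R by rewrite ler_nat.
exists (15 * Num.sqrt (K1 + K3)), (15 * Num.sqrt (K1 + K3)); split=> //.
- by move=> phi psi omega theta1 theta2 V1 solV _ L1V; split=> _; exact: (decay_I K0 _ d1).
- by move=> phi psi omega theta1 theta2 V2 solV _ L1V; split=> _; exact: (decay_III K0 _ d3).
Qed.
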